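(* Let $D=[-H,H]$ with $H>0$, let $v_\infty\in\mathbb{R}$ be given, and assume: (A1) $\mu:\mathbb{R}^2\to\mathbb{R}$ is continuous, $\mu(\cdot,\theta)$ is non-decreasing on $[0,+\infty)$ and non-increasing on $(-\infty,0]$, and $\inf_{\theta\in\mathbb{R}}\mu(0,\theta)>0$. (A2) $\mathbb{C}:\mathbb{R}\to\mathbb{R}$ is continuously differentiable, $\mathbb{C}'([1,\infty))=0$, and $\inf_{\alpha\in\mathbb{R}}\mathbb{C}(\alpha)>0$. (A3) $f_0,f_1$ are continuous and non-negative, $f_1'(\theta)>0$, $f_1(0)=0$, $f_0'(\theta)<0$, $f_0(\theta_\infty)=0$. (A4) $\kappa>0$, $\ell>0$, $\eta>0$. (A5) There is a continuous superlinear function $\varPhi:\mathbb{R}\to[0,\infty)$ such that $R(\pi,\theta)\ge\varPhi(\pi)$ for all $(\pi,\theta)$. (A6) $|\mu(\pi,\theta)-\mu(\pi,\tilde\theta)|\le o(|\theta-\tilde\theta|)$ with some continuous $o:\mathbb{R}^+\to\mathbb{R}^+$ satisfying $o(0)=0$. For each $\eta>0$ let $(\varepsilon_\eta,v_\eta,\pi_\eta,\alpha_\eta,\theta_\eta,\sigma_\eta)$ be the solution of the steady-state problem $(P_\eta)$ obtained as a Schauder fixed point as described in the context. Then there is a subsequence ($\eta\to0$) such that, for some $\pi\in L^1(D)$, $v\in W^{1,1}(D)$, $\alpha\in W^{2,\infty}(D)$, $\varepsilon\in W^{1,\infty}(D)$, $\theta\in W^{1,\infty}(D)$, and $\sigma\in\mathbb{R}$,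 it holds \begin{align*} &\varepsilon_\eta\to\varepsilon \ \text{ weakly* in } W^{2,\infty}(D), \qquad v_\eta\to v\ \text{ weakly in } W^{1,1}(D),\qquad \pi_\eta\to\pi\ \text{ weakly in } L^1(D),\\ &\alpha_\eta\to\alpha\ \text{ weakly* in } W^{2,\infty}(D),\qquad \theta_\eta\to\theta\ \text{ strongly in } H^1(D),\qquad \sigma_\eta\to\sigma\ \text{ in }\mathbb{R}, \end{align*} and $\pi(x)=\varPi(\sigma,\theta(x))$ for a.a. $x\in D$. Moreover, $(\varepsilon,v,\pi,\alpha,\theta,\sigma)$ is a classical solution of the steady-state problem with $\eta=0$ (where the boundary condition $\pi(\pm H)=0$ is omitted), in the sense that $$(\mathbb{C}(\alpha)\varepsilon)_x=0\ \text{ with }\ \mathbb{C}(\alpha)\varepsilon=\sigma,\quad \pi=v_x,\quad \tfrac12\mathbb{C}'(\alpha)\varepsilon^2+G_{\rm c}\tfrac{\alpha-1}{\ell^2}=G_{\rm c}\ell^2\alpha_{xx},\quad |\pi|f_1(\theta)-f_0(\theta)=\kappa\theta_{xx},$$ $$R(\tilde\pi,\theta)-\sigma(\tilde\pi-\pi)\ge R(\pi,\theta)\quad\forall\,\tilde\pi\in\mathbb{R},$$ hold pointwise everywhere on $D$, together with $v(\pm H)=\pm v_\infty$, $\alpha(\pm H)=1$, $\theta(\pm H)=\theta_\infty$. More specifically, $\pi\in C(D)$ and $v\in C^1(D)$.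
   Context: The problem is a one-dimensional steady-state model of a fault with velocity $v$, plastic strain rate $\pi$, elastic strain $\varepsilon$, damage $\alpha$, aging $\theta$ and stress $\sigma$; $\theta_\infty$ and the fracture toughness $G_{\rm c}$ are given constants, and a subscript $x$ denotes the derivative in $x$. $\mathrm{Sign}$ is the set-valued sign: $\mathrm{Sign}(\pi)=\{1\}$ for $\pi>0$, $[-1,1]$ for $\pi=0$, $\{-1\}$ for $\pi<0$. $R(\cdot,\theta)$ is the convex dissipation potential with $R(0,\theta)=0$ and $\partial_\pi R(\pi,\theta)=\mu(\pi,\theta)\,\mathrm{Sign}(\pi)$. Superlinear means $\varPhi(\pi)/|\pi|\to\infty$ as $|\pi|\to\infty$. By the strict convexity of $\pi\mapsto R(\pi,\theta)$, which the paper refers to (A1), the set-valued mapping $\pi\mapsto\mu(\pi,\theta)\,\mathrm{Sign}(\pi)$ is strictly monotone, so that $\pi$ with $\mu(\pi,\theta)\,\mathrm{Sign}(\pi)\ni\sigma$ is uniquely determined as a function of $\sigma$ and $\theta$, denoted $\pi=\varPi(\sigma,\theta)$; the map $\varPi:\mathbb{R}^2\to\mathbb{R}$ is continuous. Problem $(P_\eta)$, $\eta>0$: find $(\varepsilon,v,\pi,\alpha,\theta)$ on $D$ and the constant $\sigma=\mathbb{C}(\alpha)\varepsilon\in\mathbb{R}$ such that $$(\mathbb{C}(\alpha)\varepsilon)_x=0,\quad \pi=v_x,\quad \mu(\pi,\theta)\,\mathrm{Sign}(\pi)\ni\mathbb{C}(\alpha)\varepsilon+\eta\pi_{xx},$$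 $$\tfrac12\mathbb{C}'(\alpha)\varepsilon^2+G_{\rm c}\tfrac{\alpha-1}{\ell^2}=G_{\rm c}\ell^2\alpha_{xx},\quad |\pi|f_1(\theta)-f_0(\theta)=\kappa\theta_{xx},$$ $$v(\pm H)=\pm v_\infty,\quad \pi(\pm H)=0,\quad \alpha(\pm H)=1,\quad \theta(\pm H)=\theta_\infty .$$ Fixed-point solutions: let $\varphi_0,\varphi_1$ be primitives of $f_0,f_1$. For given $\theta$ let $S_{\mathcal B}(\theta)$ be the unique minimizer of $\pi\mapsto\int_D R(\pi,\theta)+\frac\eta2\pi_x^2\,dx$ on $\{\pi\in H^1_0(D):\int_D\pi\,dx=2v_\infty\}$, and for given $\pi$ let $S_{\mathcal A}(\pi)$ be the unique minimizer of $\theta\mapsto\int_D|\pi|\varphi_1(\theta)-\varphi_0(\theta)+\frac\kappa2\theta_x^2\,dx$ on $\{\theta\in H^1(D):\theta(\pm H)=\theta_\infty\}$. The solution of $(P_\eta)$ referred to in the claim is one for which $\theta_\eta=S_{\mathcal A}(S_{\mathcal B}(\theta_\eta))$, $\pi_\eta=S_{\mathcal B}(\theta_\eta)$, $\sigma_\eta$ is the Lagrange multiplier of the constraint $\int_D\pi\,dx=2v_\infty$ (so that $\mu(\pi_\eta,\theta_\eta)\,\mathrm{Sign}(\pi_\eta)\ni\sigma_\eta+\eta(\pi_\eta)_{xx}$), $\alpha_\eta$ solves $\frac{\mathbb{C}'(\alpha)}{2\mathbb{C}^2(\alpha)}\sigma_\eta^2+G_{\rm c}\frac{\alpha-1}{\ell^2}=G_{\rm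 c}\ell^2\alpha_{xx}$ with $\alpha(\pm H)=1$, $\varepsilon_\eta=\sigma_\eta/\mathbb{C}(\alpha_\eta)$, and $v_\eta$ is determined by $(v_\eta)_x=\pi_\eta$ and $v_\eta(\pm H)=\pm v_\infty$.
   Formalization: ε_η→ε is stated weakly* in W^{1,∞}(D), not W^{2,∞}(D) (false for C merely C^1); in (A3) f_0,f_1 are non-negative only on [0,θ_∞], since f_1(0)=0, f_1'>0 rule it out on all of R; G_c>0 is assumed. *)

(* Defs.v *)
From HB Require Import structures.
From mathcomp Require Export all_boot all_order all_algebra.
From mathcomp Require Export all_classical all_reals all_analysis.
Set Implicit Arguments.
Unset Strict Implicit.
Unset Printing Implicit Defensive.
Export Order.TTheory GRing.Theory Num.Theory numFieldNormedType.Exports.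

Local Open Scope classical_set_scope.
Local Open Scope ring_scope.

Definition dom {R : realType} (H : R) : set R := `[- H, H].

Definition Lp {R : realType} (H : R) (p : \bar R) (f : R -> R) : Prop :=
  (f \_ (dom H)) \in Lfun (@lebesgue_measure R) p.

(* phi is in C^1_c(]-H, H[); as in Brezis, these are the test functions of the
   one-dimensional Sobolev spaces. *)
Definition test_fun {R : realType} (H : R) (phi : R -> R) : Prop :=
  [/\ forall x, derivable phi x 1, continuous (derive1 phi)
    & exists2 a, a < H & forall x, a < `|x| -> phi x = 0].

Definition is_weak_deriv {R : realType} (H : R) (f g : R -> R) : Prop :=
  [/\ Lp H 1 f, Lp H 1 g & forall phi, test_fun H phi ->
      \int[lebesgue_measure]_(x in dom H) (f x * derive1 phi x) =
      - \int[lebesgue_measure]_(x in dom H) (g x * phi x)].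

(* A representative of the weak derivative (unique up to null sets); the
   function 0 if f is not weakly differentiable. *)
Definition wderiv {R : realType} (H : R) (f : R -> R) : R -> R :=
  xget (fun=> 0) [set g | is_weak_deriv H f g].

(* W^{k,p}(D), an element of W^{k,p}(D) with k >= 1 being identified with its
   continuous representative, so that boundary values make sense. *)
Fixpoint sobolev {R : realType} (H : R) (k : nat) (p : \bar R) (f : R -> R)
    : Prop :=
  if k is k'.+1 then
    [/\ {within dom H, continuous f}, Lp H p f
      & exists2 g, is_weak_deriv H f g & sobolev H k' p g]
  else Lp H p f.

(* Weak* convergence in L^oo = (L^1)', and in W^{k,oo} derivative by
   derivative. *)
Definition wstar_Loo {R : realType} (H : R) (f_ : nat -> R -> R) (f : R -> R)
    : Prop :=
  forall g, Lp H 1 g ->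
    \int[lebesgue_measure]_(x in dom H) (f_ n x * g x) @[n --> \oo] -->
    \int[lebesgue_measure]_(x in dom H) (f x * g x).

Definition wstar_W1oo {R : realType} (H : R) (f_ : nat -> R -> R) (f : R -> R)
    : Prop :=
  [/\ forall n, sobolev H 1 +oo%E (f_ n), sobolev H 1 +oo%E f,
      wstar_Loo H f_ f
    & wstar_Loo H (fun n => wderiv H (f_ n)) (wderiv H f)].

Definition wstar_W2oo {R : realType} (H : R) (f_ : nat -> R -> R) (f : R -> R)
    : Prop :=
  [/\ forall n, sobolev H 2 +oo%E (f_ n), sobolev H 2 +oo%E f,
      wstar_Loo H f_ f,
      wstar_Loo H (fun n => wderiv H (f_ n)) (wderiv H f)
    & wstar_Loo H (fun n => wderiv H (wderiv H (f_ n)))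
        (wderiv H (wderiv H f))].

Definition weak_L1 {R : realType} (H : R) (f_ : nat -> R -> R) (f : R -> R)
    : Prop :=
  [/\ forall n, Lp H 1 (f_ n), Lp H 1 f & forall g, Lp H +oo%E g ->
      \int[lebesgue_measure]_(x in dom H) (f_ n x * g x) @[n --> \oo] -->
      \int[lebesgue_measure]_(x in dom H) (f x * g x)].

Definition weak_W11 {R : realType} (H : R) (f_ : nat -> R -> R) (f : R -> R)
    : Prop :=
  [/\ forall n, sobolev H 1 1 (f_ n), sobolev H 1 1 f, weak_L1 H f_ f
    & weak_L1 H (fun n => wderiv H (f_ n)) (wderiv H f)].

Definition strong_L2 {R : realType} (H : R) (f_ : nat -> R -> R) (f : R -> R)
    : Prop :=
  Lnorm lebesgue_measure 2%:E (EFin \o ((f_ n \- f) \_ (dom H)))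
    @[n --> \oo] --> 0%E.

Definition strong_H1 {R : realType} (H : R) (f_ : nat -> R -> R) (f : R -> R)
    : Prop :=
  [/\ forall n, sobolev H 1 2%:E (f_ n), sobolev H 1 2%:E f, strong_L2 H f_ f
    & strong_L2 H (fun n => wderiv H (f_ n)) (wderiv H f)].

(* Derivative relative to D: one-sided at the end points. *)
Definition deriv_on {R : realType} (D : set R) (f g : R -> R) : Prop :=
  forall x, D x -> (f y - f x) / (y - x) @[y --> within D x^'] --> g x.

Definition C1_on {R : realType} (D : set R) (f : R -> R) : Prop :=
  exists2 g, deriv_on D f g & {within D, continuous g}.

Definition Sign {R : realType} (p : R) : set R :=
  if 0 < p then [set 1] else if p < 0 then [set -1] else [set z | -1 <= z <= 1].

(* The set mu(p, t) Sign(p). *)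
Definition friction {R : realType} (mu : R -> R -> R) (p t : R) : set R :=
  [set mu p t * z | z in Sign p].

Definition strictly_convex {R : realType} (f : R -> R) : Prop :=
  forall p q l, p != q -> 0 < l -> l < 1 ->
    f (l * p + (1 - l) * q) < l * f p + (1 - l) * f q.

Definition subdiff {R : realType} (f : R -> R) (p : R) : set R :=
  [set s | forall q, f p + s * (q - p) <= f q].

Definition dissipation_potential {R : realType} (mu Rd : R -> R -> R) : Prop :=
  forall t, Rd 0 t = 0 /\ forall p, subdiff (Rd ^~ t) p = friction mu p t.

(* The map Pi : (s, t) |-> the p such that mu(p, t) Sign(p) contains s. *)
Definition flow_map {R : realType} (mu : R -> R -> R) (s t : R) : R :=
  xget 0 [set p | friction mu p t s].

Definition superlinear {R : realType} (Phi : R -> R) : Prop :=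
  (Phi p / `|p| @[p --> +oo] --> +oo) /\ (Phi p / `|p| @[p --> -oo] --> +oo).

(* The equation (C(al) ep)_x = 0 is expressed by C(al) ep being the constant s.
   The remaining differential relations are understood almost everywhere, with
   weak derivatives. *)
Definition steady_state {R : realType}
    (H vinf thinf kappa ell Gc : R) (mu : R -> R -> R) (C f0 f1 : R -> R)
    (eta : R) (ep v p al th : R -> R) (s : R) : Prop :=
  [/\ [/\ sobolev H 1 1 v, sobolev H 2 1 p, sobolev H 2 1 al
        & sobolev H 2 1 th],
      (forall x, dom H x -> C (al x) * ep x = s) /\ is_weak_deriv H v p,
      {ae lebesgue_measure, forall x, dom H x ->
         friction mu (p x) (th x)
           (C (al x) * ep x + eta * wderiv H (wderiv H p) x)},
      {ae lebesgue_measure, forall x, dom H x ->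
         2^-1 * derive1 C (al x) * ep x ^+ 2 + Gc * ((al x - 1) / ell ^+ 2)
         = Gc * ell ^+ 2 * wderiv H (wderiv H al) x} /\
      {ae lebesgue_measure, forall x, dom H x ->
         `|p x| * f1 (th x) - f0 (th x) = kappa * wderiv H (wderiv H th) x}
    & [/\ v (- H) = - vinf /\ v H = vinf, p (- H) = 0 /\ p H = 0,
          al (- H) = 1 /\ al H = 1 & th (- H) = thinf /\ th H = thinf]].

Definition H10 {R : realType} (H : R) (p : R -> R) : Prop :=
  [/\ sobolev H 1 2%:E p, p (- H) = 0 & p H = 0].

Definition energyB {R : realType} (H eta : R) (Rd : R -> R -> R)
    (th p : R -> R) : R :=
  \int[lebesgue_measure]_(x in dom H)
    (Rd (p x) (th x) + eta / 2 * wderiv H p x ^+ 2).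

(* p = S_B(th) *)
Definition is_SB {R : realType} (H vinf eta : R) (Rd : R -> R -> R)
    (th p : R -> R) : Prop :=
  let adm q :=
    H10 H q /\ \int[lebesgue_measure]_(x in dom H) q x = 2 * vinf in
  adm p /\ forall q, adm q -> energyB H eta Rd th p <= energyB H eta Rd th q.

(* s is a Lagrange multiplier of the constraint on the integral at the
   minimizer p: p minimizes the Lagrangian over the whole of H^1_0. *)
Definition lagrange_multiplier {R : realType} (H vinf eta : R)
    (Rd : R -> R -> R) (th p : R -> R) (s : R) : Prop :=
  let lagrangian q := energyB H eta Rd th q
    - s * (\int[lebesgue_measure]_(x in dom H) q x - 2 * vinf) in
  forall q, H10 H q -> lagrangian p <= lagrangian q.

Definition energyA {R : realType} (H kappa : R) (phi0 phi1 : R -> R)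
    (p th : R -> R) : R :=
  \int[lebesgue_measure]_(x in dom H)
    (`|p x| * phi1 (th x) - phi0 (th x) + kappa / 2 * wderiv H th x ^+ 2).

(* th = S_A(p) *)
Definition is_SA {R : realType} (H thinf kappa : R) (phi0 phi1 : R -> R)
    (p th : R -> R) : Prop :=
  let adm q := [/\ sobolev H 1 2%:E q, q (- H) = thinf & q H = thinf] in
  adm th /\ forall q, adm q ->
    energyA H kappa phi0 phi1 p th <= energyA H kappa phi0 phi1 p q.

(* The solutions of the regularized problem that are constructed from a fixed
   point th = S_A(S_B(th)), with p = S_B(th). *)
Definition fixed_point_solution {R : realType}
    (H vinf thinf kappa ell Gc : R) (mu Rd : R -> R -> R)
    (C f0 f1 phi0 phi1 : R -> R)
    (eta : R) (ep v p al th : R -> R) (s : R) : Prop :=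
  [/\ steady_state H vinf thinf kappa ell Gc mu C f0 f1 eta ep v p al th s,
      is_SB H vinf eta Rd th p /\ is_SA H thinf kappa phi0 phi1 p th,
      lagrange_multiplier H vinf eta Rd th p s,
      {ae lebesgue_measure, forall x, dom H x ->
         derive1 C (al x) / (2 * C (al x) ^+ 2) * s ^+ 2
           + Gc * ((al x - 1) / ell ^+ 2)
         = Gc * ell ^+ 2 * wderiv H (wderiv H al) x}
    & forall x, dom H x -> ep x = s / C (al x)].

Definition classical_limit_solution {R : realType}
    (H vinf thinf kappa ell Gc : R) (Rd : R -> R -> R) (C f0 f1 : R -> R)
    (ep v p al th : R -> R) (s : R) : Prop :=
  [/\ (forall x, dom H x -> C (al x) * ep x = s) /\
      deriv_on (dom H) (fun x => C (al x) * ep x) (fun=> 0),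
      deriv_on (dom H) v p,
      (exists al' al'' : R -> R,
        [/\ deriv_on (dom H) al al', deriv_on (dom H) al' al''
          & forall x, dom H x ->
            2^-1 * derive1 C (al x) * ep x ^+ 2 + Gc * ((al x - 1) / ell ^+ 2)
            = Gc * ell ^+ 2 * al'' x]) /\
      (exists th' th'' : R -> R,
        [/\ deriv_on (dom H) th th', deriv_on (dom H) th' th''
          & forall x, dom H x ->
            `|p x| * f1 (th x) - f0 (th x) = kappa * th'' x]),
      (forall x, dom H x -> forall q,
        Rd (p x) (th x) <= Rd q (th x) - s * (q - p x))
    & [/\ v (- H) = - vinf /\ v H = vinf, al (- H) = 1 /\ al H = 1
        & th (- H) = thinf /\ th H = thinf]].

(* Main.v *)
Require Import Defs.
From mathcomp Require Import ring lra measurable_realfun ess_sup_inf.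

Local Open Scope classical_set_scope.
Local Open Scope ring_scope.

Set Implicit Arguments.
Unset Strict Implicit.
Unset Printing Implicit Defensive.

(** Comparing the Lagrangian at the minimizer with multiples of a fixed bump
    bounds the stress and the dissipated energy, hence the strain rates in L^1;
    the maximum principle bounds the aging, and the first integral of the
    autonomous damage equation bounds the damage.  Aging and damage are then
    equi-Lipschitz, and a subsequence of them converges uniformly together with
    the stress.

    Uniform integrability and the Dunford-Pettis theorem are not needed: the
    strain rates converge strongly in L^1 to [flow_map mu s (th x)].  Indeed, the
    Lagrangian inequality shows that the integral of R(p_n, th) - s p_n tends to
    that of its pointwise minimum, and by strict convexity R(q, th) - s q grows
    at least linearly in the distance of q to the minimizer, uniformly in x.

    With the strain rates converging in L^1 and everything else uniformly, the
    second derivatives of aging and damage converge in L^1, so that their first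
    derivatives converge uniformly and the limits are of class C^2. *)

(** * Integration over the domain *)

Section Basics.
Context {R : realType}.
Notation mu := (@lebesgue_measure R).
Implicit Types (H M e : R) (f g : R -> R).

(** The aging equation contains the modulus of the strain rate, so weak convergence of the strain
    rates would not pass to the limit in it; this is why strong convergence in L^1 is sought.
    Compactness comes from the limit problem itself: its pointwise minimizer is unique, so it can be
    written down as soon as stress and aging have converged, and no limit of the strain rates has to
    be extracted. That minimizer is continuous but need not vanish at the end points, so it enters
    the Lagrangian only through approximations in H^1_0. The gradient term of such a fixed
    approximation disappears with eta, while that of the regularized minimizer is dropped for its
    sign.

    The differential relations hold almost everywhere, for chosen representatives of weak
    derivatives. Since the second derivatives they prescribe are continuous, damage and aging are
    identified on D with C^2 functions on the whole line, and from then on ordinary calculus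
    applies. *)

Lemma inf_le (A : set R) x : 0 < inf A -> A x -> inf A <= x.
Proof.
move=> A0 Ax; apply: ge_inf => //.
have [//|hn] := pselect (has_lbound A).
(* [inf] defaults to 0 on a nonempty set without lower bound, which positivity excludes. *)
by move: A0; rewrite inf_out ?ltxx// => -[_]; exact: hn.
Qed.

Definition integ H f := mu.-integrable (dom H) (EFin \o f).

Lemma domE H x : dom H x <-> (- H <= x <= H).
Proof. by rewrite /dom /= in_itv. Qed.

Lemma dom_measurable H : measurable (dom H).
Proof. exact: measurable_itv. Qed.
Lemma dom_measurable_ocitv H :
  @measurable _ (g_sigma_algebraType (R.-ocitv.-measurable)) (dom H).
Proof. exact: dom_measurable. Qed.
Hint Resolve dom_measurable dom_measurable_ocitv : core.

Lemma ae_imply (P Q : R -> Prop) : (forall x, P x -> Q x) ->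
  {ae mu, forall x, P x} -> {ae mu, forall x, Q x}.
Proof. by move=> PQ; apply: filterS; first exact: (ae_filter_ringOfSetsType mu). Qed.

Lemma ae_imply2 (P Q S : R -> Prop) : (forall x, P x -> Q x -> S x) ->
  {ae mu, forall x, P x} -> {ae mu, forall x, Q x} -> {ae mu, forall x, S x}.
Proof. by move=> PQ; apply: filterS2; first exact: (ae_filter_ringOfSetsType mu). Qed.

Lemma ae_interior H : {ae mu, forall x : R, dom H x -> - H < x < H}.
Proof.
have ne0 z : {ae mu, forall x, x <> z}.
  exists [set z]; split; [exact: measurable_set1|exact: lebesgue_measure_set1|].
  by move=> x /= /contrapT.
apply: ae_imply2 (ne0 H) (ne0 (- H)) => x /eqP xH /eqP xNH /domE /andP[x1 x2].
by rewrite !lt_neqAle x1 x2 xH eq_sym xNH.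
Qed.

Lemma mu_dom H : 0 < H -> mu (dom H) = (H + H)%:E.
Proof.
move=> H0; rewrite lebesgue_measure_itv /= lte_fin ifT ?gtrN//.
by rewrite -EFinD opprK.
Qed.

Lemma cont_integ H f : {within dom H, continuous f} -> integ H f.
Proof. by move=> cf; apply: continuous_compact_integrable => //; exact: segment_compact. Qed.

Lemma Lp1P H f : Lp H 1 f <-> integ H f.
Proof.
rewrite /Lp /integ; have := @integrable_mkcond _ _ _ mu (dom H) (EFin \o f) (@dom_measurable H).
rewrite restrict_EFin => -[h1 h2]; split.
  by move/Lfun1_integrable; exact: h2.
by move=> h; apply/Lfun1_integrable; exact: h1.
Qed.

Lemma Lp_measurable H p f : Lp H p f -> measurable_fun (dom H) f.
Proof.
move=> /andP[]; rewrite inE/= => mf _.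
by apply/(measurable_restrictT f) => //.
Qed.

Lemma integ_measurable H f : integ H f -> measurable_fun (dom H) f.
Proof. by move/Lp1P; exact: Lp_measurable. Qed.

Lemma integral_cst_dom H M : 0 < H -> \int[mu]_(x in dom H) M = M * (H + H).
Proof.
move=> H0; rewrite Rintegral_cst//; congr (_ * _).
exact: (congr1 fine (mu_dom H0)).
Qed.

Lemma Lnorm2_le H f e : 0 < H -> 0 <= e -> measurable_fun (dom H) f ->
  {ae mu, forall x, dom H x -> `|f x| <= e} ->
  (Lnorm mu 2%:E (EFin \o (f \_ (dom H))) <= (((e ^+ 2) * (H + H)) `^ 2^-1)%:E)%E.
Proof.
move=> H0 e0 mf fe; rewrite unlock -poweR_EFin.
have mfD : measurable_fun setT (f \_ (dom H))
  by exact: (measurable_restrictT f (@dom_measurable H)).1.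
apply: gt0_ler_poweR.
- by rewrite invr_ge0.
- rewrite in_itv /= leey andbT; apply: integral_ge0 => x _.
  by rewrite ?lee_fin ?powR_ge0 ?poweR_ge0.
- rewrite in_itv /= leey andbT lee_fin mulr_ge0// ?exprn_ge0//.
  by rewrite addr_ge0// ltW.
apply: (@le_trans _ _ (\int[mu]_x ((cst (e ^+ 2)%:E) \_ (dom H)) x)%E).
  apply: ae_ge0_le_integral => //=.
  - apply/measurable_EFinP.
    by apply: (measurableT_comp (measurable_powR _)) => //; exact: measurableT_comp.
  - by move=> x _; rewrite patchE; case: ifP => //; rewrite lee_fin exprn_ge0.
  - exact: (measurable_restrictT _ (@dom_measurable H)).1.
  apply: ae_imply fe => x fe _; rewrite /= !patchE; case: ifPn => xD.
    rewrite lee_fin -(@powR_mulrn _ _ 2)//.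
    by apply: ge0_ler_powR => //; rewrite ?nnegrE//; apply: fe; exact/set_mem.
  by rewrite normr0 powR0.
rewrite -integral_mkcond integral_cst//.
apply: (eq_ind _ (fun z => (_ * z <= _)%E) _ _ (esym (mu_dom H0))).
by rewrite -EFinM.
Qed.

Lemma ae_bounded_Lp2 H f e : 0 < H -> measurable_fun (dom H) f ->
  {ae mu, forall x, dom H x -> `|f x| <= e} -> Lp H 2%:E f.
Proof.
move=> H0 mf fe; apply/andP; split; rewrite inE /=.
  exact: (measurable_restrictT f (@dom_measurable H)).1.
rewrite /finite_norm; apply: le_lt_trans (ltry _).
apply: (@Lnorm2_le _ _ `|e|) => //.
by apply: ae_imply fe => x fe /fe /le_trans; apply; exact: ler_norm.
Qed.

Lemma bounded_Lpoo H f M : 0 < H -> measurable_fun (dom H) f ->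
  (forall x, dom H x -> `|f x| <= M) -> Lp H +oo%E f.
Proof.
move=> H0 mf fM; apply/andP; split; rewrite inE /=.
  exact: (measurable_restrictT f (@dom_measurable H)).1.
rewrite /finite_norm unlock; case: ifP => // _.
apply: (@le_lt_trans _ _ `|M|%:E); last exact: ltry.
apply/ess_supP; apply: aeW => x /=; rewrite lee_fin patchE; case: ifPn => xD.
  by apply: le_trans (ler_norm _); apply: fM; exact/set_mem.
by rewrite normr0.
Qed.

Lemma Lpoo_bounded H f : Lp H +oo%E f ->
  exists2 M, 0 <= M & {ae mu, forall x, dom H x -> `|f x| <= M}.
Proof.
move=> /andP[_]; rewrite inE /= /finite_norm unlock.
case: ifPn => [_|].
  move=> foo; exists `|fine (ess_sup mu (abse \o (EFin \o (f \_ (dom H)))))| => //.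
  have := ess_sup_ge mu (abse \o (EFin \o (f \_ (dom H)))).
  apply: ae_imply => x /= xle Dx; move: xle foo.
  rewrite patchE mem_set//; case: ess_sup => //= r; rewrite lee_fin => xr _.
  by apply: le_trans xr _; exact: ler_norm.
(* The norm of exponent [+oo] is an essential supremum only if the whole space has positive measure;
   otherwise it is a default value. *)
move/negP; case; suff : (0 < mu [set: R])%E by [].
apply: (@lt_le_trans _ _ (mu (dom 1))); first by rewrite mu_dom// lte_fin addr_gt0.
by apply: le_measure; rewrite ?inE.
Qed.

Lemma continuous_Lp H f : 0 < H -> {within dom H, continuous f} ->
  [/\ Lp H 1 f, Lp H 2%:E f & Lp H +oo%E f].
Proof.
move=> H0 cf; have iF := cont_integ cf; have mf := integ_measurable iF.
have [M fM] : exists M, forall x, dom H x -> `|f x| <= M.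
  have /compact_bounded[M [Mr Mf]] : compact (f @` dom H).
    by apply: continuous_compact => //; exact: segment_compact.
  exists (M + 1) => x Dx; apply: Mf; first by rewrite ltrDl.
  by exists x.
split; first exact/Lp1P.
  by apply: (@ae_bounded_Lp2 _ _ M) => //; exact: aeW.
exact: bounded_Lpoo fM.
Qed.

End Basics.
#[global] Hint Resolve dom_measurable dom_measurable_ocitv : core.

(** * Continuously differentiable functions *)

Section Calculus.
Context {R : realType}.
Notation mu := (@lebesgue_measure R).
Implicit Types (H M e a b x y : R) (f g F : R -> R).

(* Functions on the interval D are handled as restrictions of functions that are
   continuously differentiable on the whole line, so that one-sided derivatives
   only appear in [C1_deriv_on]. *)
Definition C1 F g := (forall x, is_derive x 1 F (g x)) /\ continuous g.

Lemma C1_cont F g : C1 F g -> continuous F.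
Proof.
move=> [dF _] x; apply: differentiable_continuous.
by rewrite -derivable1_diffP; case: (dF x).
Qed.

Lemma C1_derive1 F g : C1 F g -> derive1 F = g.
Proof. by move=> [dF _]; apply/funext => x; rewrite derive1E; case: (dF x). Qed.

Lemma C1_MVT F g a b : C1 F g -> a <= b ->
  exists2 c, a <= c <= b & F b - F a = g c * (b - a).
Proof.
move=> FC ab; have [|c] := @MVT_segment _ F g a b ab (fun x _ => FC.1 x).
  by apply: continuous_subspaceT; exact: (C1_cont FC).
by rewrite in_itv /=; exists c.
Qed.

Lemma C1_LR F g a b : C1 F g -> derivable_oo_LRcontinuous F a b.
Proof.
move=> FC; split => [x _||]; first by case: (FC.1 x).
  by apply: cvg_at_right_filter; exact: (C1_cont FC).
by apply: cvg_at_left_filter; exact: (C1_cont FC).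
Qed.

Lemma C1_FTC F g a b : C1 F g -> a <= b ->
  \int[mu]_(x in `[a, b]) g x = F b - F a.
Proof.
move=> FC; rewrite le_eqVlt => /predU1P[->|ab].
  by rewrite set_itv1 Rintegral_set1 subrr.
rewrite /Rintegral (@continuous_FTC2 _ g F)//.
- by apply: continuous_subspaceT; exact: FC.2.
- exact: (C1_LR a b FC).
- by move=> x _; rewrite (C1_derive1 FC).
Qed.

Lemma C1D F f G g : C1 F f -> C1 G g -> C1 (fun x => F x + G x) (fun x => f x + g x).
Proof.
move=> [dF cf] [dG cg]; split => x; last by apply: cvgD; [exact: cf|exact: cg].
exact: is_deriveD.
Qed.

Lemma C1Z c F f : C1 F f -> C1 (fun x => c * F x) (fun x => c * f x).
Proof.
move=> [dF cf]; split => x; last by apply: cvgM; [exact: cvg_cst|exact: cf].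
exact: is_deriveZ.
Qed.

Lemma C1B F f G g : C1 F f -> C1 G g -> C1 (fun x => F x - G x) (fun x => f x - g x).
Proof.
move=> [dF cf] [dG cg]; split => x; last by apply: cvgB; [exact: cf|exact: cg].
exact: is_deriveB.
Qed.

Lemma C1M F f G g : C1 F f -> C1 G g ->
  C1 (fun x => F x * G x) (fun x => F x * g x + G x * f x).
Proof.
move=> FC GC; split => x; last first.
  apply: cvgD; apply: cvgM; [exact: (C1_cont FC)|exact: GC.2|exact: (C1_cont GC)|exact: FC.2].
by have := @is_deriveM _ _ F G x 1 (f x) (g x) (FC.1 x) (GC.1 x).
Qed.

Lemma C1_cst c : C1 (fun=> c) (fun=> 0).
Proof. by split=> x; [exact: is_derive_cst|exact: cvg_cst]. Qed.

Lemma C1_id : C1 id (fun=> 1).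
Proof. by split=> x; [exact: is_derive_id|exact: cvg_cst]. Qed.

Lemma C1_comp F f G g : C1 F f -> C1 G g ->
  C1 (fun x => G (F x)) (fun x => f x * g (F x)).
Proof.
move=> FC GC; split => x; last first.
  apply: cvgM; first exact: FC.2.
  by apply: continuous_comp; [exact: (C1_cont FC)|exact: GC.2].
have := @is_derive1_comp _ G F x (g (F x)) (f x).
by rewrite /= mulrC; apply; [exact: GC.1|exact: FC.1].
Qed.

Lemma C1V F f : C1 F f -> (forall x, F x != 0) ->
  C1 (fun x => (F x)^-1) (fun x => - (f x / F x ^+ 2)).
Proof.
move=> FC F0; split => x; last first.
  apply: cvgN; apply: cvgM; first exact: FC.2.
  apply: cvgV; first by rewrite expf_eq0 F0.
  by apply: (@cvgM _ _ _ _ F F) ; exact: (C1_cont FC).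
have := @is_deriveV _ F x (f x) 1 (F0 x) (FC.1 x).
by move=> h; apply: is_derive_eq h _; rewrite /GRing.scale /= mulNr mulrC.
Qed.

Lemma C1_eq F f g : C1 F f -> f =1 g -> C1 F g.
Proof. by move=> FC fg; have <- : f = g by exact/funext. Qed.

(** The retraction of the line onto D. Composing with it extends a function that is continuous on D
    to one that is continuous on the whole line, by its two boundary values. *)
Definition clamp H x := Num.max (- H) (Num.min x H).

Lemma clamp_dom H x : 0 < H -> dom H (clamp H x).
Proof.
move=> H0; apply/domE; rewrite /clamp le_max lexx /= ge_max ge_min lexx orbT andbT.
by lra.
Qed.

Lemma clampE H x : dom H x -> clamp H x = x.
Proof.
move/domE => /andP[h1 h2]; rewrite /clamp.
by rewrite min_l// max_r.
Qed.

Lemma clamp_cont H : continuous (clamp H).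
Proof.
move=> x; apply: (@continuous_max _ _ (fun=> - H) (fun x => Num.min x H)).
  exact: cvg_cst.
by apply: (@continuous_min _ _ id (fun=> H)); [exact: cvg_id|exact: cvg_cst].
Qed.

Lemma clamp_comp_cont H g : 0 < H -> {within dom H, continuous g} ->
  continuous (fun x => g (clamp H x)).
Proof.
move=> H0 /subspace_continuousP cg x.
apply: (@cvg_comp _ _ _ (clamp H) g _ (within (dom H) (nbhs (clamp H x)))).
  move=> U /= hU.
  have h : nbhs x (fun y => dom H (clamp H y) -> U (clamp H y)) := @clamp_cont H x _ hU.
  by apply: filterS h => y /= /(_ (clamp_dom y H0)).
exact: (cg _ (clamp_dom x H0)).
Qed.

(** The fundamental theorem for integrals starting at -oo asks for integrability on left half-lines.
    Subtracting the constant [g (- H)] leaves an integrand that vanishes to the left of [- H]; a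
    linear function restores the constant. *)
Lemma primitive_left_cst H g : continuous g -> (forall x, x <= - H -> g x = g (- H)) ->
  exists F, C1 F g.
Proof.
move=> cg gH.
pose h x := g x - g (- H).
have ch : continuous h by move=> x; apply: cvgB; [exact: cg|exact: cvg_cst].
exists (fun x => g (- H) * x + \int[mu]_(t in `]-oo, x]) h t).
split; last by [].
move=> x.
have ih u : mu.-integrable `]-oo, u] (EFin \o h).
  have hh : {in [set` `]-oo, u]], (EFin \o h) \_ `[- H, u] =1 (EFin \o h)}.
    move=> y /set_mem /= yu; rewrite patchE; case: ifPn => // /negP yH.
    rewrite /= /h gH ?subrr// leNgt; apply/negP => Hy; apply: yH; apply/mem_set.
    by move: yu; rewrite /= !in_itv /= => ->; rewrite andbT ltW.
  refine (@eq_integrable _ _ _ mu _ _ _ _ hh _) => //.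
  apply/(@integrable_restrict _ _ _ mu) => //.
  apply: integrableS (_ : mu.-integrable `[- H, u] _) => //.
    by apply: measurableI.
  apply: continuous_compact_integrable; first exact: segment_compact.
  exact: continuous_subspaceT.
have [||d1 d2] := @continuous_FTC1 _ h -oo%O x (x + 1) _ (ih _) _ (ch x).
- by rewrite ltrDl.
- by rewrite ltNyr.
rewrite (_ : g x = g (- H) + h x); last by rewrite /h addrC subrK.
apply: is_deriveD.
  by have := (C1Z (g (- H)) C1_id).1 x; rewrite mulr1.
apply: DeriveDef => //; rewrite -derive1E; exact: d2.
Qed.

(** One has [g x = g (max x 0) + g (min x 0) - g 0]. The first summand is constant to the left of 0,
    and so is the second after a reflection of the line. *)
Lemma primitive g : continuous g -> exists F, C1 F g.
Proof.
move=> cg.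
have c1 : continuous (fun x => g (Num.max x 0)).
  move=> x; apply: (@continuous_comp _ _ _ (fun x => Num.max x 0) g); last exact: cg.
  by apply: (@continuous_max _ _ id (fun=> 0)); [exact: cvg_id|exact: cvg_cst].
have c2 : continuous (fun x => g (- Num.max x 0)).
  move=> x; apply: (@continuous_comp _ _ _ (fun x => - Num.max x 0) g); last exact: cg.
  apply: cvgN; apply: (@continuous_max _ _ id (fun=> 0)); first exact: cvg_id.
  exact: cvg_cst.
have [|P PC] := @primitive_left_cst 0 _ c1.
  by move=> x; rewrite oppr0 => x0; rewrite max_r// maxxx.
have [|Q QC] := @primitive_left_cst 0 _ c2.
  by move=> x; rewrite oppr0 => x0; rewrite max_r// maxxx.
have NC : C1 (fun x => - x) (fun=> - 1).
  split=> x; [exact: is_deriveNid|exact: cvg_cst].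
exists (fun x => (P x - Q (- x)) - g 0 * x).
apply: (C1_eq (C1B (C1B PC (C1_comp NC QC)) (C1Z (g 0) (@C1_id)))) => x.
rewrite mulN1r opprK mulr1; have [x0|x0] := leP 0 x.
  by rewrite max_r ?oppr_le0// oppr0 addrK.
by rewrite max_l ?opprK ?oppr_ge0 ?ltW// addrAC subrr add0r.
Qed.

Lemma C1_deriv_on (D : set R) F f G : C1 F f -> (forall x, D x -> G x = F x) ->
  deriv_on D G f.
Proof.
move=> FC GF x Dx; have [dF dFE] := FC.1 x.
move/cvg_ex: (dF) => [l]; rewrite /= => hl.
have lE : l = f x by rewrite -dFE; apply/esym/cvg_lim.
move: hl; rewrite lE => hl.
apply/cvgrPdist_lt => e e0; move/cvgrPdist_lt : hl => /(_ e e0).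
rewrite !near_withinE => /nbhs_ballP[d /= d0 hd].
apply/nbhs_ballP; exists d => //= y xy yx Dy.
have := hd (y - x).
rewrite /ball /= sub0r normrN distrC => /(_ xy).
rewrite subr_eq0 => /(_ yx).
rewrite /GRing.scale /= mulr1 subrK !GF// => h.
by rewrite [(_ - _) / _]mulrC.
Qed.

Lemma cvg_joint (h : R -> R -> R) (T : Type) (F : set_system T) (FF : Filter F)
  (f g : T -> R) a b : continuous (fun z : R * R => h z.1 z.2) ->
  f y @[y --> F] --> a -> g y @[y --> F] --> b -> h (f y) (g y) @[y --> F] --> h a b.
Proof.
move=> ch fa gb.
have fg : (f y, g y) @[y --> F] --> (a, b) by exact: cvg_pair fa gb.
have hab : h z.1 z.2 @[z --> (a, b)] --> h a b by exact: (ch (a, b)).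
exact: cvg_comp fg hab.
Qed.

Lemma joint_cont (h : R -> R -> R) f g : continuous (fun z : R * R => h z.1 z.2) ->
  continuous f -> continuous g -> continuous (fun x => h (f x) (g x)).
Proof. by move=> ch cf cg x; apply: (cvg_joint _ ch); [exact: cf|exact: cg]. Qed.

Lemma continuous_bounded_itv f a b : continuous f ->
  exists2 K, 0 <= K & forall t, a <= t <= b -> `|f t| <= K.
Proof.
move=> cf; have /compact_bounded[N [_ hN]] : compact (f @` `[a, b]).
  by apply: continuous_compact; [exact: continuous_subspaceT|exact: segment_compact].
exists (`|N| + 1); first by rewrite addr_ge0.
move=> t tab; apply: hN; last by exists t => //=; rewrite in_itv.
by have := ler_norm N; lra.
Qed.

Lemma continuous_bounded_rect (h : R -> R -> R) a b c d :
  continuous (fun z : R * R => h z.1 z.2) ->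
  exists2 K, 0 <= K & forall x y, a <= x <= b -> c <= y <= d -> `|h x y| <= K.
Proof.
move=> ch.
have /compact_bounded[N [_ hN]] :
    compact ((fun z : R * R => h z.1 z.2) @` (`[a, b]%classic `*` `[c, d]%classic)).
  apply: continuous_compact; first exact: continuous_subspaceT.
  by apply: compact_setX; exact: segment_compact.
exists (`|N| + 1); first by rewrite addr_ge0.
move=> x y xab ycd; apply: hN; first by have := ler_norm N; lra.
by exists (x, y) => //=; split; rewrite in_itv.
Qed.

End Calculus.

(** * Weak derivatives *)

Section WeakDerivatives.
Context {R : realType}.
Notation mu := (@lebesgue_measure R).
Implicit Types (H M e a b c x y : R) (f g h F phi : R -> R).

Definition ae_eq_dom H f g := {ae mu, forall x, dom H x -> f x = g x}.

Lemma ae_eq_Rint H f g : measurable_fun (dom H) f -> measurable_fun (dom H) g ->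
  ae_eq_dom H f g -> \int[mu]_(x in dom H) f x = \int[mu]_(x in dom H) g x.
Proof.
move=> mf mg fg; congr fine; apply: ae_eq_integral => //.
- exact/measurable_EFinP.
- exact/measurable_EFinP.
by apply: ae_imply fg => x h Dx /=; rewrite h.
Qed.

Lemma integ_ae_eq H f g : measurable_fun (dom H) g ->
  ae_eq_dom H f g -> integ H f -> integ H g.
Proof.
move=> mg fg /integrableP[mf fi]; apply/integrableP; split; first exact/measurable_EFinP.
apply: le_lt_trans fi; apply: ae_ge0_le_integral => //.
- by apply: measurableT_comp => //; exact/measurable_EFinP.
- by apply: measurableT_comp => //.
by apply: ae_imply fg => x h Dx /=; rewrite h.
Qed.

Lemma continuous_dom_measurable H phi : continuous phi -> measurable_fun (dom H) phi.
Proof.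
by move=> cphi; apply: integ_measurable; apply: cont_integ; exact: continuous_subspaceT.
Qed.

Lemma integM H f phi : integ H f -> continuous phi -> integ H (fun x => f x * phi x).
Proof.
move=> fi cphi; apply: (@integrableMl _ _ _ mu _ _ (EFin \o f) phi) => //.
  exact: continuous_dom_measurable.
have /compact_bounded[M [Mr Mf]] : compact (phi @` dom H).
  by apply: continuous_compact; [exact: continuous_subspaceT|exact: segment_compact].
exists M; split => // y My x Dx; apply: Mf => //; by exists x.
Qed.

Lemma dominated_Rint H (f_ : nat -> R -> R) f g :
  (forall n, measurable_fun (dom H) (f_ n)) -> measurable_fun (dom H) f ->
  {ae mu, forall x, dom H x -> f_ n x @[n --> \oo] --> f x} -> integ H g ->
  (forall n x, dom H x -> `|f_ n x| <= g x) ->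
  \int[mu]_(x in dom H) f_ n x @[n --> \oo] --> \int[mu]_(x in dom H) f x.
Proof.
move=> mf_ mf cf ig fg.
have cf' : {ae mu, forall x, dom H x -> (f_ n x)%:E @[n --> \oo] --> (f x)%:E}.
  by apply: ae_imply cf => x cf Dx; apply: cvg_EFin; [exact: nearW|exact: cf].
have fg' : {ae mu, forall x n, dom H x -> (`|(f_ n x)%:E| <= (g x)%:E)%E}.
  by apply: aeW => x n Dx; rewrite lee_fin; exact: fg.
have [ifi _ h] := @dominated_convergence _ _ _ mu (dom H) (@dom_measurable_ocitv _ H)
  (fun n => EFin \o f_ n) (EFin \o f) (EFin \o g)
  (fun n => (measurable_EFinP _ _).2 (mf_ n)) ((measurable_EFinP _ _).2 mf) cf' ig fg'.
by apply: fine_cvg; rewrite fineK //; exact: (integrable_fin_num _ ifi).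
Qed.

Lemma test_C1 H phi : test_fun H phi -> C1 phi (derive1 phi).
Proof.
by case=> d c _; split => // x; rewrite derive1E; exact: derivableP.
Qed.

Lemma test_bnd H phi : 0 < H -> test_fun H phi -> phi (- H) = 0 /\ phi H = 0.
Proof.
move=> H0 [_ _ [a aH h]]; split; apply: h; last by rewrite gtr0_norm.
by rewrite normrN gtr0_norm.
Qed.

Lemma test_cont H phi : test_fun H phi -> continuous phi.
Proof. by move/test_C1/C1_cont. Qed.

Lemma C1_test H phi f a : C1 phi f -> a < H -> (forall x, a < `|x| -> phi x = 0) ->
  test_fun H phi.
Proof.
move=> C aH h; split; last by exists a.
  by move=> x; case: (C.1 x).
by rewrite (C1_derive1 C); case: C.
Qed.

Lemma C1_weak_deriv_int H F f phi : 0 < H -> C1 F f -> test_fun H phi ->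
  \int[mu]_(x in dom H) (F x * derive1 phi x) =
  - \int[mu]_(x in dom H) (f x * phi x).
Proof.
move=> H0 FC tp; have PC := test_C1 tp.
rewrite (@Rintegration_by_parts _ F phi f (derive1 phi)).
- by have [-> ->] := test_bnd H0 tp; rewrite !mulr0 subrr sub0r.
- by rewrite gtrN.
- by apply: continuous_subspaceT; exact: FC.2.
- exact: C1_LR FC.
- by move=> x _; rewrite (C1_derive1 FC).
- by apply: continuous_subspaceT; exact: PC.2.
- exact: C1_LR PC.
- by [].
Qed.

(** The function is half the square of [max t 0]. As test functions are only required to be C^1, it
    suffices as a building block for all bumps. *)
Lemma smooth_step : exists s, [/\ C1 s (fun t : R => Num.max t 0),
  forall t, t <= 0 -> s t = 0 & forall t, 0 < t -> 0 < s t].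
Proof.
have cm : continuous (fun t : R => Num.max t 0).
  move=> t; apply: (@continuous_max _ _ id (fun=> 0)); first exact: cvg_id.
  exact: cvg_cst.
have [S SC] := primitive cm.
exists (fun t => S t - S 0); split.
- by apply: (C1_eq (C1B SC (C1_cst (S 0)))) => x; rewrite subr0.
- move=> t t0; have [c /andP[_ c0] E] := C1_MVT SC t0.
  by apply/eqP; rewrite -oppr_eq0 opprB E max_r// mul0r.
(* On [[0, t]] the mean value point might be 0, where the derivative vanishes; hence the cut at
   [t / 2]. *)
move=> t t0; have t2 : t / 2 <= t by lra.
have [c /andP[c1 c2] E] := C1_MVT SC (ltW t0).
have [c' /andP[c1' c2'] E'] := C1_MVT SC t2.
have t20 : 0 <= t / 2 by lra.
have [c'' /andP[c1'' c2''] E''] := C1_MVT SC t20.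
rewrite (_ : S t - S 0 = (S t - S (t / 2)) + (S (t / 2) - S 0)); last by ring.
rewrite E' E'' ltr_pwDl//; first by rewrite mulr_gt0 ?lt_max; lra.
by rewrite mulr_ge0 ?le_max ?lexx ?orbT//; lra.
Qed.

(** For a C^1 function [w] that is positive exactly on []a, b[], the quotients [n * w / (1 + n * w)]
    lie between 0 and 1, vanish where [w] does, and tend to 1 elsewhere. *)
Lemma indicator_approx H a b : - H < a -> a < b -> b < H ->
  exists phi_ : nat -> R -> R, [/\ forall n, test_fun H (phi_ n),
    forall n x, `|phi_ n x| <= 1 &
    forall x, phi_ n x @[n --> \oo] --> ((\1_(`]a, b[%classic : set R) x) : R)].
Proof.
move=> Ha ab bH; have [s [sC s0 s1]] := smooth_step.
have uC := C1M (C1B (@C1_id R) (C1_cst a)) (C1B (C1_cst b) (@C1_id R)).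
have wC := C1_comp uC sC.
have w0 x : ~~ (a < x < b) -> s ((x - a) * (b - x)) = 0.
  move=> h; apply: s0; move: h; rewrite negb_and -!leNgt => /orP[xa|bx].
    by apply: mulr_le0_ge0; lra.
  by apply: mulr_ge0_le0; lra.
have w1 x : a < x < b -> 0 < s ((x - a) * (b - x)).
  by move=> /andP[? ?]; apply: s1; rewrite mulr_gt0//; lra.
pose w x := s ((x - a) * (b - x)).
have wge0 x : 0 <= w x.
  by have [/w1/ltW//|/w0] := boolP (a < x < b); rewrite /w => ->.
have dpos n x : 0 < 1 + n%:R * w x by rewrite ltr_pwDl// mulr_ge0.
exists (fun n x => (n%:R * w x) * (1 + n%:R * w x)^-1); split.
- move=> n.
  have dC := C1D (C1_cst 1) (C1Z n%:R wC).
  have C := C1M (C1Z n%:R wC) (C1V dC (fun x => lt0r_neq0 (dpos n x))).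
  apply: (C1_test (a := Num.max `|a| `|b|) C).
    by rewrite gt_max !ltr_norml; apply/andP; split; lra.
  move=> x; rewrite gt_max => /andP[xa xb]; rewrite w0 ?mulr0 ?mul0r//.
  apply/negP => /andP[h1 h2].
  have [x0|x0] := leP 0 x.
    move: xb; rewrite (ger0_norm x0) => h; have := ler_norm b; lra.
  move: xa; rewrite (ltr0_norm x0) => h; have := ler_norm (- a); rewrite normrN; lra.
- move=> n x; rewrite ger0_norm; last by rewrite mulr_ge0 ?mulr_ge0// invr_ge0 ltW.
  by rewrite ler_pdivrMr// mul1r lerDr.
move=> x; rewrite indicE; have [xab|xab] := boolP (a < x < b); last first.
  rewrite memNset/=; last by rewrite /= in_itv /=; exact/negP.
  rewrite [X in X @ _](_ : _ = fun=> 0); first exact: cvg_cst.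
  by apply/funext => n; rewrite /w w0// mulr0 mul0r.
rewrite mem_set /=; last by rewrite /= in_itv.
have wx : 0 < w x by exact: w1.
rewrite [X in X @ _](_ : _ = fun n : nat => 1 - (1 + n%:R * w x)^-1); last first.
  by apply/funext => n; field; rewrite gt_eqF.
rewrite -[X in _ --> X](subr0 1); apply: cvgB; first exact: cvg_cst.
apply/cvgrPdist_lt => e e0; near=> n.
rewrite sub0r normrN gtr0_norm ?invr_gt0// invf_plt ?posrE//.
have : (e * w x)^-1 < n%:R by near: n; exact: nbhs_infty_gtr.
rewrite invfM => h; have : (e^-1 / w x) * w x < n%:R * w x by rewrite ltr_pM2r.
by rewrite divfK ?gt_eqF// => /lt_trans; apply; rewrite ltrDr.
Unshelve. all: by end_near. Qed.

(* The integrals of [h] over all intervals vanish, so that by Lebesgue's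
   differentiation theorem [h] is almost everywhere the derivative of a
   constant. *)
Lemma test_orthogonal H h : 0 < H -> integ H h ->
  (forall phi, test_fun H phi -> \int[mu]_(x in dom H) (h x * phi x) = 0) ->
  ae_eq_dom H h (fun=> 0).
Proof.
move=> H0 ih h0.
have mh := integ_measurable ih.
have int0 a b : - H < a -> a < b -> b < H -> \int[mu]_(x in `]a, b[) h x = 0.
  move=> Ha ab bH; have [phi_ [t1 t2 t3]] := indicator_approx Ha ab bH.
  have /cvg_lim <- // : \int[mu]_(x in dom H) (h x * phi_ n x) @[n --> \oo] -->
     \int[mu]_(x in `]a, b[) h x; last first.
    under eq_fun do rewrite h0//. exact: lim_cst.
  rewrite (_ : \int[mu]_(x in `]a, b[) h x =
      \int[mu]_(x in dom H) (h x * (\1_(`]a, b[%classic : set R) x : R))).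
    apply: (@dominated_Rint _ _ _ (fun x => `|h x|)).
    - move=> n; apply: measurable_funM => //.
      by apply: continuous_dom_measurable; exact: test_cont (t1 n).
    - by apply: measurable_funM => //; exact: measurable_indic.
    - by apply: aeW => x _; apply: cvgM; [exact: cvg_cst|exact: t3].
    - exact: integrable_abse ih.
    - by move=> n x _; rewrite normrM ler_piMr.
  have EI : `]a, b[ `&` dom H = `]a, b[%classic.
    apply/setIidPl => x /=; rewrite /dom /= !in_itv /= => /andP[? ?].
    by apply/andP; split; lra.
  rewrite -{1}EI Rintegral_mkcondl; apply: eq_Rintegral => x _.
  rewrite patchE indicE.
  by have [xI|xI] := pselect ((`]a, b[%classic : set R) x);
    rewrite ?(mem_set xI) ?(memNset xI) ?mulr1 ?mulr0.
pose k := h \_ (dom H).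
have ik : mu.-integrable [set: R] (EFin \o k).
  have := @integrable_mkcond _ _ _ mu (dom H) (EFin \o h) (@dom_measurable R H).
  by rewrite restrict_EFin => -[+ _]; apply.
pose F y := \int[mu]_(t in `]-oo, y]) k t.
have FE x y : - H < x -> x < y -> y < H -> F y = F x.
  move=> Hx xy yH; apply/eqP; rewrite -subr_eq0 /F (@Rintegral_itvB _ k -oo%O (BRight y) x).
  - rewrite -Rintegral_itv_bndo_bndc; last exact: integrableS ik.
    rewrite -[X in _ == X](int0 x y)//; apply/eqP; apply: eq_Rintegral => z /set_mem /=.
    rewrite in_itv /= => /andP[? ?]; rewrite /k patchE mem_set//.
    by apply/domE/andP; split; lra.
  - exact: integrableS ik.
  - by [].
  - by rewrite bnd_simp ltW.
have iky y : mu.-integrable `]-oo, y] (EFin \o k) by exact: integrableS ik.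
have := @FTC1Ny R k iky (open_integrable_locally openT ik).
apply: (ae_imply2 _ (ae_interior H)) => x xI [dF F'] Dx.
have /andP[Hx xH] := xI Dx.
have -> : h x = k x by rewrite /k patchE mem_set.
rewrite -F' derive1E (@near_eq_derive _ _ _ _ (cst (F x))) ?derive_cst//.
have : x \in `]- H, H[ by rewrite in_itv /= Hx.
move/near_in_itvoo; apply: filterS => y; rewrite in_itv /= => /andP[y1 y2].
by have [xy|yx|->//] := ltgtP x y; [exact: (FE x y)|exact/esym/(FE y x)].
Qed.

Lemma weak_deriv_unique H f g1 g2 : 0 < H ->
  is_weak_deriv H f g1 -> is_weak_deriv H f g2 -> ae_eq_dom H g1 g2.
Proof.
move=> H0 [_ /Lp1P i1 d1] [_ /Lp1P i2 d2].
have : ae_eq_dom H (fun x => g1 x - g2 x) (fun=> 0).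
  apply: test_orthogonal => //; first exact: integrableB i1 i2.
  move=> phi tp; under eq_Rintegral do rewrite mulrBl.
  rewrite RintegralB//; [|exact: integM i1 (test_cont tp)|exact: integM i2 (test_cont tp)].
  by apply/eqP; rewrite subr_eq0 -eqr_opp -d1// -d2.
by apply: ae_imply => x h /h /eqP; rewrite subr_eq0 => /eqP.
Qed.

Lemma wderivP H f g : 0 < H -> is_weak_deriv H f g ->
  is_weak_deriv H f (wderiv H f) /\ ae_eq_dom H (wderiv H f) g.
Proof.
move=> H0 fg; have h : is_weak_deriv H f (wderiv H f) by apply: (@xgetI _ _ _ g).
by split => //; exact: weak_deriv_unique h fg.
Qed.

Lemma weak_deriv_ae H f f' g g' : measurable_fun (dom H) f' -> measurable_fun (dom H) g' ->
  ae_eq_dom H f f' -> ae_eq_dom H g g' -> is_weak_deriv H f g -> is_weak_deriv H f' g'.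
Proof.
move=> mf' mg' ff' gg' [/Lp1P fi /Lp1P gi d].
have f'i := integ_ae_eq mf' ff' fi; have g'i := integ_ae_eq mg' gg' gi.
split; [exact/Lp1P|exact/Lp1P|] => phi tp.
have [_ tc _] := tp; have pc := test_cont tp.
rewrite -(@ae_eq_Rint _ (fun x => f x * derive1 phi x)) ?d//.
- congr (- _); apply: ae_eq_Rint.
  + exact: integ_measurable (integM gi pc).
  + exact: integ_measurable (integM g'i pc).
  + by apply: ae_imply gg' => x h /h ->.
- exact: integ_measurable (integM fi tc).
- exact: integ_measurable (integM f'i tc).
- by apply: ae_imply ff' => x h /h ->.
Qed.

Lemma C1_weak_deriv H F g f f' : 0 < H -> C1 F f' -> 
  (forall x, dom H x -> f x = F x) -> ae_eq_dom H g f' ->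
  measurable_fun (dom H) g -> is_weak_deriv H f g.
Proof.
move=> H0 FC fF gf' mg; have ff x (Dx : dom H x) := esym (fF x Dx).
have mF : measurable_fun (dom H) F := continuous_dom_measurable (C1_cont FC).
apply: (@weak_deriv_ae _ F _ f').
- by apply: eq_measurable_fun mF => x /set_mem /ff.
- by [].
- by apply: aeW.
- by apply: ae_imply gf' => x h /h.
split.
- by apply/Lp1P/cont_integ/continuous_subspaceT; exact: (C1_cont FC).
- by apply/Lp1P/cont_integ/continuous_subspaceT; exact: FC.2.
by move=> phi; exact: C1_weak_deriv_int.
Qed.

(** The lemma of du Bois-Reymond: any test function minus the multiple of a fixed bump [w] with the
    same integral is the derivative of a test function. Hence [f] minus its [w]-weighted mean is
    orthogonal to all test functions. *)
Lemma weak_deriv0_cst H f : 0 < H -> is_weak_deriv H f (fun=> 0) ->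
  exists c, ae_eq_dom H f (fun=> c).
Proof.
move=> H0 [/Lp1P fi _ df].
have [s [sC s0 s1]] := smooth_step.
have wC := C1_comp (C1M (C1B (C1_cst (H / 2)) (@C1_id R)) (C1D (C1_cst (H / 2)) (@C1_id R))) sC.
pose w x := s ((H / 2 - x) * (H / 2 + x)).
have wt : test_fun H w.
  apply: (C1_test (a := H / 2) wC); first by lra.
  move=> x; rewrite lter_normr => /orP[|] h; apply: s0.
    by apply: mulr_le0_ge0; lra.
  by apply: mulr_ge0_le0; lra.
have [W WC] := primitive (test_cont wt).
have int_dom phi P : C1 P phi ->
    \int[mu]_(x in dom H) phi x = P H - P (- H).
  by move=> PC; rewrite -(C1_FTC PC)//; lra.
pose I0 := W H - W (- H).
have wge0 x : 0 <= w x.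
  by have [/s0|/s1/ltW//] := leP ((H / 2 - x) * (H / 2 + x)) 0; rewrite /w => ->.
have Wle x y : x <= y -> 0 <= W y - W x.
  by move=> xy; have [z _ ->] := C1_MVT WC xy; rewrite mulr_ge0// subr_ge0.
have I0_gt0 : 0 < I0.
  have h4 : - (H / 4) <= H / 4 by lra.
  have : 0 < W (H / 4) - W (- (H / 4)).
    have [z /andP[z1 z2] ->] := C1_MVT WC h4; rewrite mulr_gt0//; last by lra.
    by apply: s1; rewrite mulr_gt0//; lra.
  have := Wle (H / 4) H; have := Wle (- H) (- (H / 4)); rewrite /I0; lra.
have wc := test_cont wt.
pose c := (\int[mu]_(x in dom H) (f x * w x)) / I0.
exists c.
suff : ae_eq_dom H (fun x => f x - c) (fun=> 0).
  by apply: ae_imply => x h /h /eqP; rewrite subr_eq0 => /eqP.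
have ci : integ H (fun=> c) by apply/cont_integ/continuous_subspaceT => x; exact: cvg_cst.
apply: test_orthogonal => //; first exact: integrableB fi ci.
move=> phi tp; have pc := test_cont tp.
have pi : integ H phi by exact/cont_integ/continuous_subspaceT.
under eq_Rintegral do rewrite mulrBl.
rewrite RintegralB//; [|exact: integM fi pc|exact: integM ci pc].
rewrite RintegralZl//.
have [P PC] := primitive pc.
rewrite (int_dom _ _ PC); set J := P H - P (- H).
(* The factor [J / I0] makes [Q] vanish at both ends of D. Its derivative vanishes near them and
   beyond, so [Q] is itself a test function. *)
pose Q x := P x - P (- H) - J / I0 * (W x - W (- H)).
have QC : C1 Q (fun x => phi x - J / I0 * w x).
  apply: (C1_eq (C1B (C1B PC (C1_cst (P (- H)))) (C1Z (J / I0) (C1B WC (C1_cst (W (- H))))))).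
  by move=> x; rewrite !subr0.
have tQ : test_fun H Q.
  have [_ _ [a aH pa]] := tp; have [_ _ [b bH wb]] := wt.
  pose d := Num.max 0 (Num.max a b).
  have dH : d < H by rewrite /d !gt_max H0 aH.
  have d0 : 0 <= d by rewrite /d le_max lexx.
  have Q'0 y : d < `|y| -> phi y - J / I0 * w y = 0.
    rewrite /d !gt_max => /andP[_ /andP[h1 h2]].
    by rewrite pa// wb// mulr0 subrr.
  have QH : Q H = 0 by rewrite /Q -/J -/I0 divfK ?subrr// gt_eqF.
  have QNH : Q (- H) = 0 by rewrite /Q !subrr mulr0 subr0.
  apply: (C1_test QC dH) => x dx.
  have [x0|x0] := leP 0 x.
    rewrite ger0_norm// in dx.
    have [xH|Hx] := leP x H.
      have [z /andP[z1 z2]] := C1_MVT QC xH; rewrite Q'0 ?mul0r ?QH.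
        by move=> /eqP; rewrite sub0r oppr_eq0 => /eqP.
      by rewrite ger0_norm; lra.
    have [z /andP[z1 z2]] := C1_MVT QC (ltW Hx); rewrite Q'0 ?mul0r ?QH ?subr0//.
    by rewrite ger0_norm; lra.
  rewrite ltr0_norm// in dx.
  have [xH|Hx] := leP x (- H).
    have [z /andP[z1 z2]] := C1_MVT QC xH; rewrite Q'0 ?mul0r ?QNH.
      by move=> /eqP; rewrite sub0r oppr_eq0 => /eqP.
    by rewrite ler0_norm; lra.
  have [z /andP[z1 z2]] := C1_MVT QC (ltW Hx); rewrite Q'0 ?mul0r ?QNH ?subr0//.
  by rewrite ler0_norm; lra.
have := df _ tQ; rewrite (C1_derive1 QC).
under [X in _ = - X]eq_Rintegral do rewrite mul0r.
rewrite integral_cst_dom// mul0r oppr0.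
rewrite (@eq_Rintegral _ _ _ mu _ (fun x => f x * phi x - J / I0 * (f x * w x))); last first.
  by move=> x _; ring.
have fwi := integM fi wc.
have Ji : integ H (fun x => J / I0 * (f x * w x)) by exact: integrableZl fwi.
rewrite RintegralB//; last exact: integM fi pc.
by rewrite RintegralZl// => <-; rewrite /c; ring.
Qed.

(** Two continuous functions that differ at a point of D differ on an interval of positive length,
    one-sided if the point is an end point; such an interval does not fit into a null set. *)
Lemma continuous_ae_eq H f g : 0 < H -> {within dom H, continuous f} ->
  {within dom H, continuous g} -> ae_eq_dom H f g -> forall x, dom H x -> f x = g x.
Proof.
move=> H0 cf cg [N [mN N0 sN]] x Dx; apply: contrapT => fgx.
have := clamp_comp_cont H0 cf => /(_ x); have := clamp_comp_cont H0 cg => /(_ x) => c1 c2.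
have ck : (fun y => f (clamp H y) - g (clamp H y)) y @[y --> x] --> f (clamp H x) - g (clamp H x).
  exact: cvgB.
have k0 : 0 < `|f (clamp H x) - g (clamp H x)|.
  by rewrite clampE// normr_gt0 subr_eq0; exact/eqP.
move/cvgrPdist_lt : ck => /(_ _ k0) /nbhs_ballP[e /= e0 he].
pose l := Num.max (- H) (x - e); pose r := Num.min H (x + e).
have /domE /andP[x1 x2] := Dx.
have lr : l < r by rewrite /l /r lt_min !gt_max; apply/andP; split; apply/andP; split; lra.
have sub : `]l, r[ `<=` N.
  move=> y /=; rewrite in_itv /= /l /r lt_min gt_max => /andP[/andP[y1 y2] /andP[y3 y4]].
  have Dy : dom H y by apply/domE/andP; split; lra.
  apply: sN => /= fgy; have := he y; rewrite /= clampE// clampE// fgy// subrr subr0 ltxx.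
  suff yb : ball x e y by move=> /(_ yb).
  by rewrite /ball /= ltr_distl; apply/andP; split; lra.
have : (mu `]l, r[ <= mu N)%E by apply: le_measure; rewrite ?inE//; exact: measurable_itv.
rewrite N0 lebesgue_measure_itv /= lte_fin lr -EFinD lee_fin; lra.
Qed.

Lemma weak_deriv_C1 H f g G : 0 < H -> {within dom H, continuous f} ->
  C1 G g -> is_weak_deriv H f g ->
  exists c, forall x, dom H x -> f x = G x + c.
Proof.
move=> H0 cf GC d.
have cG : {within dom H, continuous G} by exact: continuous_subspaceT (C1_cont GC).
have [|c fGc] := @weak_deriv0_cst H (fun x => f x - G x) H0.
  have fi := cont_integ cf.
  have gi : integ H g := cont_integ (continuous_subspaceT GC.2).
  have Gi := cont_integ cG.
  split.
  - by apply/Lp1P; exact: integrableB fi Gi.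
  - by apply/Lp1P/cont_integ; exact: continuous_subspaceT (fun x => cvg_cst _).
  move=> phi tp; have [_ tc _] := tp; have pc := test_cont tp.
  under eq_Rintegral do rewrite mulrBl.
  rewrite RintegralB//; [|exact: integM fi tc|exact: integM Gi tc].
  rewrite (C1_weak_deriv_int H0 GC tp); case: d => _ _ -> //.
  under [X in _ = - X]eq_Rintegral do rewrite mul0r.
  by rewrite integral_cst_dom// mul0r oppr0 subrr.
exists c; apply: continuous_ae_eq => //.
  by apply: continuous_subspaceT => x; apply: cvgD; [exact: (C1_cont GC)|exact: cvg_cst].
by apply: ae_imply fGc => x h /h /eqP; rewrite subr_eq addrC => /eqP.
Qed.

(** The equation [f'' = g] is integrated twice, each time up to a constant. The intermediate step
    runs through the continuous representative [g1] of the first derivative, since [wderiv H f] is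
    determined only up to null sets. *)
Lemma sobolev21_C2 H f g : 0 < H -> sobolev H 2 1 f -> continuous g ->
  ae_eq_dom H (wderiv H (wderiv H f)) g ->
  exists F F1, [/\ C1 F F1, C1 F1 g & forall x, dom H x -> f x = F x].
Proof.
move=> H0 [cf _ [g1 fg1 [cg1 _ [g2 g12 _]]]] cg w2g.
have [fw w1g1] := wderivP H0 fg1.
have mw1 : measurable_fun (dom H) (wderiv H f) by case: fw => _ /Lp_measurable.
have mg1 : measurable_fun (dom H) g1 by case: fg1 => _ /Lp_measurable.
have mg2 : measurable_fun (dom H) g2 by case: g12 => _ /Lp_measurable.
have mg : measurable_fun (dom H) g by exact: continuous_dom_measurable.
have w1g2 : is_weak_deriv H (wderiv H f) g2.
  apply: weak_deriv_ae g12 => //; last exact: aeW.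
  by apply: ae_imply w1g1 => x h /h ->.
have [_ w2g2] := wderivP H0 w1g2.
have g1g : is_weak_deriv H g1 g.
  apply: weak_deriv_ae g12 => //; first exact: aeW.
  by apply: ae_imply2 w2g w2g2 => x h1 h2 Dx; rewrite -h1// h2.
have [G1 G1C] := primitive cg.
have [c1 g1E] := weak_deriv_C1 H0 cg1 G1C g1g.
have G1cC : C1 (fun x => G1 x + c1) g by apply: (C1_eq (C1D G1C (C1_cst c1))) => x; rewrite addr0.
have [G GC] := primitive (C1_cont G1cC).
have [|c fE] := weak_deriv_C1 H0 cf GC.
  apply: (weak_deriv_ae _ _ _ _ fg1); [by case: fg1 => /Lp_measurable| | exact: aeW |exact: aeW].
  exact: continuous_dom_measurable (C1_cont G1cC).
exists (fun x => G x + c), (fun x => G1 x + c1); split => //.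
by apply: (C1_eq (C1D GC (C1_cst c))) => x; rewrite addr0.
Qed.

Lemma C1_wderiv H f F F1 : 0 < H -> C1 F F1 -> (forall x, dom H x -> f x = F x) ->
  is_weak_deriv H f F1 /\ ae_eq_dom H (wderiv H f) F1.
Proof.
move=> H0 FC fF; have d : is_weak_deriv H f F1.
  apply: (C1_weak_deriv H0 FC fF); first exact: aeW.
  exact: continuous_dom_measurable FC.2.
by have [] := wderivP H0 d.
Qed.

Lemma C1_weak_deriv_ae H F F1 w : 0 < H -> C1 F F1 -> ae_eq_dom H w F ->
  measurable_fun (dom H) w -> is_weak_deriv H w F1.
Proof.
move=> H0 FC wF mw.
have [d _] := C1_wderiv H0 FC (fun x _ => erefl).
apply: (weak_deriv_ae mw _ _ _ d); [exact: continuous_dom_measurable FC.2| |exact: aeW].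
by apply: ae_imply wF => x h /h ->.
Qed.

Lemma C2_wderiv H f F F1 F2 : 0 < H -> C1 F F1 -> C1 F1 F2 ->
  (forall x, dom H x -> f x = F x) -> ae_eq_dom H (wderiv H (wderiv H f)) F2.
Proof.
move=> H0 FC F1C fF; have [d wF1] := C1_wderiv H0 FC fF.
have [[_ /Lp_measurable mw _] _] := wderivP H0 d.
by have [_] := wderivP H0 (C1_weak_deriv_ae H0 F1C wF1 mw).
Qed.

Lemma eq_dom_continuous H f F : (forall x, dom H x -> f x = F x) -> continuous F ->
  {within dom H, continuous f}.
Proof.
move=> fF cF; apply: (@subspace_eq_continuous _ _ _ F); last exact: continuous_subspaceT.
by move=> x /set_mem Dx; rewrite /from_subspace fF.
Qed.

Lemma C1_sobolev1 H f F F1 : 0 < H -> C1 F F1 -> (forall x, dom H x -> f x = F x) ->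
  [/\ sobolev H 1 1 f, sobolev H 1 2%:E f & sobolev H 1 +oo%E f].
Proof.
move=> H0 FC fF; have [d _] := C1_wderiv H0 FC fF.
have cf := eq_dom_continuous fF (C1_cont FC).
have [f1 f2 foo] := continuous_Lp H0 cf.
have [g1 g2 goo] := @continuous_Lp _ H F1 H0 (continuous_subspaceT FC.2).
by split; split => //; exists F1.
Qed.

Lemma C2_sobolev2 H f F F1 F2 : 0 < H -> C1 F F1 -> C1 F1 F2 ->
  (forall x, dom H x -> f x = F x) -> sobolev H 2 +oo%E f.
Proof.
move=> H0 FC F1C fF; have [d _] := C1_wderiv H0 FC fF.
have cf := eq_dom_continuous fF (C1_cont FC).
have [f1 f2 foo] := continuous_Lp H0 cf.
split => //; exists F1 => //.
by have [] := @C1_sobolev1 H F1 F1 F2 H0 F1C (fun x _ => erefl).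
Qed.

End WeakDerivatives.

(** * Uniform convergence and convergence in the mean *)

Section Convergence.
Context {R : realType}.
Notation mu := (@lebesgue_measure R).
Implicit Types (H M e a b c x y : R) (f g h F phi : R -> R).

Definition unif_cvg H (f_ : nat -> R -> R) f :=
  forall e, 0 < e -> \forall n \near \oo, forall x, dom H x -> `|f_ n x - f x| <= e.

Definition L1_cvg H (f_ : nat -> R -> R) f :=
  \int[mu]_(x in dom H) `|f_ n x - f x| @[n --> \oo] --> (0 : R).

Lemma integ_norm H f : integ H f -> integ H (fun x => `|f x|).
Proof. exact: integrable_abse. Qed.

Lemma integB H f g : integ H f -> integ H g -> integ H (fun x => f x - g x).
Proof. exact: integrableB. Qed.

Lemma integD H f g : integ H f -> integ H g -> integ H (fun x => f x + g x).
Proof. exact: integrableD. Qed.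

Lemma integZ H c f : integ H f -> integ H (fun x => c * f x).
Proof. exact: integrableZl. Qed.

Lemma integ_bddM H f g M : integ H f -> measurable_fun (dom H) g ->
  {ae mu, forall x, dom H x -> `|g x| <= M} -> integ H (fun x => f x * g x).
Proof.
move=> fi mg gM; have mf := integ_measurable fi.
have := integ_norm (integZ `|M| fi) => /integrableP[mMf iMf].
apply/integrableP; split; first by apply/measurable_EFinP; exact: measurable_funM.
apply: le_lt_trans iMf; apply: ae_ge0_le_integral => //.
- by apply: measurableT_comp => //; apply/measurable_EFinP; exact: measurable_funM.
- exact: measurableT_comp.
apply: ae_imply gM => x gM Dx; rewrite /= lee_fin normr_id !normrM normr_id mulrC.
by apply: ler_wpM2r => //; apply: le_trans (gM Dx) (ler_norm _).
Qed.

Lemma ae_le_Rint H f g : integ H f -> integ H g ->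
  {ae mu, forall x, dom H x -> f x <= g x} ->
  \int[mu]_(x in dom H) f x <= \int[mu]_(x in dom H) g x.
Proof.
move=> fi gi fg; have fgi := integB gi fi.
rewrite -subr_ge0 -(RintegralB _ gi fi)//.
rewrite (@ae_eq_Rint _ _ _ (fun x => `|g x - f x|)).
- exact: Rintegral_ge0.
- exact: integ_measurable fgi.
- exact: integ_measurable (integ_norm fgi).
by apply: ae_imply fg => x h /h h'; rewrite ger0_norm// subr_ge0.
Qed.

Lemma unif_L1_cvg H (f_ : nat -> R -> R) f : 0 < H -> (forall n, integ H (f_ n)) -> integ H f ->
  unif_cvg H f_ f -> L1_cvg H f_ f.
Proof.
move=> H0 i_ i u; apply/cvgrPdist_le => e e0.
have e1 : 0 < e / (H + H) by rewrite divr_gt0// addr_gt0.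
apply: filterS (u _ e1) => n hn; rewrite sub0r normrN ger0_norm ?Rintegral_ge0//.
have ci : integ H (fun=> e / (H + H)).
  by apply/cont_integ/continuous_subspaceT => x; exact: cvg_cst.
have := @le_Rintegral _ _ _ mu (dom H) _ _ (@dom_measurable_ocitv _ H)
  (integ_norm (integB (i_ n) i)) ci hn.
by rewrite integral_cst_dom// divfK// gt_eqF// addr_gt0.
Qed.

Lemma L1_cvg_ae H (f_ : nat -> R -> R) f (g_ : nat -> R -> R) g :
  (forall n, integ H (f_ n)) -> integ H f ->
  (forall n, measurable_fun (dom H) (g_ n)) -> measurable_fun (dom H) g ->
  (forall n, ae_eq_dom H (f_ n) (g_ n)) -> ae_eq_dom H f g -> L1_cvg H f_ f -> L1_cvg H g_ g.
Proof.
move=> i_ i m_ m e_ e; rewrite /L1_cvg => h.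
rewrite (_ : (fun n => _) = (fun n => \int[mu]_(x in dom H) `|f_ n x - f x|))//.
apply/funext => n; apply: ae_eq_Rint.
- apply: integ_measurable; apply/integ_norm/integB; [exact: integ_ae_eq (e_ n) (i_ n)|].
  exact: integ_ae_eq e i.
- exact: integ_measurable (integ_norm (integB (i_ n) i)).
by apply: ae_imply2 (e_ n) e => x h1 h2 Dx; rewrite h1// h2.
Qed.

Lemma L1_weak H (f_ : nat -> R -> R) f : (forall n, integ H (f_ n)) -> integ H f ->
  L1_cvg H f_ f -> weak_L1 H f_ f.
Proof.
move=> i_ i u; split; [by move=> n; exact/Lp1P|exact/Lp1P|] => g gp.
have mg := Lp_measurable gp; have [M M0 gM] := Lpoo_bounded gp.
have fgi n : integ H (fun x => f_ n x * g x) := integ_bddM (i_ n) mg gM.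
have fgi0 : integ H (fun x => f x * g x) := integ_bddM i mg gM.
apply/cvgrPdist_le => e e0.
have M1 : 0 < M + 1 by rewrite ltr_wpDl.
have e1 : 0 < e / (M + 1) by rewrite divr_gt0.
move/cvgrPdist_le : u => /(_ _ e1); apply: filterS => n.
rewrite sub0r normrN ger0_norm ?Rintegral_ge0// => hn.
rewrite distrC -(RintegralB _ (fgi n) fgi0)//; apply: le_trans (le_normr_Rintegral _ _) _ => //.
  exact: integB (fgi n) fgi0.
rewrite -[leRHS](@divfK _ (M + 1)) ?gt_eqF// mulrC.
apply: le_trans (ler_wpM2l (ltW M1) hn).
have fi := integ_norm (integB (i_ n) i).
rewrite -RintegralZl//; apply: ae_le_Rint; [exact: integ_norm (integB (fgi n) fgi0)|exact: integZ|].
apply: ae_imply gM => x gM Dx; rewrite -mulrBl normrM mulrC ler_wpM2r//.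
by apply: le_trans (gM Dx) _; rewrite lerDl.
Qed.

Lemma unif_wstar H (f_ : nat -> R -> R) f (g_ : nat -> R -> R) g : 0 < H ->
  (forall n, continuous (f_ n)) -> continuous f ->
  (forall n, measurable_fun (dom H) (g_ n)) -> measurable_fun (dom H) g ->
  (forall n, ae_eq_dom H (g_ n) (f_ n)) -> ae_eq_dom H g f -> unif_cvg H f_ f ->
  wstar_Loo H g_ g.
Proof.
move=> H0 c_ c m_ m e_ e u h /Lp1P hi.
have hfi n : integ H (fun x => h x * f_ n x) := integM hi (c_ n).
have hf : integ H (fun x => h x * f x) := integM hi c.
have mh := integ_measurable hi.
have E n : \int[mu]_(x in dom H) (g_ n x * h x) = \int[mu]_(x in dom H) (h x * f_ n x).
  apply: ae_eq_Rint; [exact: measurable_funM|exact: integ_measurable (hfi n)|].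
  by apply: ae_imply (e_ n) => x hx /hx ->; rewrite mulrC.
have E0 : \int[mu]_(x in dom H) (g x * h x) = \int[mu]_(x in dom H) (h x * f x).
  apply: ae_eq_Rint; [exact: measurable_funM|exact: integ_measurable hf|].
  by apply: ae_imply e => x hx /hx ->; rewrite mulrC.
rewrite E0; under eq_fun do rewrite E.
apply/cvgrPdist_le => d d0.
set I := \int[mu]_(x in dom H) `|h x|.
have I0 : 0 <= I by exact: Rintegral_ge0.
have I1 : 0 < I + 1 by rewrite ltr_wpDl.
have d1 : 0 < d / (I + 1) by rewrite divr_gt0.
apply: filterS (u _ d1) => n hn.
rewrite distrC -(RintegralB _ (hfi n) hf)//; apply: le_trans (le_normr_Rintegral _ _) _ => //.
  exact: integB (hfi n) hf.
apply: (@le_trans _ _ (\int[mu]_(x in dom H) (d / (I + 1) * `|h x|))).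
  apply: le_Rintegral => //; [exact: integ_norm (integB (hfi n) hf)| |].
    exact: integZ (integ_norm hi).
  by move=> x Dx; rewrite -mulrBr normrM mulrC ler_wpM2r// hn.
rewrite RintegralZl//; last exact: integ_norm.
by rewrite -/I mulrAC ler_pdivrMr// ler_wpM2l ?ltW// ltrDl.
Qed.

Lemma unif_strong_L2 H (f_ : nat -> R -> R) f (g_ : nat -> R -> R) g : 0 < H ->
  (forall n, measurable_fun (dom H) (g_ n)) -> measurable_fun (dom H) g ->
  (forall n, ae_eq_dom H (g_ n) (f_ n)) -> ae_eq_dom H g f -> unif_cvg H f_ f ->
  strong_L2 H g_ g.
Proof.
move=> H0 m_ m e_ e u; rewrite /strong_L2.
have key (d : R) : 0 < d -> \forall n \near \oo,
    (Lnorm mu 2%:E (EFin \o ((g_ n \- g)%R \_ (dom H))) <= (d * (H + H) `^ 2^-1)%:E)%E.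
  move=> d0; apply: filterS (u _ d0) => n hn.
  apply: le_trans (@Lnorm2_le _ H _ d H0 (ltW d0) _ _) _.
  - exact: measurable_funB.
  - by apply: ae_imply2 (e_ n) e => x h1 h2 Dx /=; rewrite h1// h2// hn.
  rewrite lee_fin powRM; [|by rewrite exprn_ge0// ltW|by rewrite ltW// addr_gt0].
  by rewrite -(@powR_mulrn _ d 2 (ltW d0)) -powRrM divff// powRr1// ltW.
apply/fine_cvgP; split.
  apply: filterS (key 1 ltr01) => n hn; rewrite ge0_fin_numE ?Lnorm_ge0//.
  exact: le_lt_trans hn (ltry _).
apply/cvgrPdist_le => d d0.
have K0 : 0 < (H + H) `^ 2^-1 by rewrite powR_gt0// addr_gt0.
have d1 : 0 < d / (H + H) `^ 2^-1 by rewrite divr_gt0.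
apply: filterS (key _ d1) => n hn; rewrite sub0r normrN.
rewrite divfK ?gt_eqF// in hn.
rewrite ger0_norm ?fine_ge0 ?Lnorm_ge0//= -lee_fin fineK//.
by rewrite ge0_fin_numE ?Lnorm_ge0//; exact: le_lt_trans hn (ltry _).
Qed.

Lemma C1_increment_L1 H F r x y : C1 F r -> dom H x -> dom H y ->
  `|F x - F y| <= \int[mu]_(z in dom H) `|r z|.
Proof.
move=> FC; wlog xy : x y / y <= x.
  move=> h Dx Dy; have [|/ltW] := leP y x; first by move=> ?; exact: h.
  by rewrite distrC => ?; exact: h.
move=> /domE/andP[x1 x2] /domE/andP[y1 y2].
rewrite -(C1_FTC FC xy).
have sub : `[y, x] `<=` dom H.
  by move=> z; rewrite /= in_itv /= => /andP[z1 z2]; apply/domE/andP; split; lra.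
have ri : integ H r := cont_integ (continuous_subspaceT FC.2).
have ri' : mu.-integrable `[y, x] (EFin \o r).
  exact: (@integrableS _ _ _ mu _ _ _ (@dom_measurable_ocitv _ H)
    (measurable_itv `[y, x]) sub ri).
apply: le_trans (le_normr_Rintegral _ _) _ => //.
rewrite /Rintegral; apply: fine_le.
- by apply: integrable_fin_num => //; exact: integrable_abse ri'.
- by apply: integrable_fin_num => //; exact: integ_norm ri.
apply: ge0_subset_integral => //.
exact: measurable_int (integ_norm ri).
Qed.

(** Let [S] be a second primitive of [r]. The derivative of [F_ n - S] oscillates by at most the L^1
    distance of [r_ n] and [r], so it becomes constant in the limit; uniform convergence of [F_]
    identifies the constant. The limit is therefore [S] plus an affine function. *)
Lemma C2_limit H (F_ F1_ r_ : nat -> R -> R) r f : 0 < H -> (forall n, C1 (F_ n) (F1_ n)) ->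
  (forall n, C1 (F1_ n) (r_ n)) -> continuous r -> L1_cvg H r_ r -> unif_cvg H F_ f ->
  exists F F1, [/\ C1 F F1, C1 F1 r, forall x, dom H x -> f x = F x & unif_cvg H F1_ F1].
Proof.
move=> H0 C_ C1_ cr Lr uf.
have [S1 S1C] := primitive cr; have [S SC] := primitive (C1_cont S1C).
have DH : dom H H by apply/domE/andP; split; lra.
have DNH : dom H (- H) by apply/domE/andP; split; lra.
pose u x := f x - S x.
(* By the mean value theorem the derivative of [F_ n - S] takes the slope of its own chord over D
   somewhere, and these slopes tend to the slope [m] of the limit. *)
pose m := (u H - u (- H)) / (H + H).
have u_C n := C1B (C_ n) SC; have u1_C n := C1B (C1_ n) S1C.
have um : unif_cvg H (fun n x => F1_ n x - S1 x) (fun=> m).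
  move=> e e0; have e2 : 0 < e / 2 by lra.
  have eH : 0 < e / 2 * H by rewrite mulr_gt0.
  move/cvgrPdist_le : Lr => /(_ _ e2); apply: filterS2 (uf _ eH) => n hn.
  rewrite sub0r normrN ger0_norm ?Rintegral_ge0// => hL x Dx.
  have HH : - H <= H by lra.
  have [z /andP[z1 z2]] := C1_MVT (u_C n) HH.
  rewrite opprK => Ez.
  have Dz : dom H z by apply/domE/andP.
  have hx := le_trans (C1_increment_L1 (u1_C n) Dx Dz) hL.
  have hz : `|F1_ n z - S1 z - m| <= e / 2.
    have -> : F1_ n z - S1 z = (F_ n H - S H - (F_ n (- H) - S (- H))) / (H + H).
      by rewrite Ez mulfK// gt_eqF// addr_gt0.
    rewrite /m /u -mulrBl normrM [`|_^-1|]gtr0_norm ?invr_gt0 ?addr_gt0//.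
    rewrite ler_pdivrMr ?addr_gt0//.
    have := hn _ DH; have := hn _ DNH; rewrite !ler_norml => /andP[? ?] /andP[? ?].
    by apply/andP; split; lra.
  move: hx hz; rewrite !ler_norml => /andP[? ?] /andP[? ?]; apply/andP; split; lra.
have uE x : dom H x -> u x = u (- H) + m * (x + H).
  move=> Dx; apply/eqP; rewrite -subr_eq0 -normr_le0; apply/ler_addgt0Pl => e e0.
  rewrite addr0; have e4 : 0 < e / 4 by lra.
  have e5 : 0 < e / (4 * (H + H)) by rewrite divr_gt0// mulr_gt0// addr_gt0.
  have [n [hf hm]] := filter_ex (filterI (uf _ e4) (um _ e5)).
  have /domE /andP[x1 x2] := Dx.
  have [z /andP[z1 z2] Ez] := C1_MVT (u_C n) x1.
  have Dz : dom H z by apply/domE/andP; split; lra.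
  have h1 := hf _ Dx; have h2 := hf _ DNH; have h3 := hm _ Dz.
  have h4 : `|(F1_ n z - S1 z - m) * (x + H)| <= e / 4.
    rewrite normrM; apply: (@le_trans _ _ (e / (4 * (H + H)) * (H + H))).
      by apply: ler_pM => //; rewrite ger0_norm; lra.
    rewrite invfM mulrA divfK// gt_eqF// addr_gt0//.
  move: h1 h2 h4 Ez; rewrite opprK mulrBl !ler_norml => /andP[? ?] /andP[? ?] /andP[? ?] Ez.
  by rewrite /u; apply/andP; split; lra.
exists (fun x => S x + (u (- H) + m * (x + H))), (fun x => S1 x + m); split.
- apply: (C1_eq (C1D SC (C1D (C1_cst (u (- H))) (C1Z m (C1D (@C1_id R) (C1_cst H)))))) => x.
  by rewrite add0r addr0 mulr1.
- by apply: (C1_eq (C1D S1C (C1_cst m))) => x; rewrite addr0.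
- by move=> x Dx; rewrite -uE// /u addrC subrK.
move=> e e0; apply: filterS (um _ e0) => n hn x Dx.
by rewrite opprD addrA; exact: hn.
Qed.

End Convergence.

(** * Compactness *)

Section Compactness.
Context {R : realType}.
Implicit Types (H M L e a b c x y : R) (f g h : R -> R).

Lemma increasing_cvg (n_ : nat -> nat) : {homo n_ : i j / (i < j)%N} ->
  n_ k @[k --> \oo] --> \oo.
Proof.
move=> n_incr.
have le k : (k <= n_ k)%N.
  by elim: k => // k IH; exact: leq_ltn_trans IH (n_incr _ _ (ltnSn k)).
move=> P [N _ NP]; exists N => // k /= Nk; apply: NP => /=.
exact: leq_trans Nk (le k).
Qed.

Lemma unif_cvg_subseq H (f_ : nat -> R -> R) f (n_ : nat -> nat) :
  {homo n_ : i j / (i < j)%N} -> unif_cvg H f_ f -> unif_cvg H (fun k => f_ (n_ k)) f.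
Proof. by move=> hn uf e e0; exact: (increasing_cvg hn (uf e e0)). Qed.

(** By Tychonoff's theorem the functions bounded by [M] form a compact set for pointwise
    convergence; [f] is a cluster point of the sequence there. Its neighbourhoods control finitely
    many points at a time. *)
Lemma cluster_seq_pointwise M (g_ : nat -> R -> R) : (forall n x, `|g_ n x| <= M) ->
  exists f, forall (s : seq R) e N, 0 < e ->
    exists2 n, (N <= n)%N & forall x, x \in s -> `|g_ n x - f x| < e.
Proof.
move=> gM.
pose T := prod_topology (fun _ : R => R).
have cK : compact [set f : T | forall x, `[- M, M]%classic (f x)].
  exact: (@tychonoff R (fun _ => (R : topologicalType)) (fun _ => [set` `[- M, M]])
    (fun _ => @segment_compact _ (- M) M)).
have [|f [_ fcl]] := cK (g_ @ \oo) _.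
  by exists 0%N => // n _ x /=; rewrite in_itv /= -ler_norml.
exists f => s e N e0.
have nb : nbhs f (fun h : T => forall x, x \in s -> `|h x - f x| < e).
  elim: s => [|x s IH]; first by apply: filterE => h x; rewrite in_nil.
  have hx : nbhs f (fun h : T => `|h x - f x| < e).
    have pc : (fun h : T => h x : R) @ nbhs f --> (f x : R).
      exact: (@proj_continuous R (fun _ => (R : topologicalType)) x f).
    have fxe : nbhs (f x : R) (fun y : R => `|y - f x| < e).
      by apply/nbhs_ballP; exists e => //= y; rewrite /ball /= distrC.
    exact: pc fxe.
  apply: filterS2 hx IH => h h1 h2 y; rewrite in_cons => /predU1P[->//|]; exact: h2.
have : (g_ @ \oo) [set h | exists2 n, (N <= n)%N & h = g_ n].
  by exists N => // n /= Nn; exists n.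
move=> /fcl /(_ nb) [_ [[n Nn ->] hn]]; by exists n.
Qed.

Lemma dom_grid H d : 0 < d -> exists s : seq R, forall x, dom H x ->
  exists2 y, y \in s & dom H y /\ `|x - y| <= d.
Proof.
move=> d0; pose K := (Num.truncn ((H + H) / d)).+1.
exists [seq - H + i%:R * d | i <- iota 0 K] => x /domE /andP[x1 x2].
pose i := Num.truncn ((x + H) / d).
have xd0 : 0 <= (x + H) / d by apply: divr_ge0; lra.
have /andP[i1 i2] : i%:R <= (x + H) / d < i.+1%:R by exact: truncn_itv.
rewrite ler_pdivlMr// in i1; rewrite ltr_pdivrMr// in i2.
have id0 : 0 <= i%:R * d by rewrite mulr_ge0// ltW.
exists (- H + i%:R * d).
  apply/mapP; exists i => //; rewrite mem_iota /= add0n /K ltnS.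
  by apply: le_truncn; rewrite ler_pM2r ?invr_gt0//; lra.
split; first by apply/domE/andP; split; lra.
by move: i2; rewrite -natr1 mulrDl mul1r ler_norml => i2; apply/andP; split; lra.
Qed.

Lemma extract (P : nat -> nat -> Prop) :
  (forall k N, exists2 n, (N <= n)%N & P k n) ->
  exists2 n_ : nat -> nat, {homo n_ : i j / (i < j)%N} & forall k, P k (n_ k).
Proof.
move=> h; have {}h k N : {n | (N <= n)%N /\ P k n}.
  by apply: cid; have [n] := h k N; exists n.
pose fix n_ k := if k is k'.+1 then sval (h k (n_ k').+1) else sval (h 0%N 0%N).
exists n_; last by case=> [|k] /=; case: (h _ _) => n [].
apply: homo_ltn; first exact: ltn_trans.
by move=> k /=; case: (h _ _) => n [].
Qed.

(** A pointwise cluster point inherits the Lipschitz constant. Closeness on a finite grid, fine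
    enough for both functions to vary by at most [e / 4] between a point and its grid neighbour, is
    then closeness on all of D. *)
Lemma ascoli_lipschitz H M L (f_ : nat -> R -> R) : 0 < H -> 0 <= L ->
  (forall n x, dom H x -> `|f_ n x| <= M) ->
  (forall n x y, dom H x -> dom H y -> `|f_ n x - f_ n y| <= L * `|x - y|) ->
  exists2 n_ : nat -> nat, {homo n_ : i j / (i < j)%N} &
  exists2 f, (forall x y, dom H x -> dom H y -> `|f x - f y| <= L * `|x - y|) &
    unif_cvg H (fun k => f_ (n_ k)) f.
Proof.
move=> H0 L0 fM fL.
have [|f fcl] := @cluster_seq_pointwise M (fun n x => f_ n (clamp H x)).
  by move=> n x; apply: fM; exact: clamp_dom.
have fLip x y : dom H x -> dom H y -> `|f x - f y| <= L * `|x - y|.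
  move=> Dx Dy; apply/ler_addgt0Pr => e e0; have e2 : 0 < e / 2 by lra.
  have [n _ hn] := fcl [:: x; y] _ 0%N e2.
  have := hn x; have := hn y; rewrite !in_cons !eqxx orbT /= !clampE// => /(_ isT) h1 /(_ isT) h2.
  have := fL n x y Dx Dy; move: h1 h2; rewrite !ltr_norml !ler_norml.
  by move=> /andP[? ?] /andP[? ?] /andP[? ?]; apply/andP; split; lra.
have close k N : exists2 n, (N <= n)%N & forall x, dom H x -> `|f_ n x - f x| <= k.+1%:R^-1.
  pose e : R := k.+1%:R^-1; have e0 : 0 < e by rewrite invr_gt0.
  have L1 : 0 < L + 1 by lra.
  have d0 : 0 < e / 4 / (L + 1) by rewrite divr_gt0// divr_gt0.
  have [s sg] := dom_grid H d0.
  have e4 : 0 < e / 4 by lra.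
  have [n Nn hn] := fcl s _ N e4; exists n => // x Dx.
  have [y ys [Dy xy]] := sg x Dx.
  have Lxy : L * `|x - y| <= e / 4.
    apply: le_trans (ler_wpM2l L0 xy) _; rewrite mulrA ler_pdivrMr// mulrC.
    by rewrite ler_wpM2l// ?ltW//; lra.
  have := hn y ys; rewrite clampE// => h1.
  have h2 := le_trans (fL n x y Dx Dy) Lxy; have h3 := le_trans (fLip x y Dx Dy) Lxy.
  move: h1 h2 h3; rewrite -/e !ltr_norml !ler_norml.
  by move=> /andP[? ?] /andP[? ?] /andP[? ?]; apply/andP; split; lra.
have [n_ hn Pn] := extract close.
exists n_ => //; exists f => // e e0.
have : \forall k \near \oo, e^-1 < k%:R by exact: nbhs_infty_gtr.
apply: filterS => k ke x Dx; apply: le_trans (Pn k x Dx) _.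
rewrite invf_ple ?posrE//; apply: ltW; apply: lt_le_trans ke _; by rewrite ler_nat.
Qed.

(** Real numbers are read as constant functions on [[-1, 1]], with Lipschitz constant 0. *)
Lemma bolzano_weierstrass M (s_ : nat -> R) : (forall n, `|s_ n| <= M) ->
  exists2 n_ : nat -> nat, {homo n_ : i j / (i < j)%N} &
  exists s : R, s_ (n_ k) @[k --> \oo] --> s.
Proof.
move=> sM; have [||n_ hn [f _ uf]] :=
    @ascoli_lipschitz 1 M 0 (fun n _ => s_ n) ltr01 (lexx 0).
- by move=> n x _.
- by move=> n x y _ _; rewrite subrr normr0 mul0r.
exists n_ => //; exists (f 0); apply/cvgrPdist_le => e e0.
apply: filterS (uf e e0) => k; rewrite distrC; apply; apply/domE/andP; split; lra.
Qed.

End Compactness.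

(** * The dissipation potential and the flow map *)

Section SlopeComparison.
Context {R : realType}.
Implicit Types (a b p q d : R) (f g : R -> R).

(* Telescoping over a partition of [0, p] into equal pieces: [m] and [m'] play
   the role of the derivatives of the convex functions [f] and [f']. *)
Lemma slope_comparison (f f' m m' : R -> R) d :
  (forall a b, 0 <= a -> a <= b -> f b - f a <= m b * (b - a)) ->
  (forall a b, 0 <= a -> a <= b -> m' a * (b - a) <= f' b - f' a) ->
  (forall a, 0 <= a -> m a - m' a <= d) -> f 0 = f' 0 ->
  forall p, 0 <= p -> f p - f' p <= d * p.
Proof.
move=> hf hf' hm f0 p p0; apply/ler_addgt0Pr => e e0.
(* The slope of [f] is taken at the right end of each piece and that of [f'] at the left end. The
   mismatches telescope to [h * (m' p - m' 0)], which this [N] makes smaller than [e]. *)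
pose N := (Num.truncn (p * `|m' p - m' 0| / e)).+1.
have N0 : 0 < N%:R :> R by [].
pose h := p / N%:R; have h0 : 0 <= h by rewrite divr_ge0.
have key (i : nat) : f (i%:R * h) - f' (i%:R * h) <=
    d * (i%:R * h) + h * (m' (i%:R * h) - m' 0).
  elim: i => [|i IH]; first by rewrite !mul0r f0 !subrr !mulr0 addr0.
  have i0 : 0 <= i%:R * h by rewrite mulr_ge0.
  have ii : i%:R * h <= i.+1%:R * h by rewrite ler_wpM2r// ler_nat.
  have E : i.+1%:R * h - i%:R * h = h by rewrite -mulrBl -natrB// subSnn mul1r.
  have := hf _ _ i0 ii; have := hf' _ _ i0 ii.
  have := ler_wpM2r h0 (hm _ (le_trans i0 ii)).
  rewrite E => h1 h2 h3; have -> : i.+1%:R * h = i%:R * h + h by lra.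
  have E' : i.+1%:R * h = i%:R * h + h by lra.
  rewrite E' in h1 h2 h3; lra.
have := key N; rewrite /h mulrC divfK ?gt_eqF// => {}key.
apply: (le_trans key); rewrite lerD2l.
have : p * `|m' p - m' 0| / e < N%:R by rewrite /N; exact: truncnS_gt.
rewrite ltr_pdivrMr// => h1.
rewrite -mulrA [N%:R^-1 * _]mulrC mulrA ler_pdivrMr// mulrC [e * _]mulrC.
apply: le_trans (ltW h1); rewrite mulrC ler_wpM2l//; exact: ler_norm.
Qed.

End SlopeComparison.

Section Friction.
Context {R : realType} (mu Rd : R -> R -> R).
Implicit Types (a b p q s t d e x y : R).
Context (Rd_potential : dissipation_potential mu Rd).
Context (Rd_convex : forall t, strictly_convex (Rd ^~ t)).
Context (mu_nondecr : forall t p q, 0 <= p -> p <= q -> mu p t <= mu q t).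
Context (mu_nonincr : forall t p q, p <= q -> q <= 0 -> mu q t <= mu p t).
Context (mu_inf : 0 < inf (range (mu 0))).
Context (Rd_coercive : exists Phi : R -> R,
    [/\ continuous Phi, forall p, 0 <= Phi p, superlinear Phi
      & forall p t, Phi p <= Rd p t]).
Context (mu_modulus : exists o : R -> R,
    [/\ {within `[0, +oo[, continuous o}, forall r, 0 <= r -> 0 <= o r,
        o 0 = 0 & forall p t t', `|mu p t - mu p t'| <= o `|t - t'|]).

(** * Bounds and joint continuity of the dissipation potential *)

Lemma mu_gt0 p t : 0 < mu p t.
Proof.
have h0 : 0 < mu 0 t.
  by apply: lt_le_trans mu_inf (inf_le mu_inf _); exists t.
apply: lt_le_trans h0 _; have [p0|p0] := leP 0 p; first exact: mu_nondecr.
by apply: mu_nonincr => //; exact: ltW.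
Qed.

Lemma Rd0 t : Rd 0 t = 0.
Proof. by case: (Rd_potential t). Qed.

Lemma Rd_ge0 p t : 0 <= Rd p t.
Proof. by case: Rd_coercive => Phi [_ P0 _ /(_ p t)]; exact: le_trans. Qed.

(** [Num.sg] is a selection of the set-valued sign, so that one formula provides a subgradient at
    every [p], with value 0 at [p = 0]. *)
Lemma friction_sg p t : friction mu p t (mu p t * Num.sg p).
Proof.
exists (Num.sg p) => //; rewrite /Sign; case: ifPn => [/gtr0_sg -> //|].
rewrite -leNgt => p0; case: ifPn => [/ltr0_sg -> //|].
rewrite -leNgt => p0'; have -> : p = 0 by lra.
by rewrite sgr0 /=; lra.
Qed.

Lemma frictionP p t s : friction mu p t s <-> forall q, Rd p t + s * (q - p) <= Rd q t.
Proof. by have [_ /(_ p) <-] := Rd_potential t. Qed.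

Lemma Rd_subgradient p q t : Rd p t + mu p t * Num.sg p * (q - p) <= Rd q t.
Proof. by have /frictionP := friction_sg p t. Qed.

Lemma Rd_lip p q t : Rd p t - Rd q t <= mu p t * `|p - q|.
Proof.
have := Rd_subgradient p q t => h.
apply: (@le_trans _ _ (mu p t * Num.sg p * (p - q))); first lra.
rewrite -mulrA ler_wpM2l ?(ltW (mu_gt0 _ _))//.
apply: le_trans (ler_norm _) _; rewrite normrM ler_piMl//.
by rewrite normr_sg; case: (p != 0).
Qed.

Lemma modulus_small (o : R -> R) : {within `[0, +oo[, continuous o} -> o 0 = 0 ->
  forall e, 0 < e -> exists2 d : R, 0 < d & forall r : R, 0 <= r -> r < d -> o r < e.
Proof.
move=> /subspace_continuousP /(_ 0) co o0 e e0.
have D0 : [set` `[0, +oo[] (0 : R) by rewrite /= in_itv /= lexx.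
have := co D0 => /cvgrPdist_lt /(_ e e0); rewrite near_withinE.
move=> /nbhs_ballP[d /= d0 hd]; exists d => // r r0 rd.
have := hd r; rewrite /ball /= sub0r normrN ger0_norm// in_itv /= r0 => /(_ rd isT).
rewrite /from_subspace o0 sub0r normrN; apply: le_lt_trans; exact: ler_norm.
Qed.

(** Away from 0 the slope of the potential is [mu] up to sign, and the modulus [o] compares these
    slopes for two values of the aging. [slope_comparison] transfers this to the potentials without
    integrating [mu]; negative [p] is treated by reflection. *)
Lemma Rd_modulus : exists o : R -> R,
  [/\ forall e, 0 < e -> exists2 d : R, 0 < d & forall r : R, 0 <= r -> r < d -> o r < e &
   forall p t t', `|Rd p t - Rd p t'| <= o `|t - t'| * `|p|].
Proof.
case: mu_modulus => o [co _ o0 mo]; exists o; split; first exact: modulus_small.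
suff h p t t' : Rd p t - Rd p t' <= o `|t - t'| * `|p|.
  by move=> p t t'; rewrite ler_norml; have := h p t t'; have := h p t' t;
    rewrite distrC => ? ?; apply/andP; split; lra.
have mle a : mu a t - mu a t' <= o `|t - t'| by apply: le_trans (ler_norm _) (mo _ _ _).
have [p0|p0] := leP 0 p.
  rewrite (ger0_norm p0).
  refine (@slope_comparison _ (Rd ^~ t) (Rd ^~ t') (mu ^~ t) (mu ^~ t') _ _ _ _ _ p p0) => //.
  - move=> a b a0 ab; apply: le_trans (Rd_lip b a t) _.
    by rewrite ger0_norm// subr_ge0.
  - move=> a b; rewrite le_eqVlt => /predU1P[<-|a0] ab.
      (* The selection [Num.sg] would give slope 0 at the origin; the comparison asks for the
         largest subgradient there. *)
      have : friction mu 0 t' (mu 0 t').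
        by exists 1; rewrite ?mulr1// /Sign ltxx /= lexx; lra.
      by move/frictionP => /(_ b); rewrite Rd0; lra.
    by have := Rd_subgradient a b t'; rewrite gtr0_sg// mulr1; lra.
  - by rewrite !Rd0.
rewrite (ltr0_norm p0).
have -> : Rd p t - Rd p t' = Rd (- - p) t - Rd (- - p) t' by rewrite opprK.
have Np0 : 0 <= - p by lra.
refine (@slope_comparison _ (fun p => Rd (- p) t) (fun p => Rd (- p) t')
  (fun p => mu (- p) t) (fun p => mu (- p) t') _ _ _ _ _ (- p) Np0) => //.
- move=> a b a0 ab; apply: le_trans (Rd_lip (- b) (- a) t) _.
  by rewrite ler0_norm; lra.
- move=> a b; rewrite le_eqVlt => /predU1P[<-|a0] ab.
    have : friction mu 0 t' (- mu 0 t').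
      by exists (-1); rewrite ?mulrN1// /Sign ltxx /= lexx; lra.
    by move/frictionP => /(_ (- b)); rewrite oppr0 Rd0; lra.
  by have := Rd_subgradient (- a) (- b) t'; rewrite ltr0_sg ?oppr_lt0// mulrN1; lra.
- by rewrite oppr0 !Rd0.
Qed.

Lemma mu_bound p M t : `|p| <= M -> mu p t <= mu M t + mu (- M) t.
Proof.
rewrite ler_norml => /andP[h1 h2]; have := mu_gt0 M t; have := mu_gt0 (- M) t.
have [p0|p0] := leP 0 p; first by have := mu_nondecr t p0 h2; lra.
by have := mu_nonincr t h1 (ltW p0); lra.
Qed.

(** The potential is Lipschitz in [p] on bounded sets for fixed aging, and has a modulus of
    continuity in the aging that is uniform on bounded sets of [p]. *)
Lemma Rd_cont : continuous (fun z : R * R => Rd z.1 z.2).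
Proof.
move=> [p0 t0] /=; apply/cvgrPdist_lt => e e0 /=.
case: Rd_modulus => mo [mo_small Ro].
pose M : R := `|p0| + 1.
have M0 : 0 < M by rewrite ltr_wpDl.
pose K := mu M t0 + mu (- M) t0.
have K0 : 0 < K by rewrite addr_gt0// mu_gt0.
have eM : 0 < e / 2 / M by rewrite !divr_gt0.
have [d d0 od] := mo_small _ eM.
have dK : 0 < e / 2 / K by rewrite !divr_gt0.
have c1 : (fun z : R * R => z.1) z @[z --> (p0, t0)] --> p0 by exact: cvg_fst.
have c2 : (fun z : R * R => z.2) z @[z --> (p0, t0)] --> t0 by exact: cvg_snd.
near=> z.
have z1 : `|p0 - z.1| < Num.min 1 (e / 2 / K).
  by near: z; move/cvgrPdist_lt : c1; apply; rewrite lt_min ltr01.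
have z2 : `|t0 - z.2| < d.
  by near: z; move/cvgrPdist_lt : c2; apply.
move: z1; rewrite lt_min => /andP[z11 z12].
have zM : `|z.1| <= M.
  rewrite /M -[z.1](subrKC p0) ; apply: le_trans (ler_normD _ _) _.
  by rewrite lerD2l distrC ltW.
have h1 : `|Rd z.1 t0 - Rd z.1 z.2| <= e / 2.
  apply: le_trans (Ro _ _ _) _.
  apply: (@le_trans _ _ (e / 2 / M * `|z.1|)).
    by rewrite ler_wpM2r// ltW// od.
  apply: (@le_trans _ _ (e / 2 / M * M)); last by rewrite divfK ?gt_eqF.
  by rewrite ler_wpM2l// divr_ge0; lra.
have h2 : `|Rd p0 t0 - Rd z.1 t0| < e / 2.
  have p0M : `|p0| <= M by rewrite lerDl.
  apply: (@le_lt_trans _ _ (K * `|p0 - z.1|)); last by rewrite mulrC -ltr_pdivlMr.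
  have := Rd_lip p0 z.1 t0; have := Rd_lip z.1 p0 t0; rewrite [`|z.1 - _|]distrC.
  have := ler_wpM2r (normr_ge0 (p0 - z.1)) (mu_bound t0 zM).
  have := ler_wpM2r (normr_ge0 (p0 - z.1)) (mu_bound t0 p0M).
  rewrite -/K ler_norml => ? ? ? ?; apply/andP; split; lra.
move: h1 h2; rewrite ler_norml !ltr_norml => /andP[? ?] /andP[? ?].
by apply/andP; split; lra.
Unshelve. all: by end_near. Qed.

Lemma Rd_convex_le p q l t : 0 <= l <= 1 ->
  Rd (l * p + (1 - l) * q) t <= l * Rd p t + (1 - l) * Rd q t.
Proof.
move=> /andP[]; rewrite le_eqVlt => /predU1P[<- _|l0].
  by rewrite !mul0r !add0r !subr0 !mul1r.
rewrite le_eqVlt => /predU1P[->|l1]; first by rewrite !subrr !mul0r !addr0 !mul1r.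
have [->|pq] := eqVneq p q; first by rewrite -!mulrDl addrC subrK !mul1r.
exact/ltW/Rd_convex.
Qed.

(** Beyond [M] the quotient of [Phi p] by the modulus of [p] is at least [k]; within [M] the term
    [k * M] suffices because the potential is nonnegative. [M] does not depend on [t]. *)
Lemma Rd_superlinear (k : R) : 0 <= k ->
  exists2 M, 0 <= M & forall p t, k * `|p| <= k * M + Rd p t.
Proof.
move=> k0; case: Rd_coercive => Phi [_ P0 [cy cNy] PR].
have [A [_ hA]] : \forall p \near +oo, k <= Phi p / `|p| by move/cvgryPge : cy; apply.
have [B [_ hB]] : \forall p \near -oo, k <= Phi p / `|p| by move/cvgryPge : cNy; apply.
exists (Num.max `|A| `|B|); first by rewrite le_max normr_ge0.
move=> p t; have [pM|pM] := leP `|p| (Num.max `|A| `|B|).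
  by have := Rd_ge0 p t; have := ler_wpM2l k0 pM; lra.
have kM0 : 0 <= k * Num.max `|A| `|B| by rewrite mulr_ge0// le_max normr_ge0.
suff h : k <= Phi p / `|p|.
  rewrite ler_pdivlMr in h; first by have := PR p t; lra.
  by apply: le_lt_trans pM; rewrite le_max normr_ge0.
move: pM; rewrite gt_max => /andP[]; have [p0|p0] := leP 0 p.
  move=> pA _; rewrite (ger0_norm p0) in pA; apply: hA; exact: le_lt_trans (ler_norm A) pA.
move=> _ pB; rewrite (ltr0_norm p0) in pB; apply: hB; have := ler_norm (- B); rewrite normrN; lra.
Qed.

(** * The minimizing strain rate: existence, uniqueness, continuity and growth around it *)

Lemma flow_exists s t : exists p, forall q, Rd p t - s * p <= Rd q t - s * q.
Proof.
have s1 : 0 <= `|s| + 1 by rewrite addr_ge0.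
have [M M0 hM] := Rd_superlinear s1.
(* Beyond [N] the growth bound makes [Rd q t - s * q] positive, hence larger than its value 0 at
   [q = 0]; so the minimum over [[- N, N]] is global. *)
pose N := (`|s| + 1) * M.
have cG : continuous (fun p => Rd p t - s * p).
  move=> p; apply: cvgB; last by apply: cvgM; [exact: cvg_cst|exact: cvg_id].
  by apply: (cvg_joint _ Rd_cont); [exact: cvg_id|exact: cvg_cst].
have N0 : 0 <= N by rewrite mulr_ge0// addr_ge0.
have NN : - N <= N by lra.
have [p _ hp] := EVT_min NN (continuous_subspaceT cG).
exists p => q; have [qN|qN] := leP `|q| N; first by apply: hp; rewrite in_itv /= -ler_norml.
apply: (@le_trans _ _ (Rd 0 t - s * 0)); first by apply: hp; rewrite in_itv /= oppr_le0 N0.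
rewrite Rd0 mulr0 subr0; have := hM q t.
have := ler_norm (s * q); rewrite normrM -/N; lra.
Qed.

Lemma flow_friction s t : friction mu (flow_map mu s t) t s.
Proof.
have [p hp] := flow_exists s t.
rewrite /flow_map; apply: (@xgetI _ 0 [set p | friction mu p t s] p) => /=; apply/frictionP => q.
have := hp q; lra.
Qed.

Lemma flow_min s t q : Rd (flow_map mu s t) t - s * flow_map mu s t <= Rd q t - s * q.
Proof. have /frictionP /(_ q) := flow_friction s t; lra. Qed.

Lemma flow_min_lt s t q : q != flow_map mu s t ->
  Rd (flow_map mu s t) t - s * flow_map mu s t < Rd q t - s * q.
Proof.
set p := flow_map mu s t => qp; rewrite lt_neqAle flow_min andbT; apply/eqP => E.
have h2 : (0 : R) < 1 / 2 by lra. have h3 : (1 / 2 : R) < 1 by lra.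
have := @Rd_convex t q p (1 / 2) qp h2 h3; have := flow_min s t (1 / 2 * q + (1 - 1 / 2) * p).
rewrite -/p; lra.
Qed.

(** By convexity the difference quotients of [G] from its minimizer increase with the distance, so
    from distance [e] on they are at least the smaller of those at [p + e] and [p - e]. [G] and [p]
    are mere abbreviations. *)
Lemma flow_growth s t e q : 0 < e -> e <= `|q - flow_map mu s t| ->
  forall G p, G = (fun q => Rd q t - s * q) -> p = flow_map mu s t ->
  Num.min (G (p + e) - G p) (G (p - e) - G p) / e * `|q - p| <= G q - G p.
Proof.
move=> e0 + G p GE pE; rewrite -pE => eq.
have conv l : 0 <= l <= 1 -> G (l * q + (1 - l) * p) <= l * G q + (1 - l) * G p.
  by move=> l01; have := Rd_convex_le q p t l01; rewrite GE; lra.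
have d0 : 0 < `|q - p| := lt_le_trans e0 eq.
pose l := e / `|q - p|.
have l01 : 0 <= l <= 1.
  apply/andP; split; first exact: divr_ge0 (ltW e0) (normr_ge0 _).
  by rewrite /l ler_pdivrMr// mul1r.
have := conv _ l01.
have [qp|qp] := leP p q.
  have -> : l * q + (1 - l) * p = p + e.
    rewrite /l ger0_norm ?subr_ge0//; field.
    by move: d0; rewrite normr_gt0.
  move=> h; rewrite mulrAC ler_pdivrMr//.
  have : G (p + e) - G p <= l * (G q - G p) by lra.
  rewrite /l mulrAC ler_pdivlMr// [e * _]mulrC; apply: le_trans.
  by rewrite ler_wpM2r// ge_min lexx.
have -> : l * q + (1 - l) * p = p - e.
  rewrite /l ltr0_norm ?subr_lt0//; field.
  by move: d0; rewrite normr_gt0 -opprB oppr_eq0.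
move=> h; rewrite mulrAC ler_pdivrMr//.
have : G (p - e) - G p <= l * (G q - G p) by lra.
rewrite /l mulrAC ler_pdivlMr// [e * _]mulrC; apply: le_trans.
by rewrite ler_wpM2r// ge_min lexx orbT.
Qed.

(** At [t], the value at [p] is strictly below those at [p + e] and [p - e], and this persists for
    [u] near [t]. If the minimizer at [u] were at distance at least [e] from [p], convexity on the
    segment between them would contradict one of these inequalities. *)
Lemma flow_cont s : continuous (flow_map mu s).
Proof.
move=> t; apply/cvgrPdist_lt => e e0.
set p := flow_map mu s t.
pose G q u := Rd q u - s * q.
have cG q : G q u @[u --> t] --> G q t.
  apply: cvgB; last exact: cvg_cst.
  by apply: (cvg_joint _ Rd_cont); [exact: cvg_cst|exact: cvg_id].
have lt1 : G p t < G (p + e) t by apply: flow_min_lt; rewrite -/p; apply/eqP; lra.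
have lt2 : G p t < G (p - e) t by apply: flow_min_lt; rewrite -/p; apply/eqP; lra.
have n1 : \forall u \near t, G p u < G (p + e) u.
  have h : G (p + e) u - G p u @[u --> t] --> G (p + e) t - G p t by apply: cvgB; exact: cG.
  have g0 : 0 < G (p + e) t - G p t by rewrite subr_gt0.
  by apply: filterS (cvgr_gt _ h _ g0) => u; rewrite subr_gt0.
have n2 : \forall u \near t, G p u < G (p - e) u.
  have h : G (p - e) u - G p u @[u --> t] --> G (p - e) t - G p t by apply: cvgB; exact: cG.
  have g0 : 0 < G (p - e) t - G p t by rewrite subr_gt0.
  by apply: filterS (cvgr_gt _ h _ g0) => u; rewrite subr_gt0.
apply: filterS2 n1 n2 => u h1 h2; rewrite ltNge; apply/negP => eq.
set q := flow_map mu s u in eq.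
have min_q := flow_min s u p; rewrite -/q -/(G q u) -/(G p u) in min_q.
have conv l : 0 <= l <= 1 -> G (l * q + (1 - l) * p) u <= l * G q u + (1 - l) * G p u.
  by move=> l01; have := Rd_convex_le q p u l01; rewrite /G; lra.
have d0 : 0 < `|p - q| := lt_le_trans e0 eq.
pose l := e / `|p - q|.
have l01 : 0 <= l <= 1.
  apply/andP; split; first exact: divr_ge0 (ltW e0) (normr_ge0 _).
  by rewrite /l ler_pdivrMr// mul1r.
have := conv _ l01; have /andP[l0 _] := l01.
have le1 : l * G q u <= l * G p u by exact: ler_wpM2l.
have [qp|qp] := leP p q.
  have -> : l * q + (1 - l) * p = p + e.
    rewrite /l distrC ger0_norm ?subr_ge0//; field.
    by move: d0; rewrite distrC normr_gt0.
  by lra.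
have -> : l * q + (1 - l) * p = p - e.
  rewrite /l gtr0_norm ?subr_gt0//; field.
  by move: d0; rewrite normr_gt0.
by lra.
Qed.

(** The growth rate found in [flow_growth] is positive and depends continuously on [t], so it has a
    positive minimum on the compact set [A]. *)
Lemma flow_uniform_growth s e (A : set R) : 0 < e -> compact A ->
  exists2 c, 0 < c & forall t q, A t -> e <= `|q - flow_map mu s t| ->
    c * `|q - flow_map mu s t| <=
      Rd q t - s * q - (Rd (flow_map mu s t) t - s * flow_map mu s t).
Proof.
move=> e0 cA.
pose G q t := Rd q t - s * q; pose P := flow_map mu s.
pose m t := Num.min (G (P t + e) t - G (P t) t) (G (P t - e) t - G (P t) t).
have cG f : continuous f -> continuous (fun t => G (f t) t).
  move=> cf t; apply: cvgB; last by apply: cvgM; [exact: cvg_cst|exact: cf].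
  by apply: (cvg_joint _ Rd_cont); [exact: cf|exact: cvg_id].
have cP := @flow_cont s.
have cm : continuous m.
  move=> t; apply: (@continuous_min _ _ (fun t => G (P t + e) t - G (P t) t)
     (fun t => G (P t - e) t - G (P t) t)); apply: cvgB.
  - by apply: (cG (fun t => P t + e)) => u; apply: cvgD; [exact: cP|exact: cvg_cst].
  - exact: (cG P).
  - by apply: (cG (fun t => P t - e)) => u; apply: cvgB; [exact: cP|exact: cvg_cst].
  - exact: (cG P).
have m0 t : 0 < m t.
  rewrite lt_min !subr_gt0; apply/andP; split; apply: flow_min_lt; rewrite -/(P t).
    by apply/eqP; lra.
  by apply/eqP; lra.
have [A0|/set0P A0] := eqVneq A set0.
  by exists 1 => // t q; rewrite A0.
have [t0 _ tmin] := @compact_EVT_min _ _ _ _ A0 cA (continuous_subspaceT cm).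
exists (m t0 / e); first by rewrite divr_gt0.
move=> t q At eq; have := @flow_growth s t e q e0 eq _ _ erefl erefl.
apply: le_trans; rewrite ler_wpM2r// ler_wpM2r ?invr_ge0 ?(ltW e0)//.
exact: (tmin t (mem_set At)).
Qed.

End Friction.

(** * The variational problem for the strain rate *)

Section Approximation.
Context {R : realType}.
Notation mu := (@lebesgue_measure R).
Implicit Types (H M L K e a b c x y s t : R) (f g h F r : R -> R).

Lemma C1_expr n : exists d, C1 (fun x : R => x ^+ n) d.
Proof.
elim: n => [|n [d dC]].
  by exists (fun=> 0); exact: C1_cst.
exists (fun x => x * d x + x ^+ n * 1).
rewrite (_ : (fun x => _) = (fun x : R => id x * x ^+ n)).
  exact: (C1M (@C1_id R) dC).
by apply/funext => x; rewrite exprS.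
Qed.

(* Steklov averages of [g], cut off at the end points of the domain. *)
Lemma C1_approximation H M g : 0 < H -> continuous g -> (forall x, `|g x| <= M) ->
  exists Q_ Q1_ : nat -> R -> R, [/\ forall k, C1 (Q_ k) (Q1_ k),
    forall k, Q_ k (- H) = 0 /\ Q_ k H = 0,
    forall k x, dom H x -> `|Q_ k x| <= M &
    forall x, - H < x < H -> Q_ k x @[k --> \oo] --> g x].
Proof.
move=> H0 cg gM; have [P PC] := primitive cg.
pose h (k : nat) : R := k.+1%:R^-1.
have h0 k : 0 < h k by rewrite invr_gt0.
pose A k x := k.+1%:R * (P (x + h k) - P x).
have AM k x : exists2 z, x <= z <= x + h k & A k x = g z.
  have [|z zx E] := @C1_MVT _ P g x (x + h k) PC; first by have := h0 k; lra.
  exists z => //; rewrite /A E; have -> : x + h k - x = h k by lra.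
  by rewrite /h mulrCA mulfV ?mulr1// pnatr_eq0.
(* The cut-off vanishes at both end points, takes values in [[0, 1]] on D, and tends to 1 at
   interior points. *)
pose X k x := 1 - ((x / H) ^+ 2) ^+ k.+1.
have X01 k x : dom H x -> 0 <= X k x <= 1.
  move=> /domE /andP[x1 x2].
  have : 0 <= (x / H) ^+ 2 <= 1.
    rewrite sqr_ge0 -(real_normK (num_real _)) exprn_ile1//.
    rewrite normrM normfV (gtr0_norm H0) ler_pdivrMr// mul1r ler_norml.
    by apply/andP.
  move=> /andP[u0 u1]; rewrite /X subr_ge0 exprn_ile1//= gerBl exprn_ge0//.
have AC k : exists A1, C1 (A k) A1.
  exists (fun x => k.+1%:R * ((1 + 0) * g (x + h k) - g x)).
  exact: (C1Z k.+1%:R (C1B (C1_comp (C1D (@C1_id R) (C1_cst (h k))) PC) PC)).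
have XC k : exists X1, C1 (X k) X1.
  have [d dC] := C1_expr 2; have [d' d'C] := C1_expr k.+1.
  eexists; exact: (C1B (C1_cst 1) (C1_comp (C1_comp (C1M (@C1_id R) (C1_cst H^-1)) dC) d'C)).
have QC k : exists Q1, C1 (fun x => X k x * A k x) Q1.
  by have [A1 h1] := AC k; have [X1 h2] := XC k; eexists; exact: (C1M h2 h1).
exists (fun k x => X k x * A k x), (fun k => sval (cid (QC k))); split.
- by move=> k; case: (cid (QC k)).
- move=> k; rewrite /X mulNr sqrrN divff ?gt_eqF// !expr1n subrr !mul0r//.
- move=> k x /(X01 k) /andP[u0 u1]; have [z _ ->] := AM k x.
  rewrite normrM (ger0_norm u0); apply: le_trans (gM z).
  by rewrite ler_piMl.
move=> x /andP[x1 x2]; rewrite -[X in _ --> X](mul1r (g x)); apply: cvgM.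
  rewrite -[X in _ --> X](subr0 1); apply: cvgB; first exact: cvg_cst.
  rewrite (cvg_shiftS (fun n => ((x / H) ^+ 2) ^+ n)).
  apply: cvg_expr; rewrite ger0_norm ?sqr_ge0// -(real_normK (num_real _)) expr_lt1//.
  by rewrite normrM normfV (gtr0_norm H0) ltr_pdivrMr// mul1r ltr_norml x1 x2.
apply/cvgrPdist_le => e e0.
have /cvgrPdist_le /(_ e e0) /nbhs_ballP[d /= d0 hd] := cg x.
have : \forall k \near \oo, d^-1 < k%:R by exact: nbhs_infty_gtr.
apply: filterS => k ke; have [z /andP[z1 z2] ->] := AM k x; apply: hd.
have hkd : h k < d.
  rewrite /h invf_plt ?posrE//; apply: lt_le_trans ke _; by rewrite ler_nat.
by rewrite /ball /= ltr_distl; apply/andP; split; lra.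
Qed.

End Approximation.

(** * Consequences of the Lagrangian inequality *)

Section Variational.
Context {R : realType} (Rd : R -> R -> R).
Notation mu := (@lebesgue_measure R).
Implicit Types (H M L K e a b c x y s t eta vinf lo hi : R) (p q th f g h F r : R -> R).
Context (Rd_cont : continuous (fun z : R * R => Rd z.1 z.2)).
Context (Rd_ge0 : forall p t : R, 0 <= Rd p t).

Lemma Rd_comp_cont H p th : 0 < H -> {within dom H, continuous p} ->
  {within dom H, continuous th} -> {within dom H, continuous (fun x => Rd (p x) (th x))}.
Proof.
move=> H0 cp cth.
apply: (@eq_dom_continuous _ H _ (fun x => Rd (p (clamp H x)) (th (clamp H x)))).
  by move=> x Dx; rewrite clampE.
move=> x; apply: (cvg_joint _ Rd_cont); exact: clamp_comp_cont.
Qed.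

Lemma Lp2_sqr_integ H f : Lp H 2%:E f -> integ H (fun x => f x ^+ 2).
Proof.
move=> f2; have := Lfun2_integrable_sqr f2.
move=> /(@integrableS _ _ _ mu _ _ _ measurableT (@dom_measurable_ocitv R H) (@subsetT _ _)).
move=> h; refine (@eq_integrable _ _ _ mu _ _ _ _ _ h) => //.
by move=> x Dx; rewrite /= patchE Dx.
Qed.

Lemma wderiv_sqr_integ H p : 0 < H -> sobolev H 1 2%:E p ->
  integ H (fun x => wderiv H p x ^+ 2).
Proof.
move=> H0 [_ _ [g pg g2]]; have [[_ /Lp_measurable mw _] wg] := wderivP H0 pg.
apply: integ_ae_eq (Lp2_sqr_integ g2).
  exact: measurable_funX.
by apply: ae_imply wg => x h /h ->.
Qed.

Lemma energyB_ge H eta p th : 0 < H -> 0 < eta -> sobolev H 1 2%:E p ->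
  {within dom H, continuous th} ->
  \int[mu]_(x in dom H) Rd (p x) (th x) <= energyB H eta Rd th p.
Proof.
move=> H0 eta0 sp cth; have cp : {within dom H, continuous p} by case: sp.
have i1 := cont_integ (Rd_comp_cont H0 cp cth).
have i2 := integZ (eta / 2) (wderiv_sqr_integ H0 sp).
apply: le_Rintegral => //; first exact: integD i1 i2.
by move=> x _; rewrite lerDl mulr_ge0 ?sqr_ge0// divr_ge0// ltW.
Qed.

Lemma energyB_C1 H eta Q Q1 th : 0 < H -> C1 Q Q1 -> {within dom H, continuous th} ->
  energyB H eta Rd th Q = \int[mu]_(x in dom H) Rd (Q x) (th x) +
    eta / 2 * \int[mu]_(x in dom H) (Q1 x ^+ 2).
Proof.
move=> H0 QC cth; have [_ wQ] := C1_wderiv H0 QC (fun x _ => erefl).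
have [_ s2 _] := C1_sobolev1 H0 QC (fun x _ => erefl).
have iQ := cont_integ (Rd_comp_cont H0 (continuous_subspaceT (C1_cont QC)) cth).
have iQ1 : integ H (fun x => Q1 x ^+ 2).
  by apply/cont_integ/continuous_subspaceT => x; apply: (@cvgM _ _ _ _ Q1 Q1); exact: QC.2.
have iw := wderiv_sqr_integ H0 s2.
have i1 := integD iQ (integZ (eta / 2) iw).
have i2 := integD iQ (integZ (eta / 2) iQ1).
rewrite -RintegralZl// -RintegralD//; last exact: integZ.
apply: ae_eq_Rint; [exact: integ_measurable i1|exact: integ_measurable i2|].
by apply: ae_imply wQ => x h /h ->.
Qed.

(** The gradient term of [p] is nonnegative and is dropped, whereas that of the competitor [Q] is
    kept, with its factor [eta]. The multiplier makes every [Q] with zero boundary values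
    admissible, whatever its integral. *)
Lemma lagrange_le H vinf eta p th s Q Q1 : 0 < H -> 0 < eta ->
  {within dom H, continuous th} -> sobolev H 1 2%:E p ->
  lagrange_multiplier H vinf eta Rd th p s -> C1 Q Q1 -> Q (- H) = 0 -> Q H = 0 ->
  \int[mu]_(x in dom H) Rd (p x) (th x) - s * \int[mu]_(x in dom H) p x <=
  \int[mu]_(x in dom H) Rd (Q x) (th x) - s * \int[mu]_(x in dom H) Q x +
    eta / 2 * \int[mu]_(x in dom H) (Q1 x ^+ 2).
Proof.
move=> H0 eta0 cth sp lm QC QNH QH.
have [_ s2 _] := C1_sobolev1 H0 QC (fun x _ => erefl).
have := lm Q (And3 s2 QNH QH); rewrite (energyB_C1 _ H0 QC cth).
have := energyB_ge H0 eta0 sp cth; lra.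
Qed.

(** The competitors are the multiples [a * q] of a parabola vanishing at the end points. Each bounds
    the dissipated energy plus [s * (a * J - 2 * vinf)], uniformly in [eta], [p], [th] and [s]. *)
Lemma multiplier_bound H vinf lo hi (E : R) : 0 < H -> exists K, forall eta p th s,
  0 < eta -> eta <= E -> {within dom H, continuous th} ->
  (forall x, dom H x -> lo <= th x <= hi) -> sobolev H 1 2%:E p ->
  \int[mu]_(x in dom H) p x = 2 * vinf ->
  lagrange_multiplier H vinf eta Rd th p s ->
  `|s| <= K /\ \int[mu]_(x in dom H) Rd (p x) (th x) <= K.
Proof.
move=> H0.
pose q x := (H - x) * (H + x).
have qC : C1 q (fun x => (H - x) * (0 + 1) + (H + x) * (0 - 1)).
  exact: (C1M (C1B (C1_cst H) (@C1_id R)) (C1D (C1_cst H) (@C1_id R))).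
set q1 := (fun x => _) in qC.
have cq1 : continuous q1 by exact: qC.2.
have cq := C1_cont qC.
have qi : integ H q by exact/cont_integ/continuous_subspaceT.
pose J := \int[mu]_(x in dom H) q x.
have q0 x : dom H x -> 0 <= q x.
  by move=> /domE /andP[x1 x2]; rewrite mulr_ge0//; lra.
have J0 : 0 < J.
  have [S SC] := primitive cq.
  have HH : - H <= H by lra.
  rewrite /J (C1_FTC SC HH).
  have i1 : - H <= - (H / 2) by lra.
  have i2 : - (H / 2) <= H / 2 by lra.
  have i3 : H / 2 <= H by lra.
  have [z1 /andP[? ?] E1] := C1_MVT SC i1; have [z2 /andP[? ?] E2] := C1_MVT SC i2.
  have [z3 /andP[? ?] E3] := C1_MVT SC i3.
  have e1 : 0 <= q z1 * (- (H / 2) - - H).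
    by apply: mulr_ge0; [apply/q0/domE/andP; split; lra|lra].
  have e2 : 0 < q z2 * (H / 2 - - (H / 2)).
    by apply: mulr_gt0; [rewrite mulr_gt0//; lra|lra].
  have e3 : 0 <= q z3 * (H - H / 2).
    by apply: mulr_ge0; [apply/q0/domE/andP; split; lra|lra].
  lra.
pose I1 := \int[mu]_(x in dom H) (q1 x ^+ 2).
have I10 : 0 <= I1 by apply: Rintegral_ge0 => x _; exact: sqr_ge0.
have key a : exists K, forall eta p th s, 0 < eta -> eta <= E ->
    {within dom H, continuous th} -> (forall x, dom H x -> lo <= th x <= hi) ->
    sobolev H 1 2%:E p -> \int[mu]_(x in dom H) p x = 2 * vinf ->
    lagrange_multiplier H vinf eta Rd th p s ->
    \int[mu]_(x in dom H) Rd (p x) (th x) + s * (a * J - 2 * vinf) <= K.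
  pose b := `|a| * (H + H) ^+ 2.
  have [K _ hK] := continuous_bounded_rect (- b) b lo hi Rd_cont.
  exists (K * (H + H) + `|E| / 2 * (a ^+ 2 * I1)) => eta p th s eta0 etaE cth thI sp pv lm.
  have aqC := C1Z a qC.
  have aqNH : a * q (- H) = 0 by rewrite /q subrr !mulr0.
  have aqH : a * q H = 0 by rewrite /q subrr mul0r mulr0.
  have := lagrange_le H0 eta0 cth sp lm aqC aqNH aqH.
  have aqi : integ H (fun x => a * q x) by exact: integZ.
  have Ri : integ H (fun x => Rd (a * q x) (th x)).
    by apply/cont_integ/Rd_comp_cont => //; exact: continuous_subspaceT (C1_cont aqC).
  have q1i : integ H (fun x => q1 x ^+ 2).
    by apply/cont_integ/continuous_subspaceT => x; apply: (@cvgM _ _ _ _ q1 q1); exact: cq1.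
  have B1 : \int[mu]_(x in dom H) Rd (a * q x) (th x) <= K * (H + H).
    rewrite -integral_cst_dom//; apply: le_Rintegral => //.
      by apply/cont_integ/continuous_subspaceT => x; exact: cvg_cst.
    move=> x Dx; apply: le_trans (ler_norm _) _; apply: hK; last exact: thI.
    rewrite -ler_norml.
    rewrite normrM ler_wpM2l// ger0_norm ?q0//.
    by move/domE : Dx => /andP[x1 x2]; rewrite expr2; apply: ler_pM; lra.
  have B2 : \int[mu]_(x in dom H) ((a * q1 x) ^+ 2) = a ^+ 2 * I1.
    by under eq_Rintegral do rewrite exprMn; rewrite RintegralZl.
  have B3 : eta / 2 * (a ^+ 2 * I1) <= `|E| / 2 * (a ^+ 2 * I1).
    apply: ler_wpM2r; first by rewrite mulr_ge0// sqr_ge0.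
    have := ler_norm E; lra.
  rewrite B2 RintegralZl// -/J pv; lra.
(* These weights make [a * J - 2 * vinf] equal to 1, -1 and 0. As the energy is nonnegative, the
   first two bound [s] from above and from below; the third bounds the energy itself. *)
have [K1 h1] := key ((2 * vinf + 1) / J).
have [K2 h2] := key ((2 * vinf - 1) / J).
have [K3 h3] := key (2 * vinf / J).
exists (Num.max (Num.max K1 K2) K3) => eta p th s eta0 etaE cth thI sp pv lm.
have := h1 _ _ _ _ eta0 etaE cth thI sp pv lm.
have := h2 _ _ _ _ eta0 etaE cth thI sp pv lm.
have := h3 _ _ _ _ eta0 etaE cth thI sp pv lm.
have I0 : 0 <= \int[mu]_(x in dom H) Rd (p x) (th x) by exact: Rintegral_ge0.
rewrite !divfK ?gt_eqF// subrr mulr0 addr0 => k3 k2 k1.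
split; last by rewrite le_max k3 orbT.
have [sK1 sK2] : s <= K1 /\ - s <= K2.
  by move: I0 k1 k2; generalize (\int[mu]_(x in dom H) Rd (p x) (th x)); clear; split; lra.
have h : `|s| <= Num.max K1 K2 by rewrite ler_norml lerNl !le_max sK1 sK2 orbT.
by rewrite le_max h.
Qed.

(** A strain rate [g] that is merely continuous, with arbitrary boundary values, is not admissible
    in the Lagrangian. Bounded C^1 functions vanishing at the end points and converging to [g]
    inside D have nearly the same energy, by dominated convergence. *)
Lemma energy_approximation H lo hi M s e th g : 0 < H -> {within dom H, continuous th} ->
  (forall x, dom H x -> lo <= th x <= hi) -> continuous g -> (forall x, `|g x| <= M) ->
  0 < e -> exists Q Q1, [/\ C1 Q Q1, Q (- H) = 0, Q H = 0 &
    \int[mu]_(x in dom H) (Rd (Q x) (th x) - s * Q x) <=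
    \int[mu]_(x in dom H) (Rd (g x) (th x) - s * g x) + e].
Proof.
move=> H0 cth thI cg gM e0.
have [Q_ [Q1_ [QC Q0 QM Qg]]] := C1_approximation H0 cg gM.
have [K _ hK] := continuous_bounded_rect (- M) M lo hi Rd_cont.
have cG f : continuous f -> {within dom H, continuous (fun x => Rd (f x) (th x) - s * f x)}.
  move=> cf; apply: (@eq_dom_continuous _ H _
    (fun x => Rd (f x) (th (clamp H x)) - s * f x)).
    by move=> x Dx; rewrite clampE.
  move=> x; apply: cvgB; last by apply: cvgM; [exact: cvg_cst|exact: cf].
  by apply: (cvg_joint _ Rd_cont); [exact: cf|exact: clamp_comp_cont].
have iG f (cf : continuous f) := cont_integ (cG f cf).
have cK : integ H (fun=> K + `|s| * M).
  by apply/cont_integ/continuous_subspaceT => x; exact: cvg_cst.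
have lim : \int[mu]_(x in dom H) (Rd (Q_ k x) (th x) - s * Q_ k x) @[k --> \oo] -->
    \int[mu]_(x in dom H) (Rd (g x) (th x) - s * g x).
  apply: (dominated_Rint _ _ _ cK).
  - by move=> k; apply: integ_measurable; apply: iG; exact: C1_cont (QC k).
  - exact: integ_measurable (iG _ cg).
  - apply: ae_imply (ae_interior H) => x xI Dx; have {}xI := xI Dx.
    apply: cvgB; last by apply: cvgM; [exact: cvg_cst|exact: Qg].
    by apply: (cvg_joint _ Rd_cont); [exact: Qg|exact: cvg_cst].
  - move=> k x Dx; apply: le_trans (ler_normB _ _) _; apply: lerD.
      by apply: hK; [rewrite -ler_norml; exact: QM|exact: thI].
    by rewrite normrM ler_wpM2l// QM.
move/cvgrPdist_le : lim => /(_ e e0) /filter_ex[k]; rewrite ler_norml => /andP[h _].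
by exists (Q_ k), (Q1_ k); have [q1 q2] := Q0 k; split => //; lra.
Qed.

Lemma small_factor (K e : R) : 0 <= K -> 0 < e -> exists2 d, 0 < d & d * K <= e.
Proof.
move=> K0 e0; have K1 : 0 < K + 1 by lra.
exists (e / (K + 1)); first exact: divr_gt0.
by rewrite mulrAC ler_pdivrMr// ler_wpM2l ?(ltW e0)// lerDl.
Qed.

(** The error budget of [minimizers_L1_cvg]: [a] and [b] are the energies of [p_ n] for the limit
    aging and for [th_ n], [d] and [dn] those of the smooth competitor, [P] and [q] the two
    integrals, and [V] the minimal value. The competitor consumes [e / 2]; changes of aging, stress
    and [eta] share the rest. *)
Lemma lagrangian_gap (a b d dn P q J B BQ V eta sn s w e : R) :
  `|b - a| <= w * B -> `|dn - d| <= w * BQ -> `|(s - sn) * (P - q)| <= e / 6 ->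
  eta * J <= e / 6 -> 0 <= eta * J -> b - sn * P <= dn - sn * q + eta / 2 * J ->
  d - s * q <= V + e / 2 -> w * (B + BQ) <= e / 6 -> a - s * P - V <= e.
Proof. by rewrite !ler_norml => /andP[? ?] /andP[? ?] /andP[? ?] *; lra. Qed.

(* By comparison in the Lagrangian with smooth approximations of [p], the
   integral of [Rd (p_ n x) (th x) - s * p_ n x] tends to its pointwise minimum,
   which is attained at [p x]. *)
Lemma minimizers_L1_cvg H vinf lo hi B M (eta_ s_ : nat -> R) (p_ th_ : nat -> R -> R)
    p th s (mo : R -> R) : 0 < H ->
  (forall e, 0 < e -> exists2 d, 0 < d & forall r : R, 0 <= r -> r < d -> mo r < e) ->
  (forall p t t' : R, `|Rd p t - Rd p t'| <= mo `|t - t'| * `|p|) ->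
  (forall n, 0 < eta_ n) -> eta_ n @[n --> \oo] --> 0 -> s_ n @[n --> \oo] --> s ->
  (forall n, {within dom H, continuous (th_ n)}) ->
  {within dom H, continuous th} -> (forall x, dom H x -> lo <= th x <= hi) ->
  unif_cvg H th_ th ->
  (forall n, sobolev H 1 2%:E (p_ n)) ->
  (forall n, \int[mu]_(x in dom H) `|p_ n x| <= B) ->
  (forall n, lagrange_multiplier H vinf (eta_ n) Rd (th_ n) (p_ n) (s_ n)) ->
  continuous p -> (forall x, `|p x| <= M) ->
  (forall x (q : R), dom H x -> Rd (p x) (th x) - s * p x <= Rd q (th x) - s * q) ->
  (forall e, 0 < e -> exists2 c, 0 < c & forall x (q : R), dom H x -> e <= `|q - p x| ->
     c * `|q - p x| <= Rd q (th x) - s * q - (Rd (p x) (th x) - s * p x)) ->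
  L1_cvg H p_ p.
Proof.
move=> H0 mo_small Rmo eta0 eta_cvg s_cvg cth_ cth thI uth sp_ pB lm cp pM pmin growth.
have B0 : 0 <= B by apply: le_trans (pB 0%N); exact: Rintegral_ge0.
have cp_ n : {within dom H, continuous (p_ n)} by case: (sp_ n).
have ip n := cont_integ (cp_ n).
have iRn n := cont_integ (Rd_comp_cont H0 (cp_ n) (cth_ n)).
have iR n := cont_integ (Rd_comp_cont H0 (cp_ n) cth).
have ipl : integ H p := cont_integ (continuous_subspaceT cp).
have iRp := cont_integ (Rd_comp_cont H0 (continuous_subspaceT cp) cth).
pose V := \int[mu]_(x in dom H) (Rd (p x) (th x) - s * p x).
have mod_int f n w : {within dom H, continuous f} ->
    (forall x, dom H x -> mo `|th_ n x - th x| <= w) ->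
    `|\int[mu]_(x in dom H) Rd (f x) (th_ n x) - \int[mu]_(x in dom H) Rd (f x) (th x)|
    <= w * \int[mu]_(x in dom H) `|f x|.
  move=> cf hw; have i1 := cont_integ (Rd_comp_cont H0 cf (cth_ n)).
  have i2 := cont_integ (Rd_comp_cont H0 cf cth).
  have ifn := integ_norm (cont_integ cf).
  rewrite -(RintegralB _ i1 i2)//; apply: le_trans (le_normr_Rintegral _ _) _ => //.
    exact: integB i1 i2.
  rewrite -RintegralZl//; apply: le_Rintegral => //.
  - exact: integ_norm (integB i1 i2).
  - exact: integZ.
  by move=> x Dx; apply: le_trans (Rmo _ _ _) _; rewrite ler_wpM2r// hw.
have excess e : 0 < e -> \forall n \near \oo,
    \int[mu]_(x in dom H) (Rd (p_ n x) (th x) - s * p_ n x) - V <= e.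
  move=> e0; have e2 : 0 < e / 2 by lra.
  have [Q [Q1 [QC QNH QH hQ]]] := energy_approximation s H0 cth thI cp pM e2.
  have cQ := continuous_subspaceT (C1_cont QC).
  have iQ := cont_integ (cQ (dom H)).
  pose BQ := \int[mu]_(x in dom H) `|Q x|.
  pose q := \int[mu]_(x in dom H) Q x.
  pose J := \int[mu]_(x in dom H) (Q1 x ^+ 2).
  have BQ0 : 0 <= BQ by exact: Rintegral_ge0.
  have J0 : 0 <= J by apply: Rintegral_ge0 => x _; exact: sqr_ge0.
  have e6 : 0 < e / 6 by lra.
  have [w w0 wB] := small_factor (addr_ge0 B0 BQ0) e6.
  have [ds ds0 dsB] := small_factor (addr_ge0 B0 (normr_ge0 q)) e6.
  have [de de0 deJ] := small_factor J0 e6.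
  have [d d0 hd] := mo_small _ w0.
  have d2 : 0 < d / 2 by lra.
  move/cvgrPdist_le : s_cvg => /(_ _ ds0) s_near.
  move/cvgrPdist_le : eta_cvg => /(_ _ de0) eta_near.
  apply: filterS3 (uth _ d2) s_near eta_near => n hth hs.
  rewrite sub0r normrN (gtr0_norm (eta0 n)) => heta.
  have hw x : dom H x -> mo `|th_ n x - th x| <= w.
    by move=> Dx; apply/ltW/hd => //; have := hth _ Dx; lra.
  have h1 := mod_int _ _ _ (cp_ n) hw.
  have h2 := mod_int _ _ _ (cQ (dom H)) hw.
  have h3 := lagrange_le H0 (eta0 n) (cth_ n) (sp_ n) (lm n) QC QNH QH.
  have h4 := le_normr_Rintegral (@dom_measurable_ocitv _ H) (ip n).
  have h1' := le_trans h1 (ler_wpM2l (ltW w0) (pB n)).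
  have h4' := le_trans h4 (pB n).
  move: hQ; rewrite -/V RintegralB//;
    [|exact: cont_integ (Rd_comp_cont H0 (cQ _) cth)|exact: integZ].
  rewrite RintegralZl// -/q => hQ.
  rewrite -/BQ in h2; rewrite -/q -/J in h3.
  set P := \int[mu]_(x in dom H) p_ n x in h3 h4' *.
  have h5 : `|(s - s_ n) * (P - q)| <= e / 6.
    apply: le_trans dsB; rewrite normrM; apply: ler_pM => //.
    by apply: le_trans (ler_normB _ _) _; rewrite lerD2r.
  have h6 : eta_ n * J <= e / 6.
    by apply: le_trans deJ; rewrite ler_wpM2r.
  have h6' : 0 <= eta_ n * J by rewrite mulr_ge0// ltW.
  rewrite (RintegralB _ (iR n) (integZ s (ip n)))// RintegralZl//; last exact: ip.
  exact: lagrangian_gap h1' h2 h5 h6 h6' h3 hQ wB.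
apply/cvgrPdist_le => e e0.
have HH : 0 < H + H by lra.
(* Points where [p_ n] is within [d] of [p] contribute at most [e / 2] to the distance. At the
   others the growth estimate bounds the distance by the energy excess over [c], whose integral is
   at most [e / 2]. *)
pose d := e / 2 / (H + H); have d0 : 0 < d by rewrite !divr_gt0.
have [c c0 hc] := growth _ d0.
have ce : 0 < c * (e / 2) by rewrite mulr_gt0//; lra.
apply: filterS (excess _ ce) => n hn.
rewrite sub0r normrN ger0_norm ?Rintegral_ge0//.
have iG := integB (iR n) (integZ s (ip n)).
have iGp := integB iRp (integZ s ipl).
have iD := integB iG iGp.
have icst : integ H (fun=> d) by apply/cont_integ/continuous_subspaceT => x; exact: cvg_cst.
apply: (@le_trans _ _ (\int[mu]_(x in dom H) (d + c^-1 *
    (Rd (p_ n x) (th x) - s * p_ n x - (Rd (p x) (th x) - s * p x))))).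
  apply: le_Rintegral => //; [exact: integ_norm (integB (ip n) ipl)| |].
    exact: integD icst (integZ c^-1 iD).
  move=> x Dx; have ci : 0 <= c^-1 by rewrite invr_ge0 ltW.
  have [dp|dp] := leP d `|p_ n x - p x|.
    apply: (@le_trans _ _ (c^-1 * (c * `|p_ n x - p x|))); first by rewrite mulKf// gt_eqF.
    by rewrite ler_wpDl ?(ltW d0)// ler_wpM2l// hc.
  apply: le_trans (ltW dp) _; rewrite lerDl mulr_ge0// subr_ge0; exact: pmin.
rewrite RintegralD//; last exact: integZ.
rewrite integral_cst_dom// RintegralZl// RintegralB// -/V divfK ?gt_eqF//.
rewrite [leRHS](splitr e) lerD2l mulrC ler_pdivrMr// mulrC; exact: hn.
Qed.

End Variational.

(** * A priori estimates *)

Section Estimates.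
Context {R : realType}.
Notation mu := (@lebesgue_measure R).
Implicit Types (H M L K e a b c x y s t : R) (f g h F r : R -> R).

Lemma deriv_gt0_incr f : (forall t, derivable f t 1 /\ 0 < derive1 f t) ->
  forall a b, a < b -> f a < f b.
Proof.
move=> df a b ab.
have fd x : is_derive x 1 f (derive1 f x).
  by rewrite derive1E; apply: derivableP; case: (df x).
have [|c _ E] := @MVT_segment _ f (derive1 f) a b (ltW ab) (fun x _ => fd x).
  apply: continuous_subspaceT => x; apply: differentiable_continuous.
  by rewrite -derivable1_diffP; case: (df x).
by rewrite -subr_gt0 E mulr_gt0 ?subr_gt0//; case: (df c).
Qed.

(** If [r c] were positive, [F1] would be positive just to the right of its zero [c], and [F] would
    exceed its maximum there. *)
Lemma interior_max_le0 H F F1 r c : C1 F F1 -> C1 F1 r -> - H < c < H ->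
  (forall x, dom H x -> F x <= F c) -> F1 c = 0 /\ r c <= 0.
Proof.
move=> FC F1C /andP[c1 c2] cmax.
have F1c : F1 c = 0.
  have cI : c \in `]- H, H[ by rewrite in_itv /= c1.
  have HH : - H <= H by lra.
  have [||_ <-] := @derive1_at_max _ F _ _ c HH _ cI.
  - by move=> t _; case: (FC.1 t).
  - move=> t; rewrite in_itv /= => /andP[t1 t2]; apply: cmax; apply/domE/andP; split; lra.
  by case: (FC.1 c).
split => //; rewrite leNgt; apply/negP => rc.
have /nbhs_ballP[d /= d0 hd] : \forall x \near c, 0 < r x by exact: (cvgr_gt _ (F1C.2 c) _ rc).
pose e := Num.min (d / 2) (H - c).
have e0 : 0 < e by rewrite lt_min; apply/andP; split; lra.
have ed : e < d by rewrite gt_min; apply/orP; left; lra.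
have eH : e <= H - c by rewrite ge_min lexx orbT.
have rpos x : c <= x -> x <= c + e -> 0 < r x.
  by move=> x1 x2; apply: hd; rewrite /ball /= ltr_distl; apply/andP; split; lra.
have F1pos x : c < x -> x <= c + e -> 0 < F1 x.
  move=> x1 x2; have [z /andP[z1 z2]] := C1_MVT F1C (ltW x1).
  rewrite F1c subr0 => ->; rewrite mulr_gt0 ?subr_gt0// rpos//; lra.
have ce : c <= c + e / 2 by lra.
have ce' : c + e / 2 <= c + e by lra.
have [z /andP[z1 z2] E] := C1_MVT FC ce.
have [z' /andP[z1' z2'] E'] := C1_MVT FC ce'.
have h : 0 <= F1 z.
  by move: z1; rewrite le_eqVlt => /predU1P[<-|z1]; [rewrite F1c|apply/ltW/F1pos; lra].
have h1 : 0 <= F1 z * (c + e / 2 - c) by rewrite mulr_ge0//; lra.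
have h2 : 0 < F1 z' * (c + e - (c + e / 2)).
  rewrite mulr_gt0//; last by lra.
  by apply: F1pos; lra.
have : F (c + e) <= F c by apply: cmax; apply/domE/andP; split; lra.
lra.
Qed.

Lemma interior_min_ge0 H F F1 r c : C1 F F1 -> C1 F1 r -> - H < c < H ->
  (forall x, dom H x -> F c <= F x) -> F1 c = 0 /\ 0 <= r c.
Proof.
move=> FC F1C cI cmin.
have [|h1 h2] := interior_max_le0 (C1Z (-1) FC) (C1Z (-1) F1C) cI.
  by move=> x Dx; rewrite !mulN1r lerN2 cmin.
by move: h1 h2; rewrite !mulN1r => /eqP; rewrite oppr_eq0 => /eqP; split => //; lra.
Qed.

(** The thresholds are the zeros of [f1] and [f0]. At a maximum above both, [f1] is positive and
    [f0] negative, so the equation makes the second derivative positive; a minimum below both is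
    excluded symmetrically. *)
Lemma aging_bounds H (kappa thinf : R) (f0 f1 p : R -> R) F F1 r : 0 < H -> 0 < kappa ->
  (forall a b, a < b -> f1 a < f1 b) -> f1 0 = 0 ->
  (forall a b, a < b -> f0 b < f0 a) -> f0 thinf = 0 ->
  C1 F F1 -> C1 F1 r ->
  (forall x, dom H x -> `|p x| * f1 (F x) - f0 (F x) = kappa * r x) ->
  F (- H) = thinf -> F H = thinf ->
  forall x, dom H x -> Num.min 0 thinf <= F x <= Num.max 0 thinf.
Proof.
move=> H0 k0 i1 f10 i0 f00 FC F1C eqn FNH FH.
have HH : - H <= H by lra.
have cF : {within `[- H, H], continuous F} by exact: continuous_subspaceT (C1_cont FC).
have itvdom x : x \in `[- H, H] <-> dom H x by rewrite in_itv; exact: (iff_sym (domE _ _)).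
have hi : forall x, dom H x -> F x <= Num.max 0 thinf.
  have [c cI cmax] := EVT_max HH cF.
  suff h : F c <= Num.max 0 thinf.
    by move=> x Dx; apply: le_trans h; apply: cmax; exact/itvdom.
  rewrite leNgt; apply/negP; rewrite gt_max => /andP[Fc0 Fct].
  have Dc := (itvdom c).1 cI; have /domE /andP[c1 c2] := Dc.
  have cH : - H < c < H.
    rewrite !lt_neqAle c1 c2 !andbT; apply/andP; split; apply/eqP => E.
      by move: Fct; rewrite -E FNH ltxx.
    by move: Fct; rewrite E FH ltxx.
  have [|_ rc] := interior_max_le0 FC F1C cH.
    by move=> x Dx; apply: cmax; exact/itvdom.
  have := i1 _ _ Fc0; rewrite f10 => f1c; have := i0 _ _ Fct; rewrite f00 => f0c.
  have := eqn _ Dc.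
  have : 0 <= `|p c| * f1 (F c) by rewrite mulr_ge0// ltW.
  have : kappa * r c <= 0 by rewrite pmulr_rle0.
  lra.
have lo : forall x, dom H x -> Num.min 0 thinf <= F x.
  have [c cI cmin] := EVT_min HH cF.
  suff h : Num.min 0 thinf <= F c.
    by move=> x Dx; apply: (le_trans h); apply: cmin; exact/itvdom.
  rewrite leNgt; apply/negP; rewrite lt_min => /andP[Fc0 Fct].
  have Dc := (itvdom c).1 cI; have /domE /andP[c1 c2] := Dc.
  have cH : - H < c < H.
    rewrite !lt_neqAle c1 c2 !andbT; apply/andP; split; apply/eqP => E.
      by move: Fct; rewrite -E FNH ltxx.
    by move: Fct; rewrite E FH ltxx.
  have [|_ rc] := interior_min_ge0 FC F1C cH.
    by move=> x Dx; apply: cmin; exact/itvdom.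
  have := i1 _ _ Fc0; rewrite f10 => f1c; have := i0 _ _ Fct; rewrite f00 => f0c.
  have := eqn _ Dc.
  have : `|p c| * f1 (F c) <= 0 by rewrite mulr_ge0_le0// ltW.
  have : 0 <= kappa * r c by rewrite mulr_ge0// ltW.
  lra.
by move=> x Dx; rewrite lo// hi.
Qed.

(* The equation for the damage is autonomous, so that it has a first integral. *)
Lemma damage_bounds H (ell Gc s S c0 : R) (C : R -> R) F F1 r :
  0 < H -> 0 < ell -> 0 < Gc -> 0 < c0 ->
  C1 C (derive1 C) -> (forall a, c0 <= C a) -> `|s| <= S ->
  C1 F F1 -> C1 F1 r ->
  (forall x, dom H x -> derive1 C (F x) / (2 * C (F x) ^+ 2) * s ^+ 2
      + Gc * ((F x - 1) / ell ^+ 2) = Gc * ell ^+ 2 * r x) ->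
  F (- H) = 1 -> F H = 1 ->
  forall x, dom H x -> `|F x - 1| <= S ^+ 2 / c0 * (ell ^+ 2 / Gc) + 1.
Proof.
move=> H0 l0 G0 c00 CC Cc0 sS FC F1C eqn FNH FH.
have Cpos a : 0 < C a by apply: lt_le_trans (Cc0 a).
have Cn0 a : C a != 0 by rewrite gt_eqF.
have ln0 : ell != 0 by rewrite gt_eqF.
have Gn0 : Gc != 0 by rewrite gt_eqF.
have GC := C1B FC (C1_cst 1).
have QC := C1M GC GC.
have CinvC := C1V (C1_comp FC CC) (fun x => Cn0 (F x)).
(* Multiplying the equation by [F1] and integrating gives this conserved quantity: a gradient term,
   plus the stress term with [1 / C], minus the square of [F - 1]. *)
have EC := C1B (C1D (C1Z (Gc * ell ^+ 2 / 2) (C1M F1C F1C)) (C1Z (s ^+ 2 / 2) CinvC))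
  (C1Z (Gc / (2 * ell ^+ 2)) QC).
set E := (fun x => _ - _) in EC.
have Ecst x : dom H x -> E x = E (- H).
  move=> /domE /andP[x1 x2]; have [z /andP[z1 z2] Ez] := C1_MVT EC x1.
  apply/eqP; rewrite -subr_eq0 Ez; apply/eqP.
  have Dz : dom H z by apply/domE/andP; split; lra.
  apply/eqP; rewrite mulf_eq0; apply/orP; left; apply/eqP.
  have -> : r z = (derive1 C (F z) / (2 * C (F z) ^+ 2) * s ^+ 2
      + Gc * ((F z - 1) / ell ^+ 2)) / (Gc * ell ^+ 2).
    by rewrite eqn//; field; rewrite ln0 Gn0.
  field; by rewrite Cn0 ln0 Gn0.
have HH : - H <= H by lra.
have [c cI cmax] := EVT_max HH (continuous_subspaceT (C1_cont QC)).
have Dc : dom H c by apply/domE; move: cI; rewrite in_itv.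
pose B := S ^+ 2 / c0 * (ell ^+ 2 / Gc).
have S0 : 0 <= S by exact: le_trans sS.
have B0 : 0 <= B by rewrite mulr_ge0 ?divr_ge0 ?exprn_ge0// ltW.
suff h : (F c - 1) * (F c - 1) <= B.
  move=> x Dx; have : (F x - 1) * (F x - 1) <= B.
    by apply: le_trans h; apply: cmax; rewrite in_itv; exact/domE.
  (* The inequality between the modulus of [u] and [u ^ 2 + 1] avoids a square root; it is the
     origin of the final [+ 1]. *)
  rewrite -/B ler_norml; move: (F x - 1) => u uB.
  by apply/andP; split; nra.
have [Fc1|Fc1] := eqVneq (F c) 1; first by rewrite Fc1 subrr mul0r.
have /domE /andP[c1 c2] := Dc.
have cH : - H < c < H.
  rewrite !lt_neqAle c1 c2 !andbT; apply/andP; split; apply/eqP => Ec.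
    by move: Fc1; rewrite -Ec FNH eqxx.
  by move: Fc1; rewrite Ec FH eqxx.
have F1c : F1 c = 0.
  have cI' : c \in `]- H, H[ by rewrite in_itv.
  have dQ : is_derive c 1 (fun x => (F x - 1) * (F x - 1)) 0.
    apply: (@derive1_at_max _ _ (- H) H c HH _ cI') => [t _|t tI].
      by case: (QC.1 t).
    by apply: cmax; apply: subset_itv_oo_cc tI.
  have [_ E0] := dQ; have [_ E1] := QC.1 c.
  move: E1; rewrite E0 subr0 => /eqP; rewrite eq_sym -mulr2n mulrn_eq0 /= mulf_eq0 subr_eq0.
  by rewrite (negbTE Fc1) /= => /eqP.
(* At the maximum [c] of the square of [F - 1] the gradient term vanishes, at [- H] the square does.
   Discarding the nonnegative terms at [- H] leaves the square bounded by the stress term at [c]. *)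
have := Ecst _ Dc; rewrite /E F1c FNH.
have h1 : (C (F c))^-1 <= c0^-1 by rewrite lef_pV2 ?posrE.
have h2 : s ^+ 2 <= S ^+ 2 by rewrite -(real_normK (num_real s)) lerXn2r ?nnegrE.
have h3 : s ^+ 2 / C (F c) <= S ^+ 2 / c0.
  by apply: ler_pM => //; [exact: sqr_ge0|rewrite invr_ge0 ltW].
have h4 : 0 <= Gc * ell ^+ 2 / 2 * (F1 (- H) * F1 (- H)).
  apply: mulr_ge0; last by rewrite -expr2 sqr_ge0.
  by apply: divr_ge0 => //; apply: mulr_ge0; [exact: ltW|exact: sqr_ge0].
have h5 : 0 <= s ^+ 2 / 2 * (C 1)^-1.
  by apply: mulr_ge0; [exact: divr_ge0 (sqr_ge0 _) _|rewrite invr_ge0 ltW].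
rewrite subrr !mulr0 subr0 add0r => hE.
have h6 : Gc / (2 * ell ^+ 2) * ((F c - 1) * (F c - 1)) <= S ^+ 2 / c0 / 2.
  lra.
rewrite /B -[leLHS](@mulfK _ (ell ^+ 2 / Gc)^-1); last first.
  by rewrite invr_eq0 mulf_neq0 ?invr_eq0 ?expf_neq0.
rewrite invrK ler_wpM2r ?divr_ge0 ?exprn_ge0 ?(ltW l0) ?(ltW G0)//.
have -> : (F c - 1) * (F c - 1) * (ell ^+ 2 / Gc)^-1 =
    2 * (Gc / (2 * ell ^+ 2) * ((F c - 1) * (F c - 1))).
  by field; rewrite ln0 Gn0.
lra.
Qed.

(** Equal boundary values force [F1] to vanish somewhere, so [F1] is bounded by the L^1 norm of its
    derivative. *)
Lemma C2_lipschitz H L F F1 r : 0 < H -> C1 F F1 -> C1 F1 r -> F (- H) = F H ->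
  \int[mu]_(x in dom H) `|r x| <= L ->
  forall x y, dom H x -> dom H y -> `|F x - F y| <= L * `|x - y|.
Proof.
move=> H0 FC F1C FHH rL.
have HH : - H <= H by lra.
have [z /andP[z1 z2]] := C1_MVT FC HH.
rewrite FHH subrr => /esym/eqP; rewrite mulf_eq0 => /orP[/eqP F1z|/eqP]; last by lra.
have Dz : dom H z by apply/domE/andP; split; lra.
have F1L x : dom H x -> `|F1 x| <= L.
  by move=> Dx; have := C1_increment_L1 F1C Dx Dz; rewrite F1z subr0 => /le_trans; apply.
move=> x y; wlog xy : x y / y <= x.
  move=> h Dx Dy; have [yx|/ltW xy] := leP y x; first exact: h.
  by rewrite distrC [`|x - y|]distrC; exact: h.
move=> /domE /andP[x1 x2] /domE /andP[y1 y2].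
have [w /andP[w1 w2] ->] := C1_MVT FC xy.
by rewrite normrM ler_wpM2r// F1L//; apply/domE/andP; split; lra.
Qed.

End Estimates.

(** * Uniform limits *)

Section UniformLimits.
Context {R : realType}.
Notation mu := (@lebesgue_measure R).
Implicit Types (H M L K e a b c x y s t : R) (f g h F r : R -> R).

(** Only [z] is confined to the compact set: in the application it is a value of the limit
    functions, and [w] a nearby value of the approximating ones. *)
Lemma heine (U : pseudoMetricType R) (h : U -> R) (A : set U) e :
  compact A -> continuous h -> 0 < e ->
  exists2 d, 0 < d & forall z w, A z -> ball z d w -> `|h z - h w| < e.
Proof.
move=> /compact_near_coveringP cA ch e0.
pose P (d : R) (z : U) := forall w, ball z d w -> `|h z - h w| < e.
have e2 : 0 < e / 2 by lra.
have : \forall d \near 0^'+, forall z, A z -> P d z.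
  apply: (cA R (0^'+) P) => z0 _.
  have /cvgrPdist_lt /(_ _ e2) /nbhs_ballP[r /= r0 hr] := ch z0.
  have r2 : 0 < r / 2 by lra.
  exists (ball z0 (r / 2), [set d | d < r / 2]) => /=.
    by split; [exact: nbhsx_ballx|exact: nbhs_right_lt].
  move=> [z d] /= [z0z dr] w zw.
  have z0w : ball z0 r w.
    by rewrite (splitr r); apply: ball_triangle z0z _; exact: le_ball (ltW dr) _ zw.
  have z0z' : ball z0 r z by apply: le_ball z0z; lra.
  have := hr _ z0w; have := hr _ z0z'; rewrite /= !ltr_norml => /andP[? ?] /andP[? ?].
  by apply/andP; split; lra.
move=> hd.
have : \forall d \near 0^'+, 0 < d /\ forall z, A z -> P d z.
  by apply: filterS2 hd (nbhs_right_gt 0) => d h1 h2; split.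
move=> /filter_ex[d [d0 hAd]]; exists d => // z w Az; exact: hAd.
Qed.

Lemma unif_cvg_joint H (h : R -> R -> R) (f_ g_ : nat -> R -> R) f g : 0 < H ->
  continuous (fun z : R * R => h z.1 z.2) ->
  {within dom H, continuous f} -> {within dom H, continuous g} ->
  unif_cvg H f_ f -> unif_cvg H g_ g ->
  unif_cvg H (fun n x => h (f_ n x) (g_ n x)) (fun x => h (f x) (g x)).
Proof.
move=> H0 ch cf cg uf ug e e0.
pose A := (fun x => (f (clamp H x), g (clamp H x))) @` dom H.
have cA : compact A.
  apply: continuous_compact; last exact: segment_compact.
  apply: continuous_subspaceT => x.
  have c1 := @clamp_comp_cont _ _ _ H0 cf x; have c2 := @clamp_comp_cont _ _ _ H0 cg x.
  exact: cvg_pair c1 c2.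
have [d d0 hd] := heine cA ch e0.
have d2 : 0 < d / 2 by lra.
apply: filterS2 (uf _ d2) (ug _ d2) => n hf hg x Dx.
rewrite distrC; apply: ltW.
apply: (hd (f x, g x) (f_ n x, g_ n x)).
  by exists x => //; rewrite clampE.
split; rewrite /ball /= distrC.
  by apply: le_lt_trans (hf x Dx) _; lra.
by apply: le_lt_trans (hg x Dx) _; lra.
Qed.

Lemma unif_cvg_comp H h (f_ : nat -> R -> R) f : 0 < H -> continuous h ->
  {within dom H, continuous f} -> unif_cvg H f_ f ->
  unif_cvg H (fun n x => h (f_ n x)) (fun x => h (f x)).
Proof.
move=> H0 ch cf uf; apply: (@unif_cvg_joint H (fun a _ => h a) f_ f_ f f) => //.
by move=> z; apply: (@continuous_comp _ _ _ fst h); [exact: cvg_fst|exact: ch].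
Qed.

Lemma unif_cvg_eq H (f_ g_ : nat -> R -> R) f g :
  (forall n x, dom H x -> f_ n x = g_ n x) -> (forall x, dom H x -> f x = g x) ->
  unif_cvg H f_ f -> unif_cvg H g_ g.
Proof.
move=> fg_ fg u e e0; apply: filterS (u e e0) => n hn x Dx.
by rewrite -fg_// -fg// hn.
Qed.

Lemma unif_cvg_cst H (s_ : nat -> R) s : s_ n @[n --> \oo] --> s ->
  unif_cvg H (fun n _ => s_ n) (fun=> s).
Proof.
by move=> /cvgrPdist_le hs e e0; apply: filterS (hs e e0) => n hn x _; rewrite distrC.
Qed.

Lemma unif_cvg_limit H (f_ : nat -> R -> R) f x a : unif_cvg H f_ f -> dom H x ->
  (forall n, f_ n x = a) -> f x = a.
Proof.
move=> u Dx fa; apply/eqP; rewrite -subr_eq0 -normr_le0; apply/ler_addgt0Pl => e e0.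
by have /filter_ex[n /(_ x Dx)] := u e e0; rewrite fa distrC addr0.
Qed.

Lemma unif_cvg_bounds H (f_ : nat -> R -> R) f lo hi : unif_cvg H f_ f ->
  (forall n x, dom H x -> lo <= f_ n x <= hi) -> forall x, dom H x -> lo <= f x <= hi.
Proof.
move=> u fI x Dx; apply/andP; split; apply/ler_addgt0Pl => e e0.
  have /filter_ex[n /(_ x Dx)] := u e e0; have /andP[h1 h2] := fI n x Dx.
  by rewrite ler_norml => /andP[? ?]; lra.
have /filter_ex[n /(_ x Dx)] := u e e0; have /andP[h1 h2] := fI n x Dx.
by rewrite ler_norml => /andP[? ?]; lra.
Qed.

Lemma L1_cvg_le H (f_ g_ h_ : nat -> R -> R) f g h c : 0 <= c ->
  (forall n, integ H (f_ n)) -> integ H f -> (forall n, integ H (g_ n)) -> integ H g ->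
  (forall n, integ H (h_ n)) -> integ H h ->
  (forall n x, dom H x -> `|f_ n x - f x| <= c * `|g_ n x - g x| + `|h_ n x - h x|) ->
  L1_cvg H g_ g -> L1_cvg H h_ h -> L1_cvg H f_ f.
Proof.
move=> c0 if_ if0 ig_ ig0 ih_ ih0 fgh ug uh.
have lim : c * \int[mu]_(x in dom H) `|g_ n x - g x| + \int[mu]_(x in dom H) `|h_ n x - h x|
    @[n --> \oo] --> (0 : R).
  rewrite -[X in _ --> X](addr0 (0 : R)); apply: cvgD => //.
  by rewrite -[X in _ --> X](mulr0 c); apply: cvgM => //; exact: cvg_cst.
apply/cvgrPdist_le => e e0; move/cvgrPdist_le : lim => /(_ e e0); apply: filterS => n.
rewrite !sub0r !normrN ger0_norm; last first.
  by rewrite addr_ge0 ?mulr_ge0// Rintegral_ge0.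
move=> hn; rewrite ger0_norm ?Rintegral_ge0//; apply: le_trans hn.
have i1 := integ_norm (integB (if_ n) if0).
have i2 := integ_norm (integB (ig_ n) ig0); have i3 := integ_norm (integB (ih_ n) ih0).
rewrite -RintegralZl// -RintegralD//; last exact: integZ.
by apply: le_Rintegral => //; [exact: integD (integZ c i2) i3|exact: fgh].
Qed.

Lemma cvg_seq_le (u_ : nat -> R) (l : R) : u_ n @[n --> \oo] --> l ->
  exists E : R, forall n, u_ n <= E.
Proof.
move=> ul; have [M [_ hM]] : bounded_fun u_ by apply: cvg_seq_bounded; apply/cvg_ex; exists l.
exists (M + 1) => n; apply: le_trans (ler_norm _) _; apply: hM => //; by rewrite ltrDl.
Qed.

Lemma lipschitz_within H L f :
  (forall x y, dom H x -> dom H y -> `|f x - f y| <= L * `|x - y|) ->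
  {within dom H, continuous f}.
Proof.
move=> fL; apply/subspace_continuousP => x Dx; apply/cvgrPdist_le => e e0.
have L1 : 0 < `|L| + 1 by rewrite ltr_wpDl.
rewrite near_withinE; apply/nbhs_ballP; exists (e / (`|L| + 1)); first exact: divr_gt0.
move=> y; rewrite /ball /= ltr_pdivlMr// => xy Dy; apply: le_trans (fL x y Dx Dy) _.
apply: le_trans (ltW xy); rewrite mulrC ler_wpM2l//.
by have := ler_norm L; lra.
Qed.

Lemma mul_joint_cont : continuous (fun z : R * R => z.1 * z.2).
Proof. by move=> [a b] /=; apply: cvgM; [exact: cvg_fst|exact: cvg_snd]. Qed.

Lemma unif_cvgM H (f_ g_ : nat -> R -> R) f g : 0 < H ->
  {within dom H, continuous f} -> {within dom H, continuous g} ->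
  unif_cvg H f_ f -> unif_cvg H g_ g ->
  unif_cvg H (fun n x => f_ n x * g_ n x) (fun x => f x * g x).
Proof. by move=> H0; exact: (unif_cvg_joint H0 mul_joint_cont). Qed.

(** * Sobolev convergence of continuously differentiable functions *)

Lemma C1_measurable H F F1 g : C1 F F1 -> (forall x, dom H x -> g x = F x) ->
  measurable_fun (dom H) g.
Proof.
move=> FC gF; apply: integ_measurable; apply: cont_integ.
exact: eq_dom_continuous gF (C1_cont FC).
Qed.

Lemma C1_wderiv_measurable H F F1 g : 0 < H -> C1 F F1 ->
  (forall x, dom H x -> g x = F x) -> measurable_fun (dom H) (wderiv H g).
Proof.
move=> H0 FC gF; have [d _] := C1_wderiv H0 FC gF.
by have [[_ /Lp_measurable]] := wderivP H0 d.
Qed.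

Lemma C1_wstar_W1oo H (F_ F1_ g_ : nat -> R -> R) F F1 : 0 < H ->
  (forall n, C1 (F_ n) (F1_ n)) -> C1 F F1 ->
  (forall n x, dom H x -> g_ n x = F_ n x) ->
  unif_cvg H F_ F -> unif_cvg H F1_ F1 -> wstar_W1oo H g_ F.
Proof.
move=> H0 FC_ FC gF uF uF1; have FF x (Dx : dom H x) : F x = F x by [].
split.
- by move=> n; have [] := C1_sobolev1 H0 (FC_ n) (gF n).
- by have [] := C1_sobolev1 H0 FC FF.
- apply: (unif_wstar H0 (fun n => C1_cont (FC_ n)) (C1_cont FC) _ _ _ _ uF).
  + by move=> n; exact: C1_measurable (FC_ n) (gF n).
  + exact: C1_measurable FC FF.
  + by move=> n; apply: aeW; exact: gF.
  + exact: aeW.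
apply: (unif_wstar H0 (fun n => (FC_ n).2) FC.2 _ _ _ _ uF1).
- by move=> n; exact: C1_wderiv_measurable H0 (FC_ n) (gF n).
- exact: C1_wderiv_measurable H0 FC FF.
- by move=> n; have [] := C1_wderiv H0 (FC_ n) (gF n).
by have [] := C1_wderiv H0 FC FF.
Qed.

Lemma C2_wstar_W2oo H (F_ F1_ F2_ g_ : nat -> R -> R) F F1 F2 : 0 < H ->
  (forall n, C1 (F_ n) (F1_ n)) -> (forall n, C1 (F1_ n) (F2_ n)) -> C1 F F1 -> C1 F1 F2 ->
  (forall n x, dom H x -> g_ n x = F_ n x) ->
  unif_cvg H F_ F -> unif_cvg H F1_ F1 -> unif_cvg H F2_ F2 -> wstar_W2oo H g_ F.
Proof.
move=> H0 FC_ F1C_ FC F1C gF uF uF1 uF2; have FF x (Dx : dom H x) : F x = F x by [].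
have [_ _ w w1] := C1_wstar_W1oo H0 FC_ FC gF uF uF1.
have mw2 g G G1 G2 : C1 G G1 -> C1 G1 G2 -> (forall x, dom H x -> g x = G x) ->
    measurable_fun (dom H) (wderiv H (wderiv H g)).
  move=> GC G1C gG; have [d wG] := C1_wderiv H0 GC gG.
  have dw : is_weak_deriv H (wderiv H g) G2.
    apply: (C1_weak_deriv_ae H0 G1C wG).
    exact: C1_wderiv_measurable H0 GC gG.
  by have [[_ /Lp_measurable]] := wderivP H0 dw.
split; [|exact: C2_sobolev2 H0 FC F1C FF|exact: w|exact: w1|].
  by move=> n; exact: C2_sobolev2 H0 (FC_ n) (F1C_ n) (gF n).
apply: (unif_wstar H0 (fun n => (F1C_ n).2) F1C.2 _ _ _ _ uF2).
- by move=> n; exact: mw2 (FC_ n) (F1C_ n) (gF n).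
- exact: mw2 FC F1C FF.
- by move=> n; exact: C2_wderiv H0 (FC_ n) (F1C_ n) (gF n).
exact: C2_wderiv H0 FC F1C FF.
Qed.

Lemma C1_strong_H1 H (F_ F1_ g_ : nat -> R -> R) F F1 : 0 < H ->
  (forall n, C1 (F_ n) (F1_ n)) -> C1 F F1 ->
  (forall n x, dom H x -> g_ n x = F_ n x) ->
  unif_cvg H F_ F -> unif_cvg H F1_ F1 -> strong_H1 H g_ F.
Proof.
move=> H0 FC_ FC gF uF uF1; have FF x (Dx : dom H x) : F x = F x by [].
split.
- by move=> n; have [] := C1_sobolev1 H0 (FC_ n) (gF n).
- by have [] := C1_sobolev1 H0 FC FF.
- apply: (unif_strong_L2 H0 _ _ _ _ uF).
  + by move=> n; exact: C1_measurable (FC_ n) (gF n).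
  + exact: C1_measurable FC FF.
  + by move=> n; apply: aeW; exact: gF.
  + exact: aeW.
apply: (unif_strong_L2 H0 _ _ _ _ uF1).
- by move=> n; exact: C1_wderiv_measurable H0 (FC_ n) (gF n).
- exact: C1_wderiv_measurable H0 FC FF.
- by move=> n; have [] := C1_wderiv H0 (FC_ n) (gF n).
by have [] := C1_wderiv H0 FC FF.
Qed.

End UniformLimits.

(** * Limit passage *)

Section SteadyState.
Context {R : realType}.
Notation mu := (@lebesgue_measure R).
Implicit Types (H M L K e a b c x y s t : R) (f g h F r : R -> R).

(** The damage equation solved for the second derivative, with the strain eliminated through
    [ep = s / C al], so that beside the damage only the scalar stress occurs. *)
Definition damage_rhs (Gc ell : R) (C : R -> R) (s a : R) : R :=
  (derive1 C a / (2 * C a ^+ 2) * s ^+ 2 + Gc * ((a - 1) / ell ^+ 2)) / (Gc * ell ^+ 2).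

Definition aging_rhs (kappa : R) (f0 f1 : R -> R) (p t : R) : R :=
  (`|p| * f1 t - f0 t) / kappa.

Lemma damage_rhs_cont Gc ell C : continuous C -> continuous (derive1 C) ->
  (forall a, C a != 0) -> continuous (fun z : R * R => damage_rhs Gc ell C z.1 z.2).
Proof.
move=> cC cC' C0 [s a] /=.
have c1 : (fun z : R * R => z.1) z @[z --> (s, a)] --> s by exact: cvg_fst.
have c2 : (fun z : R * R => z.2) z @[z --> (s, a)] --> a by exact: cvg_snd.
have c3 : C z.2 @[z --> (s, a)] --> C a by exact: cvg_comp c2 (cC a).
have c4 : derive1 C z.2 @[z --> (s, a)] --> derive1 C a by exact: cvg_comp c2 (cC' a).
rewrite /damage_rhs; apply: cvgM; last exact: cvg_cst.
apply: cvgD; apply: cvgM.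
- apply: cvgM => //; apply: cvgV; first by rewrite mulf_neq0// expf_neq0.
  by apply: cvgM; [exact: cvg_cst|rewrite expr2; under eq_fun do rewrite expr2; exact: cvgM].
- by rewrite expr2; under eq_fun do rewrite expr2; exact: cvgM.
- exact: cvg_cst.
- by apply: cvgM; [apply: cvgB => //; exact: cvg_cst|exact: cvg_cst].
Qed.

Lemma aging_rhs_cont kappa f0 f1 : continuous f0 -> continuous f1 ->
  continuous (fun z : R * R => aging_rhs kappa f0 f1 z.1 z.2).
Proof.
move=> cf0 cf1 [p t] /=.
have c1 : (fun z : R * R => z.1) z @[z --> (p, t)] --> p by exact: cvg_fst.
have c2 : (fun z : R * R => z.2) z @[z --> (p, t)] --> t by exact: cvg_snd.
have c3 : f0 z.2 @[z --> (p, t)] --> f0 t by exact: cvg_comp c2 (cf0 t).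
have c4 : f1 z.2 @[z --> (p, t)] --> f1 t by exact: cvg_comp c2 (cf1 t).
rewrite /aging_rhs; apply: cvgM; last exact: cvg_cst.
by apply: cvgB => //; apply: cvgM => //; exact: cvg_norm.
Qed.

(** Strain rate, damage and aging are continuous on D, hence so are the second derivatives that the
    two equations prescribe. *)
Lemma solution_C2 H vinf thinf kappa ell Gc mu0 Rd C f0 f1 phi0 phi1
    eta ep v p al th s : 0 < H -> 0 < Gc -> 0 < ell -> 0 < kappa ->
  continuous C -> continuous (derive1 C) -> (forall a, C a != 0) ->
  continuous f0 -> continuous f1 ->
  fixed_point_solution H vinf thinf kappa ell Gc mu0 Rd C f0 f1 phi0 phi1
    eta ep v p al th s ->
  (exists A A1, [/\ C1 A A1, C1 A1 (fun x => damage_rhs Gc ell C s (al (clamp H x))) &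
     forall x, dom H x -> al x = A x]) /\
  (exists T T1, [/\ C1 T T1,
     C1 T1 (fun x => aging_rhs kappa f0 f1 (p (clamp H x)) (th (clamp H x))) &
     forall x, dom H x -> th x = T x]).
Proof.
move=> H0 G0 l0 k0 cC cC' C0 cf0 cf1 [[[sv sp sal sth] _ _ [_ eth] _] _ _ eal _].
have cal : {within dom H, continuous al} by case: sal.
have cth : {within dom H, continuous th} by case: sth.
have cp : {within dom H, continuous p} by case: sp.
split; apply: sobolev21_C2 => //.
- apply: (@joint_cont R (damage_rhs Gc ell C) (fun=> s) (fun x => al (clamp H x))).
  + exact: damage_rhs_cont.
  + by move=> x; exact: cvg_cst.
  + exact: clamp_comp_cont.
- apply: ae_imply eal => x h Dx; rewrite clampE// /damage_rhs h// [RHS]mulrC mulKf//.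
  by rewrite mulf_neq0 ?expf_neq0// gt_eqF.
- apply: (@joint_cont R (aging_rhs kappa f0 f1) (fun x => p (clamp H x))).
  + exact: aging_rhs_cont.
  + exact: clamp_comp_cont.
  + exact: clamp_comp_cont.
by apply: ae_imply eth => x h Dx; rewrite !clampE// /aging_rhs h// [RHS]mulrC mulKf// gt_eqF.
Qed.

Lemma velocity_primitive H v p : 0 < H -> {within dom H, continuous v} ->
  {within dom H, continuous p} -> is_weak_deriv H v p ->
  exists2 V, C1 V (fun x => p (clamp H x)) & forall x, dom H x -> v x = V x.
Proof.
move=> H0 cv cp vp; have cpc := clamp_comp_cont H0 cp.
have [P PC] := primitive cpc.
have [|c vE] := weak_deriv_C1 H0 cv PC.
  apply: (weak_deriv_ae _ _ _ _ vp); [|exact: continuous_dom_measurable|exact: aeW|].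
    exact: integ_measurable (cont_integ cv).
  by apply: aeW => x Dx; rewrite clampE.
exists (fun x => P x + c) => //.
by apply: (C1_eq (C1D PC (C1_cst c))) => x; rewrite addr0.
Qed.

End SteadyState.

Theorem proposition3p4 (R : realType)
  (H vinf thinf kappa ell Gc : R) (mu Rd : R -> R -> R)
  (C f0 f1 phi0 phi1 : R -> R)
  (H_gt0 : 0 < H) (Gc_gt0 : 0 < Gc)
  (* R(., theta), and its strict convexity *)
  (Rd_potential : dissipation_potential mu Rd)
  (Rd_convex : forall t, strictly_convex (Rd ^~ t))
  (* primitives of f0 and f1 *)
  (phi0_prim : forall t : R, is_derive t 1 phi0 (f0 t))
  (phi1_prim : forall t : R, is_derive t 1 phi1 (f1 t))
  (* (A1) *)
  (mu_cont : continuous (fun z : R * R => mu z.1 z.2))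
  (mu_nondecr : forall t p q, 0 <= p -> p <= q -> mu p t <= mu q t)
  (mu_nonincr : forall t p q, p <= q -> q <= 0 -> mu q t <= mu p t)
  (mu_inf : 0 < inf (range (mu 0)))
  (* (A2) *)
  (C_derivable : forall a : R, derivable C a 1)
  (C_deriv_cont : continuous (derive1 C))
  (C_deriv_eq0 : forall a, 1 <= a -> derive1 C a = 0)
  (C_inf : 0 < inf (range C))
  (* (A3) *)
  (f_cont : continuous f0 /\ continuous f1)
  (f_ge0 : forall t, 0 <= t <= thinf -> 0 <= f0 t /\ 0 <= f1 t)
  (f1_incr : forall t : R, derivable f1 t 1 /\ 0 < derive1 f1 t)
  (f1_0 : f1 0 = 0)
  (f0_decr : forall t : R, derivable f0 t 1 /\ derive1 f0 t < 0)
  (f0_thinf : f0 thinf = 0)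
  (* (A4) *)
  (kappa_gt0 : 0 < kappa) (ell_gt0 : 0 < ell)
  (* (A5) *)
  (Rd_coercive : exists Phi : R -> R,
    [/\ continuous Phi, forall p, 0 <= Phi p, superlinear Phi
      & forall p t, Phi p <= Rd p t])
  (* (A6) *)
  (mu_modulus : exists o : R -> R,
    [/\ {within `[0, +oo[, continuous o}, forall r, 0 <= r -> 0 <= o r,
        o 0 = 0 & forall p t t', `|mu p t - mu p t'| <= o `|t - t'|])
  (* the solutions of the regularized problems *)
  (ep_ v_ p_ al_ th_ : R -> R -> R) (s_ : R -> R)
  (sol : forall eta, 0 < eta ->
    fixed_point_solution H vinf thinf kappa ell Gc mu Rd C f0 f1 phi0 phi1
      eta (ep_ eta) (v_ eta) (p_ eta) (al_ eta) (th_ eta) (s_ eta))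
  (* a sequence of regularization parameters *)
  (eta_ : nat -> R) (eta_gt0 : forall n, 0 < eta_ n)
  (eta_cvg0 : eta_ n @[n --> \oo] --> 0) :
  exists n_ : nat -> nat, {homo n_ : i j / (i < j)%N} /\
  let e k := eta_ (n_ k) in
  exists (p v al ep th : R -> R) (s : R),
  [/\ [/\ Lp H 1 p, sobolev H 1 1 v, sobolev H 2 +oo%E al,
          sobolev H 1 +oo%E ep & sobolev H 1 +oo%E th],
      [/\ wstar_W1oo H (fun k => ep_ (e k)) ep /\
          weak_W11 H (fun k => v_ (e k)) v,
          weak_L1 H (fun k => p_ (e k)) p,
          wstar_W2oo H (fun k => al_ (e k)) al,
          strong_H1 H (fun k => th_ (e k)) th
        & s_ (e k) @[k --> \oo] --> s],
      {ae lebesgue_measure, forall x, dom H x -> p x = flow_map mu s (th x)},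
      classical_limit_solution H vinf thinf kappa ell Gc Rd C f0 f1
        ep v p al th s
    & {within dom H, continuous p} /\ C1_on (dom H) v].

Proof.
have k0 := kappa_gt0; have l0 := ell_gt0; have G0 := Gc_gt0; have H0 := H_gt0.
have Rdc := Rd_cont Rd_potential mu_nondecr mu_nonincr mu_inf mu_modulus.
have Rd0 := Rd_ge0 Rd_coercive.
have flowm := flow_min Rd_potential mu_nondecr mu_nonincr mu_inf Rd_coercive mu_modulus.
have flowc := flow_cont Rd_potential Rd_convex mu_nondecr mu_nonincr mu_inf Rd_coercive mu_modulus.
have flowg := flow_uniform_growth Rd_potential Rd_convex mu_nondecr mu_nonincr mu_inf
  Rd_coercive mu_modulus.
have [cf0 cf1] := f_cont.
have f1i := deriv_gt0_incr f1_incr.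
have f0i a b : a < b -> f0 b < f0 a.
  have := @deriv_gt0_incr R (fun t => - f0 t) _ a b; rewrite ltrN2; apply => t.
  have [d1 d2] := f0_decr t; split; first exact: derivableN.
  by rewrite derive1E deriveN// -derive1E oppr_gt0.
pose c0 := inf (range C).
have Cc0 a : c0 <= C a by apply: inf_le => //; exists a.
have Cpos a : 0 < C a by apply: lt_le_trans (Cc0 a).
have Cn0 a : C a != 0 by rewrite gt_eqF.
have CC : C1 C (derive1 C).
  by split => // a; rewrite derive1E; exact: derivableP.
have cC := C1_cont CC.
have DH : dom H H by apply/domE/andP; split; lra.
have DNH : dom H (- H) by apply/domE/andP; split; lra.
pose lo := Num.min 0 thinf; pose hi := Num.max 0 thinf.
pose P n := p_ (eta_ n); pose TH n := th_ (eta_ n); pose AL n := al_ (eta_ n).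
pose SS n := s_ (eta_ n); pose VV n := v_ (eta_ n); pose EP n := ep_ (eta_ n).
have soln n : fixed_point_solution H vinf thinf kappa ell Gc mu Rd C f0 f1 phi0 phi1
   (eta_ n) (EP n) (VV n) (P n) (AL n) (TH n) (SS n) by exact: sol.
have cP n : {within dom H, continuous (P n)} by have [[[_ []]]] := soln n.
have cTH n : {within dom H, continuous (TH n)} by have [[[_ _ _ []]]] := soln n.
have cAL n : {within dom H, continuous (AL n)} by have [[[_ _ []]]] := soln n.
have cVV n : {within dom H, continuous (VV n)} by have [[[[]]]] := soln n.
have reg n := solution_C2 H0 G0 l0 k0 cC C_deriv_cont Cn0 cf0 cf1 (soln n).
(* Each pair consists of a C^2 function on the line that agrees with the damage on D, and its
   derivative; the next choice does the same for the aging. *)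
have /choice[A_ regA] : forall n, exists A : (R -> R) * (R -> R), [/\ C1 A.1 A.2,
    C1 A.2 (fun x => damage_rhs Gc ell C (SS n) (AL n (clamp H x))) &
    forall x, dom H x -> AL n x = A.1 x].
  by move=> n; have [[A [A1 h]] _] := reg n; exists (A, A1).
have /choice[T_ regT] : forall n, exists T : (R -> R) * (R -> R), [/\ C1 T.1 T.2,
    C1 T.2 (fun x => aging_rhs kappa f0 f1 (P n (clamp H x)) (TH n (clamp H x))) &
    forall x, dom H x -> TH n x = T.1 x].
  by move=> n; have [_ [T [T1 h]]] := reg n; exists (T, T1).
have bcA n : AL n (- H) = 1 /\ AL n H = 1 by have [[_ _ _ _ [_ _ h _]] _ _ _ _] := soln n.
have bcT n : TH n (- H) = thinf /\ TH n H = thinf by have [[_ _ _ _ [_ _ _ h]] _ _ _ _] := soln n.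
have bcV n : VV n (- H) = - vinf /\ VV n H = vinf by have [[_ _ _ _ [h _ _ _]] _ _ _ _] := soln n.
have thI n x : dom H x -> lo <= TH n x <= hi.
  have [TC T1C TE] := regT n; have [t1 t2] := bcT n.
  move=> Dx; rewrite TE//.
  apply: (aging_bounds H0 k0 f1i f1_0 f0i f0_thinf TC T1C (p := P n)) => //; rewrite -?TE//.
  by move=> y Dy; rewrite clampE// /aging_rhs -TE// [RHS]mulrC divfK// gt_eqF.
have [Emax etaE] := cvg_seq_le eta_cvg0.
have sP n : sobolev H 1 2%:E (P n) by have [_ [[[[]]]]] := soln n.
have intP n : \int[lebesgue_measure]_(x in dom H) P n x = 2 * vinf.
  by have [_ [[[_ ? ]]]] := soln n.
have lmP n : lagrange_multiplier H vinf (eta_ n) Rd (TH n) (P n) (SS n).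
  by have [_ _] := soln n.
have [K hK] := multiplier_bound Rdc Rd0 vinf lo hi Emax H0.
have SK n : `|SS n| <= K /\ \int[lebesgue_measure]_(x in dom H) Rd (P n x) (TH n x) <= K.
  exact: (hK (eta_ n) _ _ _ (eta_gt0 n) (etaE n) (cTH n) (thI n) (sP n) (intP n) (lmP n)).
have iP n := cont_integ (cP n).
(* Superlinear growth with slope 1 turns the bound on the dissipated energy into a bound in L^1. *)
have [M M0 RdM] := Rd_superlinear Rd_coercive (@ler01 R).
pose B := M * (H + H) + K.
have PB n : \int[lebesgue_measure]_(x in dom H) `|P n x| <= B.
  have iR := cont_integ (Rd_comp_cont Rdc H0 (cP n) (cTH n)).
  have iM : integ H (fun=> M) by apply/cont_integ/continuous_subspaceT => x; exact: cvg_cst.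
  apply: (@le_trans _ _ (\int[lebesgue_measure]_(x in dom H) (M + Rd (P n x) (TH n x)))).
    apply: le_Rintegral => //; [exact: integ_norm|exact: integD|].
    by move=> x _; have := RdM (P n x) (TH n x); rewrite !mul1r.
  by rewrite RintegralD// integral_cst_dom// lerD2l; exact: (SK n).2.
have B0 : 0 <= B by apply: le_trans (PB 0%N); exact: Rintegral_ge0.
have [F0 F00 f0B] := continuous_bounded_itv lo hi cf0.
have [F1 F10 f1B] := continuous_bounded_itv lo hi cf1.
have ragc : continuous (fun z : R * R => aging_rhs kappa f0 f1 z.1 z.2).
  exact: aging_rhs_cont.
have rdac : continuous (fun z : R * R => damage_rhs Gc ell C z.1 z.2).
  exact: damage_rhs_cont.
have icst c : integ H (fun=> c) by apply/cont_integ/continuous_subspaceT => x; exact: cvg_cst.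
(* The second derivative of the aging is controlled in L^1 only, because the strain rate is; the
   constant is the integral of [(F1 * |P n| + F0) / kappa], estimated with [B]. *)
have THL n x y : dom H x -> dom H y ->
    `|TH n x - TH n y| <= (F1 * B + F0 * (H + H)) / kappa * `|x - y|.
  have [TC T1C TE] := regT n; have [t1 t2] := bcT n.
  move=> Dx Dy; rewrite !TE//; apply: (C2_lipschitz H0 TC T1C) => //; first by rewrite -!TE// t1.
  have iP1 := integ_norm (iP n).
  have ir : integ H _ := cont_integ (continuous_subspaceT T1C.2).
  have iF : integ H (fun x => F1 * `|P n x| + F0) := integD (integZ F1 iP1) (icst F0).
  apply: (@le_trans _ _ (\int[lebesgue_measure]_(x in dom H)
      (kappa^-1 * (F1 * `|P n x| + F0)))).
    apply: le_Rintegral => //; [exact: integ_norm|exact: integZ|] => z Dz.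
    rewrite clampE// /aging_rhs normrM normfV (gtr0_norm k0) mulrC ler_wpM2l ?invr_ge0 ?(ltW k0)//.
    apply: le_trans (ler_normB _ _) _; rewrite normrM normr_id mulrC.
    have zI := thI n _ Dz; apply: lerD; last exact: f0B.
    by rewrite ler_wpM2r// f1B.
  rewrite RintegralZl// RintegralD//; [|exact: integZ|exact: icst].
  rewrite RintegralZl// integral_cst_dom// mulrC ler_wpM2r ?invr_ge0 ?(ltW k0)//.
  by rewrite lerD2r ler_wpM2l.
pose Sb := K ^+ 2 / c0 * (ell ^+ 2 / Gc) + 1.
have ALb n x : dom H x -> `|AL n x - 1| <= Sb.
  have [AC A1C AE] := regA n; have [a1 a2] := bcA n.
  move=> Dx; rewrite AE//.
  apply: (damage_bounds H0 l0 G0 C_inf CC Cc0 (SK n).1 AC A1C) => //; rewrite -?AE//.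
  move=> y Dy; rewrite clampE// /damage_rhs -AE// [RHS]mulrC divfK//.
  by rewrite mulf_neq0 ?expf_neq0// gt_eqF.
(* The damage equation is free of the strain rate, so its second derivatives are bounded
   pointwise. *)
have [Kd Kd0 hKd] := continuous_bounded_rect (- K) K (1 - Sb) (1 + Sb) rdac.
have ALL n x y : dom H x -> dom H y ->
    `|AL n x - AL n y| <= (Kd * (H + H)) * `|x - y|.
  have [AC A1C AE] := regA n; have [a1 a2] := bcA n.
  move=> Dx Dy; rewrite !AE//; apply: (C2_lipschitz H0 AC A1C) => //; first by rewrite -!AE// a1.
  have ir : integ H _ := cont_integ (continuous_subspaceT A1C.2).
  rewrite -integral_cst_dom//; apply: le_Rintegral => //; [exact: integ_norm|exact: icst|].
  move=> z Dz; rewrite clampE//; apply: hKd; first by rewrite -ler_norml; exact: (SK n).1.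
  by have := ALb n z Dz; rewrite ler_norml => /andP[? ?]; apply/andP; split; lra.
(* Three nested extractions, for stress, aging and damage; [n_] is their composition. *)
have [n1 n1i [s s_cvg]] := bolzano_weierstrass (fun n => (SK n).1).
have THM n x : dom H x -> `|TH n x| <= `|lo| + `|hi|.
  move=> /(thI n) /andP[h1 h2]; rewrite ler_norml.
  by have := ler_norm hi; have := ler_norm (- lo); have := normr_ge0 hi; have := normr_ge0 lo;
   rewrite normrN => *; apply/andP; split; lra.
have L10 : 0 <= (F1 * B + F0 * (H + H)) / kappa.
  by rewrite divr_ge0 ?(ltW k0)// addr_ge0 ?mulr_ge0// addr_ge0// ltW.
have [n2 n2i [th thL th_cvg]] := ascoli_lipschitz H0 L10 (fun n => THM (n1 n))
  (fun n => THL (n1 n)).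
have ALM n x : dom H x -> `|AL n x| <= Sb + 1.
  move=> /(ALb n) h; rewrite -[AL n x](subrK 1); apply: le_trans (ler_normD _ _) _.
  by rewrite normr1 lerD2r.
have L20 : 0 <= Kd * (H + H) by rewrite mulr_ge0// addr_ge0// ltW.
have [n3 n3i [al alL al_cvg]] := ascoli_lipschitz H0 L20 (fun n => ALM (n1 (n2 n)))
  (fun n => ALL (n1 (n2 n))).
pose n_ k := n1 (n2 (n3 k)).
have n_i : {homo n_ : i j / (i < j)%N} by move=> i j ij; apply/n1i/n2i/n3i.
have n23i : {homo (n2 \o n3) : i j / (i < j)%N} by move=> i j ij; apply/n2i/n3i.
have e_cvg : eta_ (n_ k) @[k --> \oo] --> 0.
  exact: cvg_comp (increasing_cvg n_i) eta_cvg0.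
have {}s_cvg : SS (n_ k) @[k --> \oo] --> s.
  exact: cvg_comp (increasing_cvg n23i) s_cvg.
have {}th_cvg : unif_cvg H (fun k => TH (n_ k)) th := unif_cvg_subseq n3i th_cvg.
have cth := lipschitz_within thL; have cal := lipschitz_within alL.
have thlim := unif_cvg_bounds th_cvg (fun k => thI (n_ k)).
(* The limit strain rate is defined from the limits of stress and aging, and only then shown to be
   the limit. *)
pose p x := flow_map mu s (th (clamp H x)).
have cp : continuous p.
  move=> x; apply: (@continuous_comp _ _ _ (fun x => th (clamp H x)) (flow_map mu s)).
    exact: clamp_comp_cont.
  exact: flowc.
have [Mp Mp0 pM'] := continuous_bounded_itv lo hi (flowc s).
have pM x : `|p x| <= Mp by apply/pM'/thlim/clamp_dom.
have p_cvg : L1_cvg H (fun k => P (n_ k)) p.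
  have [mo [mo_small Rmo]] := Rd_modulus Rd_potential mu_nondecr mu_nonincr mu_inf mu_modulus.
  apply: (minimizers_L1_cvg Rdc H0 mo_small Rmo (fun k => eta_gt0 (n_ k)) e_cvg s_cvg
    (fun k => cTH (n_ k)) cth thlim th_cvg (fun k => sP (n_ k)) (fun k => PB (n_ k))
    (fun k => lmP (n_ k)) cp pM).
  - by move=> x q Dx; rewrite /p clampE//; exact: flowm.
  - move=> d d0; have [c c_gt0 hc] := flowg s d _ d0 (@segment_compact _ lo hi).
    exists c => // x q Dx; rewrite /p clampE// => hq; apply: hc => //.
    by rewrite /= in_itv; exact: thlim.
have ip := cont_integ (continuous_subspaceT cp : {within dom H, continuous p}).
have [T [T1 [TC T1C thT T1_cvg]]] : exists T T1, [/\ C1 T T1,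
    C1 T1 (fun x => aging_rhs kappa f0 f1 (p x) (th (clamp H x))),
    forall x, dom H x -> th x = T x & unif_cvg H (fun k => (T_ (n_ k)).2) T1].
  have regTk k := regT (n_ k).
  have cr : continuous (fun x => aging_rhs kappa f0 f1 (p x) (th (clamp H x))).
    apply: (@joint_cont _ (aging_rhs kappa f0 f1)) => //; exact: clamp_comp_cont.
  apply: (@C2_limit _ H (fun k => (T_ (n_ k)).1) (fun k => (T_ (n_ k)).2)
    (fun k x => aging_rhs kappa f0 f1 (P (n_ k) (clamp H x)) (TH (n_ k) (clamp H x)))) => //.
  - by move=> k; have [] := regTk k.
  - by move=> k; have [] := regTk k.
  - have crk k : continuous (fun x => aging_rhs kappa f0 f1 (P (n_ k) (clamp H x))
        (TH (n_ k) (clamp H x))) by have [_ []] := regTk k.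
    have chk k : continuous (fun x => aging_rhs kappa f0 f1 (p x) (TH (n_ k) (clamp H x))).
      by apply: (@joint_cont _ (aging_rhs kappa f0 f1)) => //; exact: clamp_comp_cont.
    have h_cvg : unif_cvg H (fun k x => aging_rhs kappa f0 f1 (p x) (TH (n_ k) (clamp H x)))
        (fun x => aging_rhs kappa f0 f1 (p x) (th (clamp H x))).
      apply: (unif_cvg_eq _ _ (@unif_cvg_joint _ H _ (fun=> p) (fun k => TH (n_ k)) p th H0
        ragc (continuous_subspaceT cp) cth _ th_cvg)).
      + by move=> k x Dx; rewrite clampE.
      + by move=> x Dx; rewrite clampE.
      + by move=> e e0; apply: nearW => k x _; rewrite subrr normr0 ltW.
    have ih k := cont_integ (continuous_subspaceT (chk k) : {within dom H, continuous _}).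
    have ir k := cont_integ (continuous_subspaceT (crk k) : {within dom H, continuous _}).
    have ir0 := cont_integ (continuous_subspaceT cr : {within dom H, continuous _}).
    have cF : 0 <= F1 / kappa by rewrite divr_ge0// ltW.
    (* The strain rate is exchanged first, at a cost of [F1 / kappa] times its L^1 error. What
       remains has the fixed continuous strain rate [p], so exchanging the aging is a matter of
       uniform convergence. *)
    apply: (L1_cvg_le cF ir ir0 (fun k => iP (n_ k)) ip ih ir0 _ p_cvg).
      move=> k x Dx; rewrite !clampE//.
      apply: le_trans (ler_distD (aging_rhs kappa f0 f1 (p x) (TH (n_ k) x)) _ _) _.
      rewrite lerD2r /aging_rhs -mulrBl normrM normfV (gtr0_norm k0) mulrAC.
      rewrite ler_pM2r ?invr_gt0// opprB addrA subrK -mulrBl normrM mulrC.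
      apply: ler_pM => //; [exact: f1B (thI _ _ Dx)|exact: ler_dist_dist].
    exact: unif_L1_cvg.
  apply: unif_cvg_eq th_cvg => // k x Dx; by have [_ _ ->] := regTk k.
have ral_cvg : unif_cvg H (fun k x => damage_rhs Gc ell C (SS (n_ k)) (AL (n_ k) (clamp H x)))
    (fun x => damage_rhs Gc ell C s (al (clamp H x))).
  apply: (unif_cvg_eq _ _ (@unif_cvg_joint _ H _ (fun k _ => SS (n_ k))
    (fun k => AL (n_ k)) (fun=> s) al H0 rdac _ cal (unif_cvg_cst H s_cvg) al_cvg)).
  - by move=> k x Dx; rewrite clampE.
  - by move=> x Dx; rewrite clampE.
  - by apply: continuous_subspaceT => x; exact: cvg_cst.
have [A [A1 [AC A1C alA A1_cvg]]] : exists A A1, [/\ C1 A A1,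
    C1 A1 (fun x => damage_rhs Gc ell C s (al (clamp H x))),
    forall x, dom H x -> al x = A x & unif_cvg H (fun k => (A_ (n_ k)).2) A1].
  have regAk k := regA (n_ k).
  have cr : continuous (fun x => damage_rhs Gc ell C s (al (clamp H x))).
    apply: (@joint_cont _ (damage_rhs Gc ell C) (fun=> s)) => //.
      by move=> x; exact: cvg_cst.
    exact: clamp_comp_cont.
  apply: (@C2_limit _ H (fun k => (A_ (n_ k)).1) (fun k => (A_ (n_ k)).2)
    (fun k x => damage_rhs Gc ell C (SS (n_ k)) (AL (n_ k) (clamp H x)))) => //.
  - by move=> k; have [] := regAk k.
  - by move=> k; have [] := regAk k.
  - apply: unif_L1_cvg => //.
      move=> k; apply/cont_integ/continuous_subspaceT; by have [_ []] := regAk k.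
    exact/cont_integ/continuous_subspaceT.
  apply: unif_cvg_eq al_cvg => // k x Dx; by have [_ _ ->] := regAk k.
have regAk k := regA (n_ k); have regTk k := regT (n_ k).
have AkC k : C1 (A_ (n_ k)).1 (A_ (n_ k)).2 by have [] := regAk k.
have TkC k : C1 (T_ (n_ k)).1 (T_ (n_ k)).2 by have [] := regTk k.
have AkE k x : dom H x -> AL (n_ k) x = (A_ (n_ k)).1 x by have [_ _ + Dx] := regAk k; apply.
have TkE k x : dom H x -> TH (n_ k) x = (T_ (n_ k)).1 x by have [_ _ + Dx] := regTk k; apply.
have A_cvg : unif_cvg H (fun k => (A_ (n_ k)).1) A := unif_cvg_eq AkE alA al_cvg.
have T_cvg : unif_cvg H (fun k => (T_ (n_ k)).1) T := unif_cvg_eq TkE thT th_cvg.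
have cA : {within dom H, continuous A} := continuous_subspaceT (C1_cont AC).
have cA1 : {within dom H, continuous A1} := continuous_subspaceT (C1_cont A1C).
have bcAl : A (- H) = 1 /\ A H = 1.
  split; rewrite -alA//; apply: (unif_cvg_limit al_cvg) => // k;
    [exact: (bcA _).1|exact: (bcA _).2].
have bcTl : T (- H) = thinf /\ T H = thinf.
  split; rewrite -thT//; apply: (unif_cvg_limit th_cvg) => // k;
    [exact: (bcT _).1|exact: (bcT _).2].
have vp k : is_weak_deriv H (VV (n_ k)) (P (n_ k)).
  by have [[_ [_ h] _ _ _] _ _ _ _] := soln (n_ k).
have [Vp VpC] := primitive cp.
(* The constant normalizes the value at [- H]. The value at [H] is inherited from the
   approximations, whose distance to [v] is at most the L^1 distance of the strain rates. *)
pose v x := Vp x - (Vp (- H) + vinf).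
have vC : C1 v p by apply: (C1_eq (C1B VpC (C1_cst (Vp (- H) + vinf)))) => x; rewrite subr0.
have v_cvg : unif_cvg H (fun k => VV (n_ k)) v.
  move=> e e0; move/cvgrPdist_le : p_cvg => /(_ e e0); apply: filterS => k.
  rewrite sub0r normrN ger0_norm ?Rintegral_ge0// => hk x Dx; apply: le_trans hk.
  have [V VC VE] := velocity_primitive H0 (cVV (n_ k)) (cP (n_ k)) (vp k).
  have := C1_increment_L1 (C1B VC vC) Dx DNH.
  rewrite -!VE// (bcV _).1 (_ : v (- H) = - vinf) ?subrr ?subr0; last by rewrite /v; ring.
  move=> /le_trans; apply; rewrite le_eqVlt; apply/orP; left; apply/eqP.
  by apply: eq_Rintegral => z /set_mem Dz; rewrite clampE.
have bcVl : v (- H) = - vinf /\ v H = vinf.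
  split; first by rewrite /v; ring.
  by apply: (unif_cvg_limit v_cvg) => // k; exact: (bcV _).2.
have cv : {within dom H, continuous v} := continuous_subspaceT (C1_cont vC).
have iVV k := cont_integ (cVV (n_ k)); have iv := cont_integ cv.
have sv k : sobolev H 1 1 (VV (n_ k)) by have [[[h _ _ _] _ _ _ _] _ _ _ _] := soln (n_ k).
have [svl _ _] := C1_sobolev1 H0 vC (fun x _ => erefl).
have [_ wv] := C1_wderiv H0 vC (fun x _ => erefl).
have CA_n0 (F : R -> R) x : C (F x) != 0 by [].
(* Since [C] is only of class C^1, so is the strain; its derivative converges uniformly because it
   involves the damage and its first derivative only. *)
pose ep x := s * (C (A x))^-1.
have epC : C1 ep (fun x => s * - (A1 x * derive1 C (A x) / C (A x) ^+ 2)).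
  exact: (C1Z s (C1V (C1_comp AC CC) (CA_n0 A))).
pose E_ k x := SS (n_ k) * (C ((A_ (n_ k)).1 x))^-1.
have E_C k : C1 (E_ k) (fun x => SS (n_ k) * - ((A_ (n_ k)).2 x *
    derive1 C ((A_ (n_ k)).1 x) / C ((A_ (n_ k)).1 x) ^+ 2)).
  exact: (C1Z (SS (n_ k)) (C1V (C1_comp (AkC k) CC) (CA_n0 _))).
have EE k x : dom H x -> EP (n_ k) x = E_ k x.
  by move=> Dx; have [_ _ _ _ ->//] := soln (n_ k); rewrite /E_ -AkE.
have cst_within c : {within dom H, continuous (fun _ : R => c : R)}.
  by apply: continuous_subspaceT => x; exact: cvg_cst.
have cCV : continuous (fun a => (C a)^-1) by move=> a; apply: cvgV => //; exact: cC.
have cCd : continuous (fun a => - (derive1 C a / C a ^+ 2)).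
  move=> a; apply: cvgN; apply: cvgM; first exact: C_deriv_cont.
  by apply: cvgV; [rewrite expf_neq0|apply: (@cvgM _ _ _ _ C C); exact: cC].
have S_cvg := unif_cvg_cst H s_cvg.
have CAV_within : {within dom H, continuous (fun x => (C (A x))^-1)}.
  apply: continuous_subspaceT => x; apply: (@continuous_comp _ _ _ A (fun a => (C a)^-1)).
    exact: (C1_cont AC).
  exact: cCV.
have cCAd : continuous (fun x => - (derive1 C (A x) / C (A x) ^+ 2)).
  move=> y; apply: (@continuous_comp _ _ _ A (fun a => - (derive1 C a / C a ^+ 2))).
    exact: (C1_cont AC).
  exact: cCd.
have CAd_within := continuous_subspaceT cCAd : {within dom H, continuous _}.
have E_cvg : unif_cvg H E_ ep.
  by apply: unif_cvgM => //; exact: unif_cvg_comp cCV cA A_cvg.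
have E1_cvg : unif_cvg H (fun k x => SS (n_ k) * - ((A_ (n_ k)).2 x *
    derive1 C ((A_ (n_ k)).1 x) / C ((A_ (n_ k)).1 x) ^+ 2))
    (fun x => s * - (A1 x * derive1 C (A x) / C (A x) ^+ 2)).
  have h := unif_cvgM H0 cA1 CAd_within A1_cvg (unif_cvg_comp H0 cCd cA A_cvg).
  apply: (unif_cvg_eq _ _ (unif_cvgM H0 (cst_within s) _ S_cvg h)).
  - by move=> k x _ /=; rewrite mulrN mulrA.
  - by move=> x _ /=; rewrite mulrN mulrA.
  - apply: continuous_subspaceT => y; apply: cvgM; first exact: (C1_cont A1C).
    exact: cCAd.
have [_ _ sep] := C1_sobolev1 H0 epC (fun x _ => erefl).
have sA := C2_sobolev2 H0 AC A1C (fun x _ => erefl).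
have [_ _ sT] := C1_sobolev1 H0 TC (fun x _ => erefl).
have pT x : dom H x -> p x = flow_map mu s (T x) by move=> Dx; rewrite /p clampE// thT.
(* The C^2 functions [A] and [T] on the line serve as limits; on D they coincide with the extracted
   [al] and [th]. *)
exists n_; split => // e; exists p, v, A, ep, T, s; split.
- by split => //; exact/Lp1P.
- split.
  + split; first exact: (C1_wstar_W1oo H0 E_C epC EE E_cvg E1_cvg).
    split => //.
      by apply: L1_weak => //; exact: unif_L1_cvg.
    have wvk k := wderivP H0 (vp k).
    have [dv _] := C1_wderiv H0 vC (fun x _ => erefl).
    have [[_ /Lp1P iwv _] _] := wderivP H0 dv.
    have iwk k : integ H (wderiv H (VV (n_ k))) by have [[_ /Lp1P]] := wvk k.
    apply: L1_weak => //.
    (* The chosen weak derivatives of the velocities agree almost everywhere with the strain rates,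
       whose L^1 convergence they inherit. *)
    apply: (L1_cvg_ae (fun k => iP (n_ k)) ip _ _ _ _ p_cvg).
    * by move=> k; exact: integ_measurable (iwk k).
    * exact: integ_measurable iwv.
    * by move=> k; have [_ h] := wvk k; apply: ae_imply h => x h /h ->.
    * by apply: ae_imply wv => x h /h ->.
  + exact: (L1_weak (fun k => iP (n_ k)) ip p_cvg).
  + apply: (C2_wstar_W2oo H0 AkC _ AC A1C AkE A_cvg A1_cvg ral_cvg).
    by move=> k; have [] := regAk k.
  + exact: (C1_strong_H1 H0 TkC TC TkE T_cvg T1_cvg).
  + exact: s_cvg.
- exact: aeW.
- split.
  + have epE x : C (A x) * ep x = s by rewrite /ep mulrCA divff ?mulr1.
    split; first by move=> x _; exact: epE.
    by apply: (C1_deriv_on (C1_cst s)) => x _; exact: epE.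
  + exact: (C1_deriv_on vC (fun x _ => erefl)).
  + split.
      exists A1, (fun x => damage_rhs Gc ell C s (al (clamp H x))); split.
      * exact: (C1_deriv_on AC (fun x _ => erefl)).
      * exact: (C1_deriv_on A1C (fun x _ => erefl)).
      * move=> x Dx; rewrite clampE// alA// /damage_rhs /ep; field.
        by rewrite Cn0 !gt_eqF.
    exists T1, (fun x => aging_rhs kappa f0 f1 (p x) (th (clamp H x))); split.
    * exact: (C1_deriv_on TC (fun x _ => erefl)).
    * exact: (C1_deriv_on T1C (fun x _ => erefl)).
    * by move=> x Dx; rewrite clampE// thT// /aging_rhs [RHS]mulrC divfK// gt_eqF.
  + by move=> x Dx q; have := flowm s (T x) q; rewrite -pT//; lra.
  + by split.
split; first exact: continuous_subspaceT.
by exists p; [exact: (C1_deriv_on vC (fun x _ => erefl))|exact: continuous_subspaceT].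
Qed.
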